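(* Let $X=(X(t))_{t\ge0}$, $X(0)=0$, be a real-valued Lévy process with Gaussian coefficient $\sigma>0$, arbitrary drift $\gamma\in\mathbb R$, and Lévy measure $\rho$, i.e. $E e^{isX(t)}=e^{t\psi(s)}$ with $$\psi(s)=i\gamma s-\frac{\sigma^2s^2}{2}+\int_{-\infty}^{\infty}\big(e^{isx}-1-isx\mathbf 1(|x|\le1)\big)\rho(dx).$$ Assume $\rho((0,\infty))>0$, $\rho((-\infty,0))<\infty$, and that for some $a>0$ with $\rho((a,\infty))>0$ the probability measure $\mu_a(\cdot)=\rho(\cdot\cap(a,\infty))/\rho((a,\infty))$ has a light right tail. Then $$\lim_{u\to\infty}\frac{P\big(\sup_{0\le t\le1}X(t)>u\big)}{P(X(1)>u)}=1 .$$
   Context: A Lévy measure $\rho$ is a Borel measure on $\mathbb R$ with $\int\min\{1,x^2\}\rho(dx)<\infty$. A random variable $X$ (or its distribution) has a light right tail if either (i) $P(X>u)>0$ for all $u>0$ and $\lim_{u\to\infty}P(X_1>u)/P(X_1+X_2>u)=0$, where $X_1,X_2$ are independent copies of $X$; or (ii) there are constants $A>0,\alpha>0$ with $X\le A$ a.s. and $P(X>\alpha)>0$. *)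

(* Defs.v *)
From HB Require Import structures.
From mathcomp Require Import all_boot all_order all_algebra.
From mathcomp Require Import all_classical all_reals all_analysis.
Set Implicit Arguments. Unset Strict Implicit. Unset Printing Implicit Defensive.
Import Order.TTheory GRing.Theory Num.Theory numFieldNormedType.Exports.
Local Open Scope classical_set_scope.
Local Open Scope ring_scope.

Definition levy_measure (R : realType) (rho : {measure set R -> \bar R}) : Prop :=
  (\int[rho]_x (Num.min 1 (x ^+ 2))%:E < +oo)%E.

Definition mutually_independent d (T : measurableType d) (R : realType)
    (P : probability T R) (n : nat) (Y : 'I_n -> T -> R) : Prop :=
  forall B : 'I_n -> set R, (forall i, measurable (B i)) ->
    P (\bigcap_(i in [set: 'I_n]) (Y i @^-1` B i)) =
    (\prod_(i < n) P (Y i @^-1` B i))%E.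

Definition levy_process d (T : measurableType d) (R : realType)
    (P : probability T R) (X : R -> T -> R) : Prop :=
  [/\ (forall w, X 0 w = 0),
      (forall t, 0 <= t -> measurable_fun setT (X t)),
      (forall w t, 0 <= t ->
         (fun r => X r w) @ t^'+ --> X t w /\
         (0 < t -> cvg ((fun r => X r w) @ t^'-))),
      (forall (n : nat) (t : nat -> R), 0 <= t 0%N ->
         (forall i, (i < n)%N -> t i < t i.+1) ->
         mutually_independent P (fun i : 'I_n => fun w => X (t i.+1) w - X (t i) w)) &
      (forall s h, 0 <= s -> 0 <= h -> forall B : set R, measurable B ->
         P [set w | B (X (s + h) w - X s w)] = P (X h @^-1` B))].

(* Real and imaginary parts of the Lévy exponent
   psi(s) = i gamma s - sigma^2 s^2/2 + \int (e^{isx} - 1 - isx 1(|x|<=1)) rho(dx). *)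
Definition psi_re (R : realType) (sigma : R) (rho : {measure set R -> \bar R}) (s : R) : R :=
  - (sigma ^+ 2 * s ^+ 2) / 2 + Rintegral rho setT (fun x => cos (s * x) - 1).

Definition psi_im (R : realType) (gamma : R) (rho : {measure set R -> \bar R}) (s : R) : R :=
  gamma * s + Rintegral rho setT
    (fun x => sin (s * x) - (if `|x| <= 1 then s * x else 0)).

(* E e^{isX(t)} = e^{t psi(s)}, written with real and imaginary parts. *)
Definition has_char_exponent d (T : measurableType d) (R : realType)
    (P : probability T R) (X : R -> T -> R) (gamma sigma : R)
    (rho : {measure set R -> \bar R}) : Prop :=
  forall t s, 0 <= t ->
    Rintegral P setT (fun w => cos (s * X t w)) =
      expR (t * psi_re sigma rho s) * cos (t * psi_im gamma rho s) /\
    Rintegral P setT (fun w => sin (s * X t w)) =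
      expR (t * psi_re sigma rho s) * sin (t * psi_im gamma rho s).

(* Light right tail of a probability distribution mu on R.  P(X1 + X2 > u)
   for independent copies X1, X2 is the product measure mu \x mu of the
   half-plane {(x,y) | x + y > u}. *)
Definition light_right_tail (R : realType) (mu : probability R R) : Prop :=
  ((forall u : R, 0 < u -> (0 < mu [set x : R | (u < x)%R])%E) /\
   (fun u : R => fine (mu [set x | u < x]) /
                 fine ((mu \x mu)%E [set p : R * R | u < p.1 + p.2]))
     @ +oo --> (0 : R))
  \/
  (exists A alpha : R, [/\ 0 < A, 0 < alpha,
      mu [set x | A < x] = 0%E & (0 < mu [set x : R | (alpha < x)%R])%E]).

(* Main.v *)
(* Write [X(1) = X(1/2) + (X(1) - X(1/2))]. By Ottaviani's inequality the supremum over [0, 1/2]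
   exceeds [u] with probability at most [C P(X(1/2) > u - K)], which is [o(P(X(1) > u))]: the part
   of the process without large positive jumps has a much lighter tail than many large jumps, and
   a light right tail makes any given number of large jumps negligible against one more.

   On [1/2, 1] the supremum is [X(1/2) + M], with [M] independent of [X(1/2)]. Ottaviani's
   inequality on the last time window of length [d] yields
   [P(M > x) <= (1 + o(1)) P(X(1) - X(1/2) > x - e) + C P(X(1-d) - X(1/2) > x - K)]
   provided [d / e ^ 2] is small. The window and the tolerance [e] are chosen as functions of the
   value [w] of the Gaussian part of [X(1/2)], with [e] a small multiple of [1 / w]: a Gaussian
   tail at level [w] is insensitive to such a shift. The second term is negligible as before for
   bounded [w], and for large [w] by a translation of the Gaussian density.

   The tail estimates are proved for compound Poisson approximations and pass to the limit by
   convergence of characteristic functions, the Gaussian factor making all tails Lipschitz. *)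
Require Import Defs.
From HB Require Import structures.
From mathcomp Require Import all_boot all_order all_algebra.
From mathcomp Require Import all_classical all_reals all_analysis.
From mathcomp Require Import measurable_realfun ring lra.
Set Implicit Arguments. Unset Strict Implicit. Unset Printing Implicit Defensive.
Import Order.TTheory GRing.Theory Num.Theory numFieldNormedType.Exports.
Local Open Scope classical_set_scope.
Local Open Scope ring_scope.

(** * Expectations of bounded functions, convolutions, tails *)

Section bounded_measurable.
Context d (T : measurableType d) (R : realType).
Implicit Types (P : probability T R) (f g : T -> R).

(** The obstacle is that [P(X(1) > u - e)] need not be close to [P(X(1) > u)]: with light jumps the
    ratio may diverge for every fixed [e > 0]. The jumps thus leave no room for the loss [e] in
    Ottaviani's inequality; only the Gaussian summand does, and less of it the higher its level. A
    vanishing [e] forces the window [d] to vanish too, and then the second term compares two times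
    that are only [d] apart: a rise by a fixed amount within time [d] takes some number [k] of jumps
    and costs a factor of order [d ^- k]. With [d] exponentially small in the Gaussian level [w]
    this cost becomes [exp (kap * w)], and the decay rate of [d] is taken so small that translating
    the Gaussian by 1 repays it.

    The cutoff [b] for large jumps satisfies [4 * b <= a]. Chernoff's bound with exponent [theta]
    for jumps of size at most [b] costs [exp (theta * b)]; steps of length [4 * b] allow [theta] so
    small that this is only the square root of the number of jumps, while the exponential gain is
    still twice what these jumps cost. *)

Definition bdm f := measurable_fun setT f /\ exists M, forall x, `|f x| <= M.

Lemma bdm_integrable P f : bdm f -> P.-integrable setT (EFin \o f).
Proof.
move=> [mf [M fM]]; apply: measurable_bounded_integrable => //.
  by rewrite (le_lt_trans (probability_le1 P _)) ?ltry.
exists M; split; first by rewrite num_real.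
by move=> x Mx y _ /=; rewrite (le_trans (fM y))// ltW.
Qed.

Lemma bdm_cst (c : R) : bdm (fun=> c).
Proof. by split; [exact: measurable_cst|exists `|c|]. Qed.

Lemma bdmD f g : bdm f -> bdm g -> bdm (fun x => f x + g x).
Proof.
move=> [mf [M fM]] [mg [N gN]]; split; first exact: measurable_funD.
by exists (M + N) => x; rewrite (le_trans (ler_normD _ _))// lerD.
Qed.

Lemma bdmM f g : bdm f -> bdm g -> bdm (fun x => f x * g x).
Proof.
move=> [mf [M fM]] [mg [N gN]]; split; first exact: measurable_funM.
by exists (M * N) => x; rewrite normrM ler_pM.
Qed.

Lemma bdmN f : bdm f -> bdm (fun x => - f x).
Proof.
move=> [mf [M fM]]; split; first exact: measurableT_comp.
by exists M => x; rewrite normrN.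
Qed.

Lemma bdmB f g : bdm f -> bdm g -> bdm (fun x => f x - g x).
Proof. by move=> bf bg; apply: bdmD => //; exact: bdmN. Qed.

Lemma le_E P f g : bdm f -> bdm g -> (forall x, f x <= g x) ->
  \int[P]_x f x <= \int[P]_x g x.
Proof. by move=> bf bg fg; apply: le_Rintegral => //; exact: bdm_integrable. Qed.

Lemma E_cst P (c : R) : \int[P]_x (fun=> c) x = c.
Proof.
by rewrite Rintegral_cst// -[RHS]mulr1; congr (_ * _); exact: (congr1 fine (probability_setT P)).
Qed.

Lemma E_D P f g : bdm f -> bdm g ->
  \int[P]_x (f x + g x) = \int[P]_x f x + \int[P]_x g x.
Proof. by move=> bf bg; apply: RintegralD => //; exact: bdm_integrable. Qed.

Lemma E_B P f g : bdm f -> bdm g ->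
  \int[P]_x (f x - g x) = \int[P]_x f x - \int[P]_x g x.
Proof. by move=> bf bg; apply: RintegralB => //; exact: bdm_integrable. Qed.

Lemma E_Z P (c : R) f : bdm f -> \int[P]_x (c * f x) = c * \int[P]_x f x.
Proof. by move=> bf; apply: RintegralZl => //; exact: bdm_integrable. Qed.

Lemma E_ge0 P f : (forall x, 0 <= f x) -> 0 <= \int[P]_x f x.
Proof. by move=> f0; apply: Rintegral_ge0 => x _. Qed.

Lemma E_norm P f M : bdm f -> (forall x, `|f x| <= M) -> `|\int[P]_x f x| <= M.
Proof.
move=> bf fM; rewrite (le_trans (le_normr_Rintegral _ _))//.
  exact: bdm_integrable.
rewrite -[leRHS](E_cst P); apply: le_E => //; last exact: bdm_cst.
case: bf => mf _; split; first exact: measurableT_comp.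
by exists M => x; rewrite normr_id.
Qed.

Lemma E_indic P (A : set T) : measurable A -> \int[P]_x (\1_A x) = fine (P A).
Proof.
by move=> mA; rewrite /Rintegral integral_indic// setIT.
Qed.

Lemma E_EFin P f : bdm f -> (\int[P]_x (f x)%:E)%E = (\int[P]_x f x)%:E.
Proof.
move=> bf; rewrite /Rintegral fineK//.
by apply: integrable_fin_num => //; exact: bdm_integrable.
Qed.

Lemma E_cvg P (f_ : nat -> T -> R) f M :
  (forall n, measurable_fun setT (f_ n)) -> (forall n x, `|f_ n x| <= M) ->
  (forall x, f_ n x @[n --> \oo] --> f x) ->
  \int[P]_x f_ n x @[n --> \oo] --> \int[P]_x f x.
Proof.
move=> mf fM ff.
have mf' : measurable_fun setT f by apply: (measurable_fun_cvg mf) => x _; exact: ff.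
have [|||||intf _] := @dominated_convergence _ _ _ P setT measurableT
  (fun n => EFin \o f_ n) (EFin \o f) (EFin \o (fun=> M)).
- by move=> n; exact/measurable_EFinP.
- exact/measurable_EFinP.
- by apply/aeW => x _; apply: cvg_EFin; [exact: nearW|exact: ff].
- by apply: bdm_integrable; exact: bdm_cst.
- by apply/aeW => x n _; rewrite /= lee_fin.
move=> h; apply: fine_cvg; rewrite fineK//.
exact: integrable_fin_num.
Qed.

End bounded_measurable.

Section product.
Context d1 d2 (T1 : measurableType d1) (T2 : measurableType d2) (R : realType).
Variables (P1 : probability T1 R) (P2 : probability T2 R).
Implicit Types (h : T1 * T2 -> R).

Lemma bdm_pair1 h x : bdm h -> bdm (fun y => h (x, y)).
Proof.
move=> [mh [M hM]]; split; last by exists M => ?.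
exact: measurableT_comp.
Qed.

Lemma bdm_pair2 h y : bdm h -> bdm (fun x => h (x, y)).
Proof.
move=> [mh [M hM]]; split; last by exists M => ?.
exact: measurableT_comp.
Qed.

Lemma fubini_F_E h : bdm h ->
  fubini_F P2 (EFin \o h) = EFin \o (fun x => \int[P2]_y h (x, y)).
Proof.
move=> bh; apply/funext => x; rewrite /fubini_F /=.
by rewrite (E_EFin _ (bdm_pair1 x bh)).
Qed.

Lemma fubini_G_E h : bdm h ->
  fubini_G P1 (EFin \o h) = EFin \o (fun y => \int[P1]_x h (x, y)).
Proof.
move=> bh; apply/funext => x; rewrite /fubini_G /=.
by rewrite (E_EFin _ (bdm_pair2 x bh)).
Qed.

Lemma bdm_fubini1 h : bdm h -> bdm (fun x => \int[P2]_y h (x, y)).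
Proof.
move=> bh; split.
  have := @measurable_fubini_F _ _ _ _ _ P1 P2 _ (bdm_integrable (P1 \x P2)%E bh).
  by rewrite fubini_F_E// => /measurable_EFinP.
case: (bh) => _ [M hM]; exists M => x.
by apply: E_norm => //; exact: bdm_pair1.
Qed.

Lemma bdm_fubini2 h : bdm h -> bdm (fun y => \int[P1]_x h (x, y)).
Proof.
move=> bh; split.
  have := @measurable_fubini_G _ _ _ _ _ P1 P2 _ (bdm_integrable (P1 \x P2)%E bh).
  by rewrite fubini_G_E// => /measurable_EFinP.
case: (bh) => _ [M hM]; exists M => x.
by apply: E_norm => //; exact: bdm_pair2.
Qed.

Lemma E_prod1 h : bdm h ->
  \int[(P1 \x P2)%E]_z h z = \int[P1]_x (\int[P2]_y h (x, y)).
Proof.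
move=> bh; rewrite /Rintegral.
have <- := @integral12_prod_meas1 _ _ _ _ _ P1 P2 _ (bdm_integrable (P1 \x P2)%E bh).
by rewrite fubini_F_E.
Qed.

Lemma E_prod2 h : bdm h ->
  \int[(P1 \x P2)%E]_z h z = \int[P2]_y (\int[P1]_x h (x, y)).
Proof.
move=> bh; rewrite /Rintegral.
have <- := @integral21_prod_meas1 _ _ _ _ _ P1 P2 _ (bdm_integrable (P1 \x P2)%E bh).
by rewrite fubini_G_E.
Qed.

Lemma E_swap h : bdm h -> \int[P1]_x (\int[P2]_y h (x, y)) =
  \int[P2]_y (\int[P1]_x h (x, y)).
Proof. by move=> bh; rewrite -E_prod1// E_prod2. Qed.

End product.

Section laws.
Context (R : realType).
Implicit Types (a b c : probability R R) (f g : R -> R).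

Section law_def.
Context d (T : measurableType d) (P : probability T R) (X : T -> R).
Hypothesis mX : measurable_fun setT X.
Let mX_mixin := isMeasurableFun.Build _ _ _ _ _ mX.
Let mX_pack : {mfun T >-> R} := HB.pack X mX_mixin.

Definition law : probability R R := distribution P mX_pack.

Lemma bdm_comp f : bdm f -> bdm (f \o X).
Proof.
move=> [mf [M fM]]; split; first exact: measurableT_comp.
by exists M => x; exact: fM.
Qed.

Lemma E_law f : bdm f -> \int[law]_x f x = \int[P]_x f (X x).
Proof.
move=> bf; rewrite /Rintegral; congr fine.
rewrite (@integral_distribution _ _ _ _ _ _ mX_pack (EFin \o f))//.
  by apply/measurable_EFinP; case: bf.
exact/bdm_integrable/bdm_comp.
Qed.

Lemma ge0_integral_law (f : R -> \bar R) : measurable_fun setT f ->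
  (forall x, 0 <= f x)%E -> (\int[law]_x f x = \int[P]_x f (X x))%E.
Proof.
by move=> mf f0; rewrite (@ge0_integral_distribution _ _ _ _ _ _ mX_pack f).
Qed.

End law_def.

Lemma measurable_sum2 : measurable_fun setT (fun p : R * R => p.1 + p.2).
Proof. exact: measurable_funD. Qed.

Definition conv a b : probability R R := law (a \x b)%E measurable_sum2.

Lemma bdm_add2 f : bdm f -> bdm (fun p : R * R => f (p.1 + p.2)).
Proof. exact: (bdm_comp measurable_sum2). Qed.

Lemma bdm_shift f (y : R) : bdm f -> bdm (fun x : R => f (x + y)).
Proof. by move=> /bdm_add2 /(bdm_pair2 y). Qed.

Lemma E_conv a b f : bdm f ->
  \int[conv a b]_x f x = \int[a]_x (\int[b]_y f (x + y)).
Proof. by move=> bf; rewrite E_law// E_prod1//; exact: bdm_add2. Qed.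

Lemma E_convr a b f : bdm f ->
  \int[conv a b]_x f x = \int[b]_y (\int[a]_x f (x + y)).
Proof. by move=> bf; rewrite E_law// E_prod2//; exact: bdm_add2. Qed.

Lemma convE a b (A : set R) : conv a b A = (a \x b)%E [set p | A (p.1 + p.2)].
Proof. by []. Qed.

Lemma ge0_integral_conv a b (f : R -> \bar R) : measurable_fun setT f ->
  (forall x, 0 <= f x)%E ->
  (\int[conv a b]_x f x = \int[(a \x b)%E]_p f (p.1 + p.2)%R)%E.
Proof. exact: ge0_integral_law. Qed.

Lemma measurable_gt x : measurable [set y : R | x < y].
Proof.
rewrite (_ : [set y | x < y] = `]x, +oo[%classic); first exact: measurable_itv.
by apply/seteqP; split => y /=; rewrite in_itv/= andbT.
Qed.

(** Real-valued, so that inequalities between tails are plain arithmetic. *)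
Definition tl a x := fine (a [set y | x < y]).

Lemma tl_def a x : tl a x = fine (a [set y | x < y]).
Proof. by []. Qed.

Lemma bdm_lt d (T : measurableType d) (u v : T -> R) : measurable_fun setT u ->
  measurable_fun setT v -> bdm (fun y => ((u y < v y)%R)%:R : R).
Proof.
move=> mu mv; split; last first.
  by exists 1 => y; case: (u y < v y)%R; rewrite ?normr0 ?normr1 ?ler01.
rewrite (_ : (fun y => _) = (fun y => if (u y < v y)%R then 1 else 0)).
  by apply: measurable_fun_ifT => //; exact: measurable_fun_ltr.
by apply/funext => y; case: ifP.
Qed.

Lemma bdm_gt x : bdm (fun y : R => ((x < y)%R)%:R : R).
Proof. exact: (bdm_lt (measurable_cst _) (@measurable_id _ _ setT)). Qed.

Lemma tlE a x : tl a x = \int[a]_y (((x < y)%R)%:R).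
Proof.
rewrite tl_def -E_indic; last exact: measurable_gt.
apply: eq_Rintegral => y _; rewrite indicE.
by congr (nat_of_bool _)%:R; apply/idP/idP; rewrite inE.
Qed.

Lemma tl_ge0 a x : 0 <= tl a x.
Proof. by rewrite tlE E_ge0. Qed.

Lemma tl_le1 a x : tl a x <= 1.
Proof.
rewrite tlE -[leRHS](E_cst a); apply: le_E; [|exact: bdm_cst|].
  by apply: bdm_lt => //; exact: measurable_id.
by move=> y; case: (_ < _).
Qed.

Lemma tl_le a x y : x <= y -> tl a y <= tl a x.
Proof.
move=> xy; rewrite !tlE; apply: le_E => [||z]; [exact: bdm_lt|exact: bdm_lt|].
by rewrite ler_nat; have [yz|//] := ltP y z; rewrite (le_lt_trans xy yz).
Qed.

Lemma tl_conv a b x : tl (conv a b) x = \int[b]_y tl a (x - y).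
Proof.
rewrite tlE E_convr; last exact: bdm_lt.
apply: eq_Rintegral => y _; rewrite tlE; apply: eq_Rintegral => z _.
by rewrite ltrBlDr.
Qed.

Lemma tl_convl a b x : tl (conv a b) x = \int[a]_y tl b (x - y).
Proof.
rewrite tlE E_conv; last exact: bdm_lt.
apply: eq_Rintegral => y _; rewrite tlE; apply: eq_Rintegral => z _.
by rewrite ltrBlDr addrC.
Qed.

Lemma bdm_tl d (T : measurableType d) (u : T -> R) a :
  measurable_fun setT u -> bdm (fun y => tl a (u y)).
Proof.
move=> mu; under eq_fun do rewrite tlE.
(* Fubini asks for a probability on the parameter space as well; any Dirac mass serves. *)
apply: (@bdm_fubini1 _ _ _ _ _ (dirac point) a (fun p : T * R => ((u p.1 < p.2)%R)%:R)).
by apply: bdm_lt => //; exact: measurableT_comp.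
Qed.

Lemma bdm_tl_sub a x : bdm (fun y : R => tl a (x - y)).
Proof. by apply: bdm_tl; exact: measurable_funB. Qed.

End laws.
(* Otherwise conversion unfolds tails down to integrals over product measures. *)
#[global] Opaque tl conv.

(** * Characteristic functions *)

Section cexp.
Context (R : realType).
Implicit Types (t p x X : R) (N : nat).

(** The real part of [e^(i p) exp (x e^(i t))]; [cexps] are the partial sums of its exponential
    series. Differentiating in [x] multiplies by [e^(i t)], that is, replaces [p] by [p + t], which
    is why the phase is kept free. *)
Definition cexp t p x := expR (x * cos t) * cos (x * sin t + p).

Definition cexps t N p x : R :=
  \sum_(0 <= k < N) x ^+ k / k`!%:R * cos (t *+ k + p).

Lemma is_derive_cexp t p x : is_derive x 1 (cexp t p) (cexp t (p + t) x).
Proof.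
rewrite /cexp; apply: is_derive_eq.
rewrite /GRing.scale/= !mulr0 !add0r !mulr1 addr0 addrA [in RHS]cosD.
by set A := x * sin t + p; set B := expR _; ring.
Qed.

Lemma is_derive_pown (x : R) k :
  is_derive x 1 (fun x : R => x ^+ k) (k%:R * x ^+ k.-1).
Proof.
have -> : (fun x : R => x ^+ k) = (@id R) ^+ k by apply/funext => y; rewrite exprfctE.
by apply: is_derive_eq; rewrite /GRing.scale/= mulr1.
Qed.

Lemma is_derive_expfact (c x : R) k :
  is_derive x 1 (fun x : R => x ^+ k.+1 / k.+1`!%:R * c) (x ^+ k / k`!%:R * c).
Proof.
have h := is_derive_pown x k.+1.
apply: is_derive_eq; rewrite /GRing.scale/= !mulr0 !add0r ?addr0.
rewrite factS natrM invfM; field.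
by rewrite !pnatr_eq0 -lt0n fact_gt0/= -[1]/(1%:R) -natrD pnatr_eq0.
Qed.

Lemma is_derive_cexps t N p x :
  is_derive x 1 (cexps t N.+1 p) (cexps t N (p + t) x).
Proof.
elim: N => [|N IH].
  rewrite [X in is_derive _ _ X _](_ : _ = fun=> cos p); last first.
    by apply/funext => y; rewrite /cexps big_nat1 expr0 mulr0n add0r fact0 invr1 !mul1r.
  by rewrite /cexps big_geq//; exact: is_derive_cst.
rewrite [X in is_derive _ _ X _](_ : _ = cexps t N.+1 p +
    (fun x : R => x ^+ N.+1 / N.+1`!%:R * cos (t *+ N.+1 + p))); last first.
  by apply/funext => y; rewrite /cexps big_nat_recr.
rewrite {2}/cexps big_nat_recr//=.
rewrite (_ : t *+ N + (p + t) = t *+ N.+1 + p); last by rewrite mulrS; ring.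
by apply: is_deriveD => //; exact: is_derive_expfact.
Qed.

(** The derivative of a remainder is the remainder of the previous order at phase [p + t], so an
    induction over all phases together with the mean value theorem gives the usual Taylor bound. *)
Lemma cexp_taylor t X N p x : 0 <= x <= X ->
  `|cexp t p x - cexps t N p x| <= expR X * (x ^+ N / N`!%:R).
Proof.
elim: N p x => [|N IH] p x /andP[x0 xX].
  rewrite /cexps big_geq// subr0 fact0 divr1 mulr1 /cexp normrM ger0_norm ?expR_ge0//.
  rewrite -[leRHS]mulr1 ler_pM// ?expR_ge0 ?cos_max// ler_expR.
  by rewrite (le_trans _ xX)// ler_piMr// cos_le1.
have [->|xn0] := eqVneq x 0.
  rewrite expr0n/= mul0r mulr0 /cexp /cexps big_nat_recl//= big1_seq; last first.
    by move=> i _; rewrite exprS !mul0r.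
  by rewrite !mul0r !add0r ?mulr0n ?add0r expR0 expr0 fact0 divr1 !mul1r addr0 subrr normr0.
have {xn0}x0 : 0 < x by rewrite lt_neqAle eq_sym xn0.
(* The bound plus [s] times the error, for [s] equal to 1 and to -1. It vanishes at 0 and its
   derivative is nonnegative by the induction hypothesis. *)
pose g (s y : R) := y ^+ N.+1 / N.+1`!%:R * expR X + s * (cexp t p y - cexps t N.+1 p y).
suff h s : `|s| = 1 -> 0 <= g s x.
  rewrite mulrC ler_norml; apply/andP; split.
    by rewrite lerNl -subr_ge0; have := h 1; rewrite /g normr1 mul1r opprK; exact.
  by rewrite -subr_ge0; have := h (-1); rewrite /g normrN normr1 mulN1r; exact.
move=> s1.
pose dg (y : R) := y ^+ N / N`!%:R * expR X + s * (cexp t (p + t) y - cexps t N (p + t) y).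
have dgg (y : R) : is_derive y 1 (g s) (dg y).
  have h1 := is_derive_expfact (expR X) y N.
  have h2 := is_derive_cexp t p y.
  have h3 := is_derive_cexps t N p y.
  rewrite /g /dg; exact: is_derive_eq.
have gc : {within `[0, x], continuous (g s)}.
  apply: derivable_within_continuous => y _.
  by have [] := dgg y.
have [c] := MVT x0 (fun y _ => dgg y) gc.
rewrite in_itv/= => /andP[c0 cx].
have -> : g s 0 = 0.
  rewrite /g exprS !mul0r add0r /cexp /cexps big_nat_recl//= big1_seq; last first.
    by move=> i _; rewrite exprS !mul0r.
  by rewrite !mul0r !add0r ?mulr0n ?add0r expR0 expr0 fact0 divr1 !mul1r addr0 subrr mulr0.
rewrite !subr0 => ->; apply: mulr_ge0; last exact: ltW.
have := IH (p + t) c; rewrite (ltW c0) (ltW (lt_le_trans cx xX)) => /(_ isT).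
rewrite /dg (mulrC (expR X)); set u := _ / _ * _; set v := cexp _ _ _ - _ => vu.
have : `|s * v| <= u by rewrite normrM s1 mul1r.
by rewrite ler_norml => /andP[+ _]; rewrite lerNl -subr_ge0 opprK.
Qed.

Lemma cvg_cexp t p x : 0 <= x -> cexps t n p x @[n --> \oo] --> cexp t p x.
Proof.
move=> x0; apply/subr_cvg0; apply: norm_cvg0.
have h : expR x * (x ^+ n / n`!%:R) @[n --> \oo] --> expR x * 0.
  apply: cvgMl_tmp; exact: cvg_exp_coeff.
rewrite mulr0 in h.
apply: (squeeze_cvgr _ (cvg_cst 0) h).
apply: nearW => n; rewrite normr_ge0/= distrC cexp_taylor//.
by rewrite x0 lexx.
Qed.

End cexp.

Section polar.
Context (R : realType).
Implicit Types (a b m : probability R R) (s r t p : R).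

Lemma bdm_cos (s p : R) : bdm (fun x : R => cos (s * x + p)).
Proof.
split; last by exists 1 => x; exact: cos_max.
apply: (measurableT_comp (continuous_measurable_fun (@continuous_cos R))).
by apply: measurable_funD => //; exact: measurable_funM.
Qed.

(* The characteristic function of [a] at [s] equals [r * e^(i t)]; quantifying over the
   phase [p] encodes its real and imaginary parts at once. *)
Definition polar a s r t :=
  forall p, \int[a]_x cos (s * x + p) = r * cos (t + p).

Lemma polar_conv a b s r t r' t' : polar a s r t -> polar b s r' t' ->
  polar (conv a b) s (r * r') (t + t').
Proof.
move=> ha hb p; rewrite E_conv; last exact: bdm_cos.
transitivity (\int[a]_x (r' * cos (s * x + (t' + p)))).
  apply: eq_Rintegral => x _.
  rewrite (_ : s * x + (t' + p) = t' + (s * x + p)); last by ring.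
  by rewrite -hb; apply: eq_Rintegral => y _; congr cos; ring.
by rewrite E_Z ?ha; [rewrite mulrCA mulrA addrA|exact: bdm_cos].
Qed.

Definition point (x : R) : probability R R := dirac x.

Lemma E_point (x : R) (f : R -> R) : bdm f -> \int[point x]_y f y = f x.
Proof.
move=> [mf _]; rewrite /Rintegral integral_dirac// ?diracT ?mul1e//.
exact/measurable_EFinP.
Qed.

Lemma polar_point (x s : R) : polar (point x) s 1 (s * x).
Proof. by move=> p; rewrite E_point ?mul1r//; exact: bdm_cos. Qed.

Fixpoint convn a n := if n is n'.+1 then conv a (convn a n') else point 0.

Lemma polar_convn a s r t n : polar a s r t -> polar (convn a n) s (r ^+ n) (t *+ n).
Proof.
move=> h; elim: n => [|n IH] /=; last by rewrite exprS mulrS; exact: polar_conv.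
by rewrite expr0 mulr0n -[X in polar _ _ _ X](mulr0 s); exact: polar_point.
Qed.

Lemma exists_angle (c s : R) : c ^+ 2 + s ^+ 2 = 1 -> exists t, cos t = c /\ sin t = s.
Proof.
move=> cs.
have c1 : -1 <= c <= 1.
  by rewrite -ler_norml -[leRHS]normr1 -ler_sqr ?nnegrE// ?normr1 ?real_normK ?num_real// expr1n -cs lerDl sqr_ge0.
have ca : cos (acos c) = c by apply: acosK; rewrite in_itv.
have sa := sin_acos c1; have ss : s ^+ 2 = 1 - c ^+ 2 by rewrite -cs addrAC subrr add0r.
rewrite -ss sqrtr_sqr in sa.
have [s0|s0] := leP 0 s.
  by exists (acos c); rewrite ca sa ger0_norm.
by exists (- acos c); rewrite cosN sinN ca sa ltr0_norm// opprK.
Qed.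

Lemma polar_exists a s : exists r t, 0 <= r /\ polar a s r t.
Proof.
(* Phase 0 gives the real part; phase [- (pi / 2)] turns the cosine into a sine and gives the
   imaginary part. *)
pose C := \int[a]_x cos (s * x + 0); pose S := \int[a]_x cos (s * x + (- (pi / 2))).
have h p : \int[a]_x cos (s * x + p) = C * cos p - S * sin p.
  rewrite mulrC (mulrC S) -!E_Z; [|exact: bdm_cos..].
  rewrite -E_B; [|by apply: bdmM; [exact: bdm_cst|exact: bdm_cos]..].
  apply: eq_Rintegral => x _.
  by rewrite addr0 cosD cosBpihalf; ring.
have [r0|r0] := eqVneq (C ^+ 2 + S ^+ 2) 0.
  exists 0, 0; split=> // p; rewrite h mul0r.
  move/eqP: r0; rewrite paddr_eq0 ?sqr_ge0// !sqrf_eq0 => /andP[/eqP-> /eqP->].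
  by rewrite !mul0r subrr.
pose r := Num.sqrt (C ^+ 2 + S ^+ 2).
have rp : 0 < r by rewrite sqrtr_gt0 lt_neqAle eq_sym r0 addr_ge0 ?sqr_ge0.
have rn0 : r != 0 by rewrite gt_eqF.
have [t [ct st]] : exists t, cos t = C / r /\ sin t = S / r.
  apply: exists_angle; rewrite !expr_div_n -mulrDl sqr_sqrtr ?divff//.
  by rewrite addr_ge0 ?sqr_ge0.
exists r, t; split; first exact: ltW.
by move=> p; rewrite h cosD ct st; field.
Qed.

End polar.

(** * Compound Poisson laws *)

Section compound_poisson.
Context (R : realType).
Implicit Types (m : probability R R) (l : {nonneg R}).

(** The Poisson weights, typed as nonnegative reals so that they can scale measures. *)
Definition pw l k : {nonneg R} := (expR (- l%:num) * (l%:num ^+ k / k`!%:R))%:nng.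

Lemma pw_gt0 l k : 0 < l%:num -> 0 < (pw l k)%:num.
Proof.
by move=> l0; rewrite /= !mulr_gt0 ?expR_gt0 ?invr_gt0 ?exprn_gt0 ?ltr0n ?fact_gt0.
Qed.

Lemma cvg_pw l : series (fun k => (pw l k)%:num) n @[n --> \oo] --> (1 : R).
Proof.
rewrite (_ : (fun n => _) = (fun n => expR (- l%:num) * series (exp_coeff l%:num) n)).
  rewrite -[X in _ --> X](mulVf (lt0r_neq0 (expR_gt0 l%:num))) -expRN.
  by apply: cvgMl_tmp; exact: is_cvg_series_exp_coeff.
by apply/funext => n; rewrite /series/= mulr_sumr.
Qed.

Lemma nneseries_EFin (u : nat -> R) (x : R) : (forall k, 0 <= u k) ->
  series u n @[n --> \oo] --> x -> (\sum_(0 <= k <oo) (u k)%:E)%E = x%:E.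
Proof.
move=> u0 ux; apply/cvg_lim => //.
rewrite (_ : (fun n => _) = (fun n => (series u n)%:E)); last first.
  by apply/funext => n; rewrite sumEFin.
by apply: cvg_EFin => //; exact: nearW.
Qed.

Lemma cvg_nneseries_fine (u : nat -> R) (x : R) : (forall k, 0 <= u k) ->
  (\sum_(0 <= k <oo) (u k)%:E)%E = x%:E -> series u n @[n --> \oo] --> x.
Proof.
move=> u0 ux; rewrite (_ : series u = fine \o (fun n => \sum_(0 <= k < n) (u k)%:E)%E).
  apply: fine_cvg; rewrite -ux; apply: is_cvg_nneseries => n _ _.
  by rewrite lee_fin.
by apply/funext => n; rewrite /= sumEFin.
Qed.

(** Built as a Poisson mixture of convolution powers, so no random sum has to be constructed and
    every tail is a series over the number of jumps. *)
Definition cpm l m := mseries (fun k => mscale (pw l k) (convn m k)) 0.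

HB.instance Definition _ l m := Measure.on (cpm l m).

Let cpm_setT l m : cpm l m setT = 1%E.
Proof.
rewrite /cpm/= /mseries -(nneseries_EFin _ (cvg_pw l))//.
apply: eq_eseriesr => k _; rewrite /mscale/= -[RHS]mule1; congr (_ * _)%E.
exact: probability_setT.
Qed.

HB.instance Definition _ l m := Measure_isProbability.Build _ _ _ (cpm l m) (cpm_setT l m).

Definition cp l m : probability R R := cpm l m.

Lemma ge0_integral_cp l m (f : R -> \bar R) : measurable_fun setT f ->
  (forall x, 0 <= f x)%E ->
  (\int[cp l m]_x f x = \sum_(0 <= k <oo) ((pw l k)%:num%:E * \int[convn m k]_x f x))%E.
Proof.
move=> mf f0; rewrite ge0_integral_measure_series//.
by apply: eq_eseriesr => k _; rewrite ge0_integral_mscale.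
Qed.

Lemma E_cp l m (f : R -> R) : bdm f ->
  series (fun k => (pw l k)%:num * \int[convn m k]_x f x) n @[n --> \oo] -->
  \int[cp l m]_x f x.
Proof.
move=> bf; case: (bf) => mf [M fM].
(* Integration against a series of measures is available for nonnegative functions; the constant [M]
   is subtracted again because the weights sum to 1. *)
pose g x := f x + M.
have g0 x : 0 <= g x by have := fM x; rewrite ler_norml -lerBlDr sub0r => /andP[].
have bg : bdm g by apply: bdmD => //; exact: bdm_cst.
have gE (a : probability R R) : \int[a]_x f x = \int[a]_x g x - M.
  rewrite -[in RHS](E_cst a M) -E_B//; last exact: bdm_cst.
  by apply: eq_Rintegral => x _; rewrite /g addrK.
have h : series (fun k => (pw l k)%:num * \int[convn m k]_x g x) n @[n --> \oo] -->
    \int[cp l m]_x g x.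
  apply: cvg_nneseries_fine => [k|]; first by rewrite mulr_ge0// E_ge0.
  rewrite -E_EFin// ge0_integral_cp//.
    by apply: eq_eseriesr => k _; rewrite EFinM -E_EFin.
  by apply/measurable_EFinP; case: bg.
rewrite gE; under eq_cvg.
  move=> n; rewrite /series/=; under eq_bigr do rewrite gE mulrBr.
  rewrite big_split/= sumrN -mulr_suml; over.
rewrite -[X in _ - X]mul1r; apply: cvgB => //; apply: cvgMr_tmp.
exact: cvg_pw.
Qed.

(** The [k]-fold convolution has polar form [r ^+ k], [t *+ k], so the Poisson mixture is the series
    [cexps] at [l * r], whose limit is the familiar [exp (l (phi - 1))], with [phi] the
    characteristic function of [m]. *)
Lemma polar_cp l m (s r t : R) : 0 <= r -> polar m s r t ->
  polar (cp l m) s (expR (l%:num * (r * cos t - 1))) (l%:num * (r * sin t)).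
Proof.
move=> r0 h p.
have h1 := @E_cp l m _ (bdm_cos s p).
have h2 : series (fun k => (pw l k)%:num * \int[convn m k]_x cos (s * x + p)) n
    @[n --> \oo] --> expR (- l%:num) * cexp t p (l%:num * r).
  rewrite (_ : (fun n => _) = (fun n => expR (- l%:num) * cexps t n p (l%:num * r))).
    by apply: cvgMl_tmp; apply: cvg_cexp; rewrite mulr_ge0.
  apply/funext => n; rewrite /series/= /cexps mulr_sumr; apply: eq_bigr => k _.
  by rewrite (polar_convn k h) exprMn; ring.
rewrite (cvg_unique _ h1 h2)// /cexp mulrA -expRD; congr (expR _ * cos (_ + _)).
- by ring.
- by ring.
Qed.

End compound_poisson.

(** * Gaussian laws *)

Section gauss.
Context (R : realType).
Local Notation leb := (@lebesgue_measure R).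
Local Notation phi := (normal_pdf (0 : R) 1).

Let nrm : probability (measurableTypeR R) R := normal_prob 0 1.

(** The Radon-Nikodym derivative and the normal density have the same integral over every measurable
    set, hence agree almost everywhere. *)
Lemma integral_nrm (f : R -> \bar R) : measurable_fun setT f ->
  (forall x, 0 <= f x)%E ->
  (\int[nrm]_x f x = \int[leb]_x (f x * (phi x)%:E))%E.
Proof.
move=> mf f0.
have dom : nrm `<< leb := @normal_prob_dominates R 0 1.
rewrite -(@Radon_Nikodym_SigmaFinite.change_of_variables _ _ _ nrm leb dom f setT)//.
apply: ae_eq_integral => //.
- apply: emeasurable_funM => //.
  exact: measurable_int (Radon_Nikodym_SigmaFinite.f_integrable dom).
- apply: emeasurable_funM => //.
  by apply/measurable_EFinP; exact: measurable_normal_pdf.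
apply: ae_eqe_mul2l; apply: integral_ae_eq => //.
- exact: Radon_Nikodym_SigmaFinite.f_integrable.
- by apply/measurable_EFinP; exact: measurable_normal_pdf.
- move=> E _ mE; rewrite -(Radon_Nikodym_SigmaFinite.f_integral dom)//.
Qed.

Lemma leb_shift (h : R) (f : R -> \bar R) : measurable_fun setT f ->
  (forall x, 0 <= f x)%E ->
  (\int[leb]_x f (x + h)%R = \int[leb]_x f x)%E.
Proof.
move=> mf f0; pose t : measurableTypeR R -> measurableTypeR R := fun x : R => (x + h)%R.
have mt : measurable_fun setT t by apply: measurable_funD.
transitivity (\int[pushforward leb t]_x f x)%E; first by rewrite ge0_integral_pushforward.
apply: eq_measure_integral => A mA _; apply/esym.
apply: (@lebesgue_measure_unique _ (pushforward leb t)) => // X [[a b] _ <-].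
transitivity (leb (`](a - h), (b - h)]%classic : set R)).
  rewrite !lebesgue_measure_itv/= !lte_fin ltrD2r.
  by case: ifP => // _; congr (_%:E); ring.
congr (leb _); apply/seteqP; split => x /=; rewrite !in_itv/= /t.
  by rewrite ltrBlDr lerBrDr.
by rewrite ltrBlDr lerBrDr.
Qed.

(** The law of the identity moves [nrm] from the structure [measurableTypeR R] to that of [R]. *)
Definition N01 : probability R R := @law R _ _ nrm (@id R) (@measurable_id _ _ setT).

Lemma integral_N01 (f : R -> \bar R) : measurable_fun setT f ->
  (forall x, 0 <= f x)%E ->
  (\int[N01]_x f x = \int[leb]_x (f x * (phi x)%:E))%E.
Proof. by move=> mf f0; rewrite ge0_integral_law// integral_nrm. Qed.

Lemma phiE (x : R) : phi x = normal_peak 1 * expR (- x ^+ 2 / 2).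
Proof. by rewrite normal_pdfE ?oner_neq0// /normal_fun subr0 expr1n. Qed.

Lemma phi_shift (x h : R) : phi (x + h) = expR (- (h * x + h ^+ 2 / 2)) * phi x.
Proof.
rewrite !phiE mulrCA -expRD; congr (_ * expR _); by field.
Qed.

Lemma measurable_expRlin (c b : R) : measurable_fun setT (fun x : R => expR (c * x + b)).
Proof.
apply: (measurableT_comp (continuous_measurable_fun (@continuous_expR R))).
by apply: measurable_funD => //; exact: measurable_funM.
Qed.

Lemma cameron_martin_N01 (h : R) (f : R -> \bar R) : measurable_fun setT f ->
  (forall x, 0 <= f x)%E ->
  (\int[N01]_x f x =
   \int[N01]_x (f (x + h)%R * (expR (- h * x - h ^+ 2 / 2))%:E))%E.
Proof.
move=> mf f0.
have mfh : measurable_fun setT (fun x : R => f (x + h)%R).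
  by apply: (measurableT_comp mf); exact: measurable_funD.
have mphi : measurable_fun setT (fun x : R => (phi x)%:E).
  by apply/measurable_EFinP; exact: measurable_normal_pdf.
rewrite integral_N01// -(leb_shift h); last 2 first.
- exact: emeasurable_funM.
- by move=> x; rewrite mule_ge0// lee_fin normal_pdf_ge0.
rewrite integral_N01; last 2 first.
- by apply: emeasurable_funM => //; apply/measurable_EFinP; exact: measurable_expRlin.
- by move=> x; rewrite mule_ge0// lee_fin expR_ge0.
apply: eq_integral => x _; rewrite -muleA -EFinM phi_shift.
by congr (_ * (expR _ * _)%:E)%E; ring.
Qed.

Definition gauss (s : R) : probability R R :=
  law N01 (measurable_funM (measurable_cst s) (@measurable_id _ _ setT)).

Lemma cameron_martin (s h : R) (f : R -> \bar R) : s != 0 -> measurable_fun setT f ->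
  (forall x, 0 <= f x)%E ->
  (\int[gauss s]_x f x =
   \int[gauss s]_x (f (x + h)%R * (expR (- h / s ^+ 2 * x - h ^+ 2 / (2 * s ^+ 2)))%:E))%E.
Proof.
move=> s0 mf f0.
rewrite ge0_integral_law// [RHS]ge0_integral_law//; last 2 first.
- apply: emeasurable_funM; last by apply/measurable_EFinP; exact: measurable_expRlin.
  by apply: (measurableT_comp mf); exact: measurable_funD.
- by move=> x; rewrite mule_ge0// lee_fin expR_ge0.
rewrite (cameron_martin_N01 (h / s)); last 2 first.
- by apply: (measurableT_comp mf); exact: measurable_funM.
- by move=> x.
apply: eq_integral => x _; congr (f _ * (expR _)%:E)%E.
  by rewrite /= mulrDr mulrCA divff// mulr1.
by rewrite /=; field.
Qed.

(** This is the Cameron-Martin formula for a constant function: the shifted density has total mass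
    1. *)
Lemma gauss_mgf (s t : R) :
  (\int[gauss s]_x (expR (t * x))%:E = (expR (s ^+ 2 * t ^+ 2 / 2))%:E)%E.
Proof.
rewrite ge0_integral_law; last 2 first.
- by apply/measurable_EFinP; have := measurable_expRlin t 0; under eq_fun do rewrite addr0.
- by move=> x; rewrite lee_fin expR_ge0.
have := @cameron_martin_N01 (- (t * s)) (fun=> (expR (s ^+ 2 * t ^+ 2 / 2))%:E)
  (measurable_cst _) (fun=> expR_ge0 _).
rewrite integral_cst// -[(N01 : {measure set R -> \bar R}) setT]/(N01 setT).
rewrite (@probability_setT _ _ _ N01) mule1 => ->.
apply: eq_integral => x _; rewrite -EFinM -expRD; congr (expR _)%:E; rewrite /=; by field.
Qed.

End gauss.

Section gauss_chf.
Context (R : realType).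
Local Notation N := (@N01 R).

(** An integrable function dominating everything that is differentiated under the Gaussian integral
    below. *)
Let G (x : R) := expR (2 * x) + expR (- 2 * x).

Lemma le_1x_exp2 (x : R) : (`|x| + 1) * expR `|x| <= G x.
Proof.
have h (y : R) : 0 <= y -> (y + 1) * expR y <= expR (2 * y).
  move=> y0; rewrite mulr_natl mulr2n expRD ler_wpM2r ?expR_ge0// addrC.
  exact: expR_ge1Dx.
rewrite /G; have [x0|x0] := leP 0 x.
  by rewrite ger0_norm// (le_trans (h _ x0))// lerDl expR_ge0.
have x0' : 0 <= - x by rewrite oppr_ge0 ltW.
by rewrite ltr0_norm// (le_trans (h _ x0'))// mulrN -mulNr lerDr expR_ge0.
Qed.

Lemma integrable_G : N.-integrable setT (EFin \o G).
Proof.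
have h c : N.-integrable setT (EFin \o (fun x => expR (c * x))).
  apply/integrableP; split.
    by apply/measurable_EFinP; have := measurable_expRlin c 0; under eq_fun do rewrite addr0.
  under eq_integral do rewrite /= ger0_norm ?expR_ge0//.
  have := gauss_mgf 1 c.
  rewrite ge0_integral_law.
  - rewrite (_ : (\int[N]_x _)%E = (\int[N]_x (expR (c * x))%:E)%E); last first.
      by apply: eq_integral => x _; rewrite /= mul1r.
    by move=> ->; rewrite ltry.
  - by apply/measurable_EFinP; have := measurable_expRlin c 0; under eq_fun do rewrite addr0.
  - by move=> x; rewrite lee_fin expR_ge0.
rewrite (_ : EFin \o G = ((EFin \o (fun x => expR (2 * x))) \+ (EFin \o (fun x => expR (- 2 * x))))%E)//.
exact: integrableD.
Qed.

Lemma integrable_le_G (f : R -> R) : measurable_fun setT f ->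
  (forall x, `|f x| <= G x) -> N.-integrable setT (EFin \o f).
Proof.
move=> mf fG; apply: (le_integrable measurableT _ _ integrable_G).
  exact/measurable_EFinP.
by move=> x _ /=; rewrite lee_fin (le_trans (fG x))// ler_norm.
Qed.

Lemma cameron_martin_bdm (h : R) (f : R -> R) : bdm f ->
  \int[N]_x f (x + h) = \int[N]_x (f x * expR (h * x - h ^+ 2 / 2)).
Proof.
move=> bf; case: (bf) => mf [M fM].
pose e x := expR (h * x - h ^+ 2 / 2).
have me : measurable_fun setT e := measurable_expRlin h (- (h ^+ 2 / 2)).
have cm (g : R -> R) : measurable_fun setT g -> (forall x, 0 <= g x) ->
    \int[N]_x g (x + h) = \int[N]_x (g x * e x).
  move=> mg g0; rewrite /Rintegral; congr fine.
  rewrite (cameron_martin_N01 (- h)).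
  - apply: eq_integral => x _; rewrite -EFinM /e; congr (g _ * expR _)%:E; [ring|by rewrite sqrrN opprK].
  - apply/measurable_EFinP; apply: (measurableT_comp mg); exact: measurable_funD.
  - by move=> x; rewrite lee_fin.
have ie : N.-integrable setT (EFin \o e).
  apply/integrableP; split; first exact/measurable_EFinP.
  under eq_integral do rewrite /= ger0_norm ?expR_ge0//.
  have := @cameron_martin_N01 R (- h) (fun=> 1%E) (measurable_cst _) (fun=> lee01).
  rewrite integral_cst// mul1e => h1.
  rewrite (_ : (\int[N]_x _)%E = N setT)%E; first by rewrite (@probability_setT _ _ _ N) ltry.
  rewrite /= h1; apply: eq_integral => x _; rewrite mul1e /e; congr (expR _)%:E.
  by rewrite sqrrN opprK.
have ife : N.-integrable setT (EFin \o (fun x => f x * e x)).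
  apply: (le_integrable measurableT _ _ (integrableZl measurableT M ie)).
    by apply/measurable_EFinP; exact: measurable_funM.
  move=> x _; rewrite /= lee_fin !normrM ler_wpM2r//.
  by rewrite (le_trans (fM x))// ler_norm.
(* The formula for nonnegative functions is applied to [f + M] and to [M], then subtracted. *)
have g0 x : 0 <= f x + M by have := fM x; rewrite ler_norml -lerBlDr sub0r => /andP[].
have M0 : 0 <= M by rewrite (le_trans _ (fM 0)).
have h1 := cm (fun x => f x + M) (measurable_funD mf (measurable_cst _)) g0.
have h2 := cm (fun=> M) (measurable_cst _) (fun=> M0).
rewrite E_D in h1; [|exact: bdm_shift|exact: bdm_cst].
rewrite (_ : \int[N]_x ((f x + M) * e x) = \int[N]_x (f x * e x) + \int[N]_x (M * e x)) in h1.
  by rewrite h2 in h1; exact: (addIr _ h1).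
under eq_Rintegral do rewrite mulrDl.
by rewrite RintegralD//; exact: (integrableZl measurableT M ie).
Qed.

Lemma derive_cos_N01 (t p : R) :
  is_derive t 1 (fun t => \int[N]_x cos (t * x + p)) (\int[N]_x (- x * sin (t * x + p))).
Proof.
pose f (t x : R) := cos (t * x + p).
have fd (x y : R) : is_derive x 1 (f ^~ y) (- y * sin (x * y + p)).
  rewrite /f; apply: is_derive_eq.
  by rewrite /GRing.scale/= !mulr0 addr0 add0r mulr1 mulrC mulrN mulNr.
have fp x y : partial1of2 f x y = - y * sin (x * y + p).
  by rewrite partial1of2E; have [_ ->] := fd x y.
have I : `]t - 1, t + 1[%classic t by rewrite /= in_itv/= ltrBlDr ltrDl ltr01.
have h1 : forall x : R, `]t - 1, t + 1[%classic x -> N.-integrable setT (EFin \o f x).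
  by move=> x _; apply: bdm_integrable; exact: bdm_cos.
have h2 : forall x y : R, `]t - 1, t + 1[%classic x -> [set: R] y -> derivable (f ^~ y) x 1.
  by move=> x y _ _; have [] := fd x y.
have h3 : forall y : R, 0 <= G y by move=> y; rewrite addr_ge0 ?expR_ge0.
have h4 : forall x y : R, `]t - 1, t + 1[%classic x -> [set: R] y -> `|partial1of2 f x y| <= G y.
  move=> x y _ _; rewrite fp normrM normrN.
  rewrite (le_trans _ (le_1x_exp2 y))// ler_pM//; first by rewrite lerDl.
  rewrite (le_trans (sin_max _))// -expR0 ler_expR//.
apply: DeriveDef.
  exact: (derivable_under_integral measurableT I h1 h2 h3 integrable_G h4).
rewrite -derive1E (differentiation_under_integral measurableT I h1 h2 h3 integrable_G h4).
by apply: eq_Rintegral => y _; rewrite fp.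
Qed.

(* Obtained by differentiating the Cameron-Martin formula in the shift at 0. *)
Lemma stein_sin (t p : R) :
  t * \int[N]_x cos (t * x + p) = \int[N]_x (x * sin (t * x + p)).
Proof.
pose f (h x : R) := sin (t * x + p) * expR (h * x - h ^+ 2 / 2).
have fd (h x : R) : is_derive h 1 (f ^~ x)
    (sin (t * x + p) * ((x - h) * expR (h * x - h ^+ 2 / 2))).
  rewrite /f; have h1 := is_derive_pown h 2; apply: is_derive_eq.
  by rewrite /GRing.scale/=; set e := expR _; field.
have msin : measurable_fun setT (fun x : R => sin (t * x + p)).
  apply: (measurableT_comp (continuous_measurable_fun (@continuous_sin R))).
  by apply: measurable_funD => //; exact: measurable_funM.
have bsin : bdm (fun x : R => sin (t * x + p)).
  by split=> //; exists 1 => x; exact: sin_max.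
have fp x y : partial1of2 f x y = sin (t * y + p) * ((y - x) * expR (x * y - x ^+ 2 / 2)).
  by rewrite partial1of2E; have [_ ->] := fd x y.
have I : `](-1 : R), 1[%classic (0 : R) by rewrite /= in_itv/= ltrN10 ltr01.
have Gb (x y : R) : `](-1 : R), 1[%classic x -> (`|y| + 1) * expR (x * y - x ^+ 2 / 2) <= G y.
  rewrite /= in_itv/= => /andP[x1 x2].
  rewrite (le_trans _ (le_1x_exp2 y))// ler_wpM2l ?addr_ge0//.
  rewrite ler_expR (@le_trans _ _ (x * y))//; first by rewrite gerBl divr_ge0 ?sqr_ge0.
  by rewrite (le_trans (ler_norm _))// normrM ler_piMl// ler_norml (ltW x1) (ltW x2).
have h1 : forall x : R, `](-1 : R), 1[%classic x -> N.-integrable setT (EFin \o f x).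
  move=> x Ix; apply: integrable_le_G.
    by apply: measurable_funM => //; exact: (measurable_expRlin x (- (x ^+ 2 / 2))).
  move=> y; rewrite (le_trans _ (Gb _ y Ix))// normrM [`|expR _|]ger0_norm ?expR_ge0//.
  by rewrite ler_wpM2r ?expR_ge0// (le_trans (sin_max _))// lerDr.
have h2 : forall x y : R, `](-1 : R), 1[%classic x -> [set: R] y -> derivable (f ^~ y) x 1.
  by move=> x y _ _; have [] := fd x y.
have h3 : forall y : R, 0 <= G y by move=> y; rewrite addr_ge0 ?expR_ge0.
have h4 : forall x y : R, `](-1 : R), 1[%classic x -> [set: R] y -> `|partial1of2 f x y| <= G y.
  move=> x y Ix _; rewrite fp (le_trans _ (Gb _ y Ix))// !normrM [`|expR _|]ger0_norm ?expR_ge0//.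
  rewrite mulrA ler_wpM2r ?expR_ge0//.
  rewrite (@le_trans _ _ (1 * `|y - x|))//; first by rewrite ler_wpM2r ?sin_max.
  rewrite mul1r (le_trans (ler_normB _ _))// lerD2l.
  by move: Ix; rewrite /= in_itv/= => /andP[x1 x2]; rewrite ler_norml (ltW x1) (ltW x2).
have dK := differentiation_under_integral measurableT I h1 h2 h3 integrable_G h4.
have KE : (fun h => \int[N]_x f h x) = (fun h => cos (t * h) * \int[N]_x sin (t * x + p) +
    sin (t * h) * \int[N]_x cos (t * x + p)).
  apply/funext => h; rewrite /f -(cameron_martin_bdm h bsin).
  have bc := bdm_cos t p.
  rewrite -!E_Z// -E_D; [|by apply: bdmM => //; exact: bdm_cst..].
  apply: eq_Rintegral => x _.
  by rewrite mulrDr addrAC sinD; ring.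
rewrite /= KE in dK.
have : is_derive (0 : R) 1 (fun h => cos (t * h) * \int[N]_x sin (t * x + p) +
    sin (t * h) * \int[N]_x cos (t * x + p)) (t * \int[N]_x cos (t * x + p)).
  apply: is_derive_eq.
  by rewrite /GRing.scale/= !mulr0 sin0 cos0; ring.
move=> [_ h5]; rewrite -h5 -derive1E dK; apply: eq_Rintegral => x _.
by rewrite fp mul0r expr0n/= mul0r subrr expR0 mulr1 subr0 mulrC.
Qed.

(** Stein's identity makes the integral a solution of [F' = - u F], so [F u * exp (u ^ 2 / 2)] is
    constant. *)
Lemma N01_cos (t p : R) : \int[N]_x cos (t * x + p) = expR (- t ^+ 2 / 2) * cos p.
Proof.
pose F (t : R) := \int[N]_x cos (t * x + p).
have dF (u : R) : is_derive u 1 F (- (u * F u)).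
  have := derive_cos_N01 u p.
  rewrite (_ : \int[N]_x (- x * sin (u * x + p)) = - (u * F u))//.
  rewrite /F stein_sin -mulN1r -RintegralZl//.
    by apply: eq_Rintegral => x _; rewrite mulN1r mulNr.
  apply: integrable_le_G.
    apply: measurable_funM => //; apply: (measurableT_comp (continuous_measurable_fun (@continuous_sin R))).
    by apply: measurable_funD => //; exact: measurable_funM.
  move=> y; rewrite normrM (le_trans _ (le_1x_exp2 y))// ler_pM//; first by rewrite lerDl.
  by rewrite (le_trans (sin_max _))// -expR0 ler_expR.
pose H (u : R) := F u * expR (u ^+ 2 / 2).
have dH (u : R) : is_derive u 1 H 0.
  rewrite /H; have h1 := is_derive_pown u 2; apply: is_derive_eq.
  by rewrite /GRing.scale/=; set e := expR _; field.
have : H t = H 0 by apply: is_derive_0_is_cst.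
rewrite /H expr0n/= mul0r expR0 mulr1 {2}/F.
under eq_Rintegral do rewrite mul0r add0r.
rewrite E_cst => <-; rewrite mulrCA -expRD.
by rewrite [X in expR X](_ : _ = 0) ?expR0 ?mulr1//; field.
Qed.

Lemma polar_gauss (s u : R) : polar (gauss s) u (expR (- (s * u) ^+ 2 / 2)) 0.
Proof.
move=> p; rewrite add0r E_law; last exact: bdm_cos.
rewrite -N01_cos; apply: eq_Rintegral => x _; congr (cos (_ + _)).
by rewrite /= mulrA (mulrC u).
Qed.

End gauss_chf.

(** * Exponential moments and Chernoff's bound *)

Section mgf.
Context (R : realType).
Implicit Types (a b m : probability R R) (t M N : R).

(** A bound in [\bar R], so that it includes the finiteness of the exponential moment. *)
Definition mgfle a t M := (\int[a]_x (expR (t * x))%:E <= M%:E)%E.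

Lemma measurable_expt t : measurable_fun setT (fun x : R => (expR (t * x))%:E).
Proof.
by apply/measurable_EFinP; have := measurable_expRlin t 0; under eq_fun do rewrite addr0.
Qed.

Lemma expt_ge0 t (x : R) : (0 <= (expR (t * x))%:E)%E.
Proof. by rewrite lee_fin expR_ge0. Qed.

Ltac sides := first [exact: measurable_expt | by move=> ? ?; exact: expt_ge0
  | exact: expt_ge0 | by rewrite lee_fin expR_ge0 | done].

Lemma mgfle_conv a b t M N : 0 <= M -> mgfle a t M -> mgfle b t N ->
  mgfle (conv a b) t (M * N).
Proof.
move=> M0 ha hb; rewrite /mgfle ge0_integral_conv; [|exact: measurable_expt|exact: expt_ge0].
rewrite fubini_tonelli1; last 2 first.
- exact: (measurableT_comp (measurable_expt t) (@measurable_sum2 R)).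
- by move=> x; exact: expt_ge0.
rewrite /fubini_F/= (@le_trans _ _ (\int[a]_x ((expR (t * x))%:E * N%:E))%E)//.
  apply: ge0_le_integral => //.
  - by move=> x _; apply: integral_ge0 => y _; exact: expt_ge0.
  - apply: (measurable_fun_fubini_tonelli_F (m2 := b) (fun p : R * R => (expR (t * (p.1 + p.2)))%:E)).
      exact: (measurableT_comp (measurable_expt t) (@measurable_sum2 R)).
    by move=> x; exact: expt_ge0.
  - by apply: emeasurable_funM => //; exact: measurable_expt.
  move=> x _; under eq_integral do rewrite mulrDr expRD EFinM.
  rewrite ge0_integralZl; try sides.
  by rewrite lee_wpmul2l// expt_ge0.
have N0 : (0 <= N%:E)%E.
  by apply: le_trans hb; apply: integral_ge0 => y _; exact: expt_ge0.
rewrite ge0_integralZr; try sides.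
by rewrite EFinM lee_wpmul2r.
Qed.

Lemma mgfle_point t (x : R) : mgfle (point x) t (expR (t * x)).
Proof. by rewrite /mgfle integral_dirac// ?diracT ?mul1e//; exact: measurable_expt. Qed.

Lemma mgfle_convn m t M n : 0 <= M -> mgfle m t M -> mgfle (convn m n) t (M ^+ n).
Proof.
move=> M0 h; elim: n => [|n IH] /=.
  by have := mgfle_point t 0; rewrite mulr0 expR0.
by rewrite exprS; exact: mgfle_conv.
Qed.

Lemma mgfle_le a t M N : M <= N -> mgfle a t M -> mgfle a t N.
Proof. by move=> MN; rewrite /mgfle => /le_trans; apply; rewrite lee_fin. Qed.

Lemma mgfle_cp (l : {nonneg R}) m t M : 0 <= M -> mgfle m t M ->
  mgfle (cp l m) t (expR (l%:num * (M - 1))).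
Proof.
move=> M0 h; rewrite /mgfle ge0_integral_cp; [|exact: measurable_expt|exact: expt_ge0].
have c : series (fun k => (pw l k)%:num * M ^+ k) n @[n --> \oo] --> expR (l%:num * (M - 1)).
  rewrite (_ : (fun n => _) = (fun n => expR (- l%:num) * series (exp_coeff (l%:num * M)) n)).
    rewrite mulrBr mulr1 addrC expRD.
    by apply: cvgMl_tmp; exact: is_cvg_series_exp_coeff.
  apply/funext => n; rewrite /series/= mulr_sumr; apply: eq_bigr => k _.
  by rewrite /exp_coeff/= exprMn; ring.
rewrite -(nneseries_EFin _ c); last by move=> k; rewrite mulr_ge0// exprn_ge0.
apply: lee_nneseries => k _.
  by move=> _; rewrite mule_ge0// integral_ge0// => x _; exact: expt_ge0.
rewrite (EFinM (pw l k)%:num (M ^+ k)); apply: lee_wpmul2l; [by rewrite lee_fin|exact: mgfle_convn].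
Qed.

Lemma mgfle_gauss (s t : R) : mgfle (gauss s) t (expR (s ^+ 2 * t ^+ 2 / 2)).
Proof. by rewrite /mgfle gauss_mgf. Qed.

Lemma integral_exptZ a t (c : R) : 0 <= c ->
  (c%:E * \int[a]_y (expR (t * y))%:E = \int[a]_y (c * expR (t * y))%:E)%E.
Proof.
move=> c0; under [RHS]eq_integral do rewrite EFinM.
rewrite ge0_integralZl//; exact: measurable_expt.
Qed.

Lemma tl_EFin a x : (tl a x)%:E = (\int[a]_y (((x < y)%R)%:R%:E))%E.
Proof. by rewrite tlE E_EFin//; apply: bdm_lt. Qed.

Lemma chernoff a t M x : 0 <= t -> mgfle a t M -> tl a x <= expR (- (t * x)) * M.
Proof.
move=> t0 h; rewrite -lee_fin tl_EFin EFinM.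
apply: (@le_trans _ _ ((expR (- (t * x)))%:E * \int[a]_y (expR (t * y))%:E)%E); last first.
  by rewrite lee_wpmul2l// lee_fin expR_ge0.
rewrite integral_exptZ ?expR_ge0//.
apply: ge0_le_integral => //.
- by apply/measurable_EFinP; have [] := @bdm_lt R _ _ (fun=> x) (@id R) (measurable_cst _) (@measurable_id _ _ setT).
- by apply/measurable_EFinP/measurable_funM => //; apply/measurable_EFinP; exact: measurable_expt.
move=> y _; rewrite lee_fin -expRD; have [xy|_] := ltP x y; last exact: expR_ge0.
rewrite -[leLHS]/(1 : R) -expR0 ler_expR addrC -mulrBr mulr_ge0// subr_ge0 ltW//.
Qed.

End mgf.

(** * Sensitivity of Gaussian tails to shifts *)

Section gauss_tail.
Context (R : realType).
Implicit Types (s v e x : R).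

Lemma tl_sub (a : probability R R) x y : 
  tl a x - tl a y = \int[a]_z (((x < z)%R)%:R - ((y < z)%R)%:R).
Proof. by rewrite E_B; [rewrite !tlE|exact: bdm_lt..]. Qed.

(** The Cameron-Martin formula with shift [h = k e] carries the translated interval back to that
    between [v - e] and [v]. There [h z <= 1], and [h ^ 2 <= 1], so the density factor is at least
    [exp (- 2 / s ^ 2)]. *)
Lemma gauss_step s v e (k : nat) : 0 < s -> 0 <= e ->
  k%:R * e * (1 + Num.max v 0) <= 1 ->
  tl (gauss s) (v - e) - tl (gauss s) v <=
  expR (2 / s ^+ 2) * (tl (gauss s) (v - e + k%:R * e) - tl (gauss s) (v + k%:R * e)).
Proof.
move=> s0 e0; set h := k%:R * e => he.
have h0 : 0 <= h by rewrite mulr_ge0.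
have sn0 : s != 0 by rewrite gt_eqF.
have m0 : 0 <= Num.max v 0 by rewrite le_max lexx orbT.
have h1 : h <= 1 by rewrite (le_trans _ he)// ler_peMr// lerDl.
pose f (z : R) : R := ((v - e + h < z)%R)%:R - ((v + h < z)%R)%:R.
have bf : bdm f by apply: bdmB; exact: bdm_lt.
pose g (z : R) : R := ((v - e < z)%R)%:R - ((v < z)%R)%:R.
have bg : bdm g by apply: bdmB; exact: bdm_lt.
have f0 : forall z, 0 <= f z.
  move=> z; rewrite subr_ge0 ler_nat; have [|//] := ltP (v + h) z.
  by move=> vz; rewrite (le_lt_trans _ vz)// lerD2r gerBl.
have g0 : forall z, 0 <= g z.
  move=> z; rewrite subr_ge0 ler_nat; have [|//] := ltP v z.
  by move=> vz; rewrite (le_lt_trans _ vz)// gerBl.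
rewrite !tl_sub -[X in X <= _]/(\int[gauss s]_z g z) -[X in _ * X]/(\int[gauss s]_z f z) -lee_fin EFinM -!E_EFin//.
rewrite [X in (_ <= _ * X)%E](cameron_martin h sn0); last 2 first.
- by apply/measurable_EFinP; case: bf.
- by move=> z; rewrite lee_fin.
pose F (z : R) := f (z + h) * expR (- h / s ^+ 2 * z - h ^+ 2 / (2 * s ^+ 2)).
have mF : measurable_fun setT F.
  apply: measurable_funM; last exact: measurable_expRlin.
  by case: (bdm_shift h bf).
have F0 (z : R) : 0 <= F z by rewrite mulr_ge0 ?expR_ge0.
have FZ : ((expR (2 / s ^+ 2))%:E * \int[gauss s]_z (F z)%:E =
    \int[gauss s]_z (expR (2 / s ^+ 2) * F z)%:E)%E.
  under [RHS]eq_integral do rewrite EFinM.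
  rewrite ge0_integralZl//.
    exact/measurable_EFinP.
  by move=> z _; rewrite lee_fin.
rewrite FZ; apply: ge0_le_integral => //.
- by move=> z _; rewrite lee_fin.
- by apply/measurable_EFinP; case: bg.
- by apply/measurable_EFinP; exact: measurable_funM.
move=> z _; rewrite lee_fin /F.
rewrite (_ : f (z + h) = g z); last by rewrite /f /g !ltrD2r.
rewrite mulrCA -[leLHS]mulr1; have [zv|zv] := leP z v; last first.
  rewrite (_ : g z = 0) ?mul0r//.
  by rewrite /g zv (le_lt_trans _ zv) ?subrr// gerBl.
rewrite ler_wpM2l// -expRD -[leLHS]expR0 ler_expR.
rewrite [X in 0 <= X](_ : _ = (2 - h * z - h ^+ 2 / 2) / s ^+ 2); last by field.
rewrite divr_ge0 ?sqr_ge0//.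
have hz : h * z <= 1.
  rewrite (le_trans _ he)// ler_wpM2l// (le_trans zv)//.
  by rewrite (@le_trans _ _ (Num.max v 0))// ?le_max ?lexx// lerDr.
have hh : h ^+ 2 <= 1 by rewrite expr_le1.
lra.
Qed.

(* By [gauss_step], the mass of [[v - e, v]] is at most a constant times the mass of each of
   its first [n ~ 1 / (e (1 + v^+))] translates to the right, which are disjoint. *)
Lemma gauss_tail_ratio s : 0 < s -> exists2 C, 0 < C & forall v e, 0 <= e ->
  e * (1 + Num.max v 0) <= 1 ->
  tl (gauss s) (v - e) <= (1 + C * (e * (1 + Num.max v 0))) * tl (gauss s) v.
Proof.
move=> s0; exists (2 * expR (2 / s ^+ 2)); first by rewrite mulr_gt0// expR_gt0.
move=> v e; rewrite le_eqVlt => /predU1P[<- _|e0 e1].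
  by rewrite mul0r mulr0 addr0 mul1r subr0.
set q := e * _ in e1 *.
have m0 : 0 <= Num.max v 0 by rewrite le_max lexx orbT.
have q0 : 0 < q by rewrite mulr_gt0// ltr_pwDl.
set c := expR _; set d := tl (gauss s) (v - e) - tl (gauss s) v.
have d0 : 0 <= d by rewrite subr_ge0 tl_le// gerBl ltW.
have step (n : nat) : n%:R * q <= 1 ->
    n%:R * d <= c * (tl (gauss s) v - tl (gauss s) (v + n%:R * e)).
  elim: n => [|n IH] nq; first by rewrite !mul0r addr0 subrr mulr0.
  have nq' : n%:R * q <= 1.
    by rewrite (le_trans _ nq)// ler_wpM2r ?ler_nat// ltW.
  have := @gauss_step s v e n.+1 s0 (ltW e0); rewrite -mulrA => /(_ nq).
  have -> : v - e + n.+1%:R * e = v + n%:R * e by rewrite -natr1; ring.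
  rewrite -/d -/c => h; have := IH nq'; rewrite -[n.+1%:R]natr1 mulrDl mul1r => h2.
  rewrite (le_trans (lerD h2 h))// -mulrDr ler_wpM2l ?expR_ge0//.
  by rewrite -natr1; lra.
pose n := Num.truncn q^-1.
have /andP[nq qn] : n%:R <= q^-1 < n.+1%:R by apply: truncn_itv; rewrite invr_ge0 ltW.
have n1 : (1 <= n)%N by rewrite truncn_gt0 invf_ge1.
have nq1 : n%:R * q <= 1 by rewrite -ler_pdivlMr// div1r.
have h1 := step n nq1.
have {}h1 : n%:R * d <= c * tl (gauss s) v.
  by rewrite (le_trans h1)// ler_wpM2l ?expR_ge0// gerBl tl_ge0.
(* From [q^-1 < n + 1 <= 2 n]; this is the factor 2 in the constant. *)
have h2 : 1 <= 2 * q * n%:R.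
  have n1' : 1 <= n%:R :> R by rewrite ler1n.
  rewrite -natr1 in qn; have qn2 : q^-1 <= 2 * n%:R by lra.
  rewrite -[leLHS](mulfV (lt0r_neq0 q0)) (_ : 2 * q * n%:R = q * (2 * n%:R)); last by ring.
  by rewrite ler_wpM2l// ltW.
rewrite mulrDl mul1r -lerBlDl -/d.
rewrite (@le_trans _ _ (2 * q * n%:R * d))//; first by rewrite ler_peMl.
have h3 : 2 * q * (n%:R * d) <= 2 * q * (c * tl (gauss s) v).
  by rewrite ler_wpM2l// mulr_ge0// ltW.
rewrite -mulrA (le_trans h3)// (_ : 2 * q * (c * tl (gauss s) v) = 2 * c * q * tl (gauss s) v)//.
by ring.
Qed.

Lemma tl_N01_lip x e : 0 <= e -> tl (@N01 R) x - tl (@N01 R) (x + e) <= normal_peak 1 * e.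
Proof.
move=> e0; rewrite tl_sub.
have bf : bdm (fun z : R => ((x < z)%R)%:R - ((x + e < z)%R)%:R : R).
  by apply: bdmB; exact: bdm_lt.
have gE z : ((x < z)%R)%:R - ((x + e < z)%R)%:R = \1_(`]x, x + e]%classic) z :> R.
  rewrite indicE mem_setE in_itv/=.
  have [xz|xz] := ltP x z; have [h|h] := ltP (x + e) z; rewrite ?subrr ?subr0//.
  have xe : x <= x + e by rewrite lerDl.
  by have := le_lt_trans xe (lt_le_trans h xz); rewrite ltxx.
have mE : measurable (`]x, x + e]%classic : set R) by exact: measurable_itv.
rewrite -lee_fin -E_EFin//; under eq_integral do rewrite gE.
rewrite integral_N01; last 2 first.
- by apply/measurable_EFinP; exact: measurable_indic.
- by move=> z; rewrite lee_fin.
pose pk : R := normal_peak 1.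
rewrite (@le_trans _ _ (\int[lebesgue_measure]_z (pk%:E * (\1_(`]x, x + e]%classic) z)%:E))%E)//.
  apply: ge0_le_integral => //.
  - by move=> z _; rewrite mule_ge0// lee_fin normal_pdf_ge0.
  - apply: emeasurable_funM; apply/measurable_EFinP; first exact: measurable_indic.
    exact: measurable_normal_pdf.
  - by apply: emeasurable_funM => //; apply/measurable_EFinP; exact: measurable_indic.
  by move=> z _; rewrite muleC lee_wpmul2r ?lee_fin// normal_pdf_ub// oner_neq0.
rewrite ge0_integralZl//; last 2 first.
- by apply/measurable_EFinP; exact: measurable_indic.
- by rewrite lee_fin normal_peak_ge0.
have lE : lebesgue_measure (`]x, x + e]%classic : set R) = e%:E.
  rewrite lebesgue_measure_itv/= lte_fin ltrDl; case: ltP => [_|e0'].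
    by rewrite -EFinB addrAC subrr add0r.
  by congr (_%:E); apply/eqP; rewrite eq_le e0 e0'.
by rewrite integral_indic// setIT [X in (_ * X)%E]lE.
Qed.

Lemma tl_gaussE s x : 0 < s -> tl (gauss s) x = tl (@N01 R) (x / s).
Proof.
move=> s0; rewrite !tlE E_law; last exact: bdm_lt.
by apply: eq_Rintegral => y _; rewrite /= ltr_pdivrMr// mulrC.
Qed.

Lemma tl_conv_gauss_lip s (b : probability R R) x e : 0 < s -> 0 <= e ->
  tl (conv (gauss s) b) x - tl (conv (gauss s) b) (x + e) <= normal_peak 1 / s * e.
Proof.
move=> s0 e0; rewrite !tl_conv -E_B; [|exact: bdm_tl_sub..].
rewrite -[leRHS](E_cst b); apply: le_E; [|exact: bdm_cst|].
  by apply: bdmB; exact: bdm_tl_sub.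
move=> y; rewrite !tl_gaussE//.
rewrite (_ : (x + e - y) / s = (x - y) / s + e / s); last by rewrite -mulrDl addrAC.
have es0 : 0 <= e / s by rewrite divr_ge0// ltW.
by rewrite (le_trans (tl_N01_lip ((x - y) / s) es0))// mulrAC mulrA.
Qed.

End gauss_tail.

(** * Convergence of tails from characteristic functions *)

Section chf_cvg.
Context (R : realType).
Implicit Types (a b : probability R R) (an bn : nat -> probability R R).
Local Notation N := (@N01 R).
Local Notation leb := (@lebesgue_measure R).
Local Notation phi := (normal_pdf (0 : R) 1).

(** Pointwise convergence of characteristic functions, with a free phase as in [polar]. *)
Definition chf_cvg an a := forall s p : R,
  \int[an n]_x cos (s * x + p) @[n --> \oo] --> \int[a]_x cos (s * x + p).

Lemma tl_cvg0 a e : 0 < e -> exists x, tl a x < e.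
Proof.
move=> e0.
have h : tl a n%:R @[n --> \oo] --> (0 : R).
  rewrite -[X in _ --> X](E_cst a 0); under eq_cvg do rewrite tlE.
  apply: (@E_cvg _ _ _ a _ _ 1).
  - by move=> n; case: (@bdm_gt R (n%:R)).
  - by move=> n x; case: (_ < _); rewrite ?normr0 ?normr1.
  - move=> x; apply: cvg_near_cst; near=> n.
    rewrite ltNge; suff -> : x <= n%:R by [].
    by near: n; exact: nbhs_infty_ger.
have /cvgrPdist_lt/(_ e e0)[n _ /(_ n (leqnn n))] := h.
by rewrite sub0r normrN ger0_norm ?tl_ge0// => ?; exists n%:R.
Unshelve. all: end_near. Qed.

Lemma tl_cvg1 a e : 0 < e -> exists x, 1 - tl a x < e.
Proof.
move=> e0.
have h : tl a (- n%:R) @[n --> \oo] --> (1 : R).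
  rewrite -[X in _ --> X](E_cst a 1); under eq_cvg do rewrite tlE.
  apply: (@E_cvg _ _ _ a _ _ 1).
  - by move=> n; case: (@bdm_gt R (- n%:R)).
  - by move=> n x; case: (_ < _); rewrite ?normr0 ?normr1.
  - move=> x; apply: cvg_near_cst; near=> n.
    suff -> : - n%:R < x by [].
    by rewrite ltrNl; near: n; exact: nbhs_infty_gtr.
have /cvgrPdist_lt/(_ e e0)[n _ /(_ n (leqnn n))] := h.
by rewrite ger0_norm ?subr_ge0 ?tl_le1// => ?; exists (- n%:R).
Unshelve. all: end_near. Qed.

(* The Gaussian density is its own Fourier transform: this replaces an inversion formula. *)
Lemma phi_chf (z : R) : phi z = normal_peak 1 * \int[N]_s cos (s * z).
Proof.
rewrite phiE; congr (_ * _); have := N01_cos z 0.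
by rewrite cos0 mulr1 => <-; apply: eq_Rintegral => s _; rewrite addr0 mulrC.
Qed.

Lemma phi_norm_le (x : R) : `|phi x| <= normal_peak 1.
Proof. by rewrite ger0_norm ?normal_pdf_ge0 ?normal_pdf_ub// oner_neq0. Qed.

Lemma bdm_phi (y : R) : bdm (fun x : R => phi (y - x)).
Proof.
split; last by exists (normal_peak 1) => x; exact: phi_norm_le.
by apply: (measurableT_comp (measurable_normal_pdf 0 1)); exact: measurable_funB.
Qed.

(** Parseval's identity: by Fubini, the density at [y] of [a] blurred by a unit Gaussian is read off
    from the characteristic function of [a]. *)
Lemma E_phi a (y : R) : \int[a]_x phi (y - x) =
  normal_peak 1 * \int[N]_s (\int[a]_x cos (s * x + (- (s * y)))).
Proof.
have bc2 : bdm (fun p : R * R => cos (p.1 * (p.2 - y))).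
  split; last by exists 1 => p; exact: cos_max.
  apply: (measurableT_comp (continuous_measurable_fun (@continuous_cos R))).
  by apply: measurable_funM => //; exact: measurable_funB.
have -> : \int[N]_s (\int[a]_x cos (s * x + (- (s * y)))) =
    \int[N]_s (\int[a]_x cos (s * (x - y))).
  by apply: eq_Rintegral => s _; apply: eq_Rintegral => x _; rewrite mulrBr.
rewrite (E_swap N a bc2)/= -E_Z; last by have := bdm_fubini2 N a bc2.
apply: eq_Rintegral => x _; rewrite phi_chf; congr (_ * _).
by apply: eq_Rintegral => s _; rewrite -[RHS]cosN -mulrN opprB.
Qed.

Lemma E_phi_cvg an a (y : R) : chf_cvg an a ->
  \int[an n]_x phi (y - x) @[n --> \oo] --> \int[a]_x phi (y - x).
Proof.
move=> h; rewrite E_phi; under eq_cvg do rewrite E_phi.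
apply: cvgMl_tmp; apply: (@E_cvg _ _ _ N _ _ 1).
- move=> n.
  have [] // := @bdm_fubini1 _ _ _ _ _ N (an n) (fun p : R * R => cos (p.1 * p.2 + - (p.1 * y))) _.
  split; last by exists 1 => p; exact: cos_max.
  apply: (measurableT_comp (continuous_measurable_fun (@continuous_cos R))).
  apply: measurable_funD; first exact: measurable_funM.
  by apply: measurableT_comp => //; exact: measurable_funM.
- by move=> n s; apply: E_norm; [exact: bdm_cos|move=> x; exact: cos_max].
- by move=> s; exact: h.
Qed.

(** The inner integral is the density of the blurred law. These densities are bounded by the peak of
    the normal density, so their pointwise convergence passes to bounded intervals. *)
Lemma tl_conv_N01_itv a (u v : R) : u <= v ->
  tl (conv a N) u - tl (conv a N) v =
  \int[leb]_(y in `]u, v]) (\int[a]_x phi (y - x)).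
Proof.
move=> uv.
pose g z : R := ((u < z)%R)%:R - ((v < z)%R)%:R.
have bg : bdm g by apply: bdmB; exact: bdm_lt.
have mg : measurable_fun setT g by case: bg.
have gE z : g z = \1_(`]u, v]%classic) z.
  rewrite /g indicE mem_setE in_itv/=.
  have [xz|xz] := ltP u z; have [h|h] := ltP v z; rewrite ?subrr ?subr0//.
  by have := le_lt_trans uv (lt_le_trans h xz); rewrite ltxx.
have g0 z : 0 <= g z by rewrite gE.
have muv : measurable (`]u, v]%classic : set R) by exact: measurable_itv.
have mp : measurable_fun setT (fun p : R * R => phi (p.2 - p.1)).
  by apply: (measurableT_comp (measurable_normal_pdf 0 1)); exact: measurable_funB.
rewrite tl_sub -/g E_conv// /Rintegral; congr fine.
transitivity (\int[a]_x \int[leb]_y ((g y)%:E * (phi (y - x))%:E))%E.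
  apply: eq_integral => x _; rewrite -[X in X%:E]/(\int[N]_y g (x + y)).
  rewrite -E_EFin; last by have := bdm_shift x bg; under eq_fun do rewrite addrC.
  rewrite integral_N01; last 2 first.
  - by apply/measurable_EFinP; apply: (measurableT_comp mg); exact: measurable_funD.
  - by move=> y; rewrite lee_fin.
  rewrite -(leb_shift (- x)).
  - by apply: eq_integral => y _; rewrite addrCA subrr addr0.
  - apply: emeasurable_funM; apply/measurable_EFinP.
      by apply: (measurableT_comp mg); exact: measurable_funD.
    exact: measurable_normal_pdf.
  - by move=> y; rewrite mule_ge0 ?lee_fin ?normal_pdf_ge0.
pose F := (fun p : R * measurableTypeR R => (g p.2)%:E * (phi ((p.2 : R) - p.1))%:E)%E.
have mF : measurable_fun setT F.
  apply: emeasurable_funM; apply/measurable_EFinP => //.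
  exact: (measurableT_comp mg).
have F0 p : (0 <= F p)%E by rewrite mule_ge0 ?lee_fin ?normal_pdf_ge0.
transitivity (\int[leb]_y \int[a]_x F (x, y))%E; first exact: (@fubini_tonelli _ _ _ _ _ a leb F mF F0).
rewrite [RHS]integral_mkcond.
apply: eq_integral => y _; rewrite /F/= ge0_integralZl//; last 3 first.
- by apply/measurable_EFinP; case: (bdm_phi y).
- by move=> x _; rewrite lee_fin normal_pdf_ge0.
- by rewrite lee_fin.
rewrite E_EFin; last exact: bdm_phi.
rewrite gE /patch indicE; case: ifP => _; by rewrite ?mul1e ?mul0e.
Qed.

Lemma tl_conv_N01_itv_cvg an a (u v : R) : chf_cvg an a -> u <= v ->
  tl (conv (an n) N) u - tl (conv (an n) N) v @[n --> \oo] -->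
  tl (conv a N) u - tl (conv a N) v.
Proof.
move=> h uv; rewrite tl_conv_N01_itv//; under eq_cvg do rewrite tl_conv_N01_itv//.
have muv : measurable (`]u, v]%classic : set R) by exact: measurable_itv.
have mE b : measurable_fun (`]u, v]%classic : set (measurableTypeR R)) (EFin \o (fun y => \int[b]_x phi (y - x))).
  apply/measurable_EFinP; apply: measurable_funTS.
  have [] // := @bdm_fubini1 _ _ R R _ N b (fun p : R * R => phi (p.1 - p.2)) _.
  split; last by exists (normal_peak 1) => x; exact: phi_norm_le.
  by apply: (measurableT_comp (measurable_normal_pdf 0 1)); exact: measurable_funB.
have En b y : `|\int[b]_x phi (y - x)| <= normal_peak 1.
  apply: E_norm; first exact: bdm_phi.
  by move=> x; exact: phi_norm_le.
have [|||||i _] := @dominated_convergence _ _ _ leb _ muv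
  (fun n => EFin \o (fun y => \int[an n]_x phi (y - x))) (EFin \o (fun y => \int[a]_x phi (y - x)))
  (EFin \o (fun=> normal_peak 1)).
- by move=> n.
- by [].
- apply/aeW => y _; apply: cvg_EFin; first exact: nearW.
  exact: E_phi_cvg.
- have lf : (lebesgue_measure (`]u, v]%classic : set R) < +oo)%E.
    by rewrite lebesgue_measure_itv/= lte_fin; case: ifP => _; rewrite ?ltry// -EFinB ltry.
  apply/integrableP; split; first exact: measurable_cst.
  by rewrite /= integral_cst// lte_mul_pinfty// lee_fin.
- by apply/aeW => y n _; rewrite /= lee_fin.
move=> h'; apply: fine_cvg; rewrite fineK//.
exact: integrable_fin_num.
Qed.

(** No tightness is assumed: since [Q n v >= 0] far to the right, the increments bound [Q n u] from
    below, and since [Q n w <= 1] far to the left, they bound it from above. *)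
Lemma tails_cvg (Q : nat -> R -> R) (q : R -> R) :
  (forall n x, 0 <= Q n x) -> (forall n x, Q n x <= 1) ->
  (forall u v, u <= v -> Q n u - Q n v @[n --> \oo] --> q u - q v) ->
  (forall x y, x <= y -> q y <= q x) ->
  (forall e, 0 < e -> exists x, q x < e) -> (forall e, 0 < e -> exists x, 1 - q x < e) ->
  forall u, Q n u @[n --> \oo] --> q u.
Proof.
move=> Q0 Q1 h qle q0 q1 u; apply/cvgrPdist_le => e e0.
have e20 : 0 < e / 2 by rewrite divr_gt0.
have [v uv hv] : exists2 v, u <= v & q v < e / 2.
  have [B hB] := q0 _ e20; exists (Num.max u B); first by rewrite le_max lexx.
  by apply: le_lt_trans hB; apply: qle; rewrite le_max lexx orbT.
have [w wu hw] : exists2 w, w <= u & 1 - q w < e / 2.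
  have [A hA] := q1 _ e20; exists (Num.min u A); first by rewrite ge_min lexx.
  by apply: le_lt_trans hA; rewrite lerD2l lerN2; apply: qle; rewrite ge_min lexx orbT.
have /cvgrPdist_le/(_ _ e20) h1 := h _ _ uv.
have /cvgrPdist_le/(_ _ e20) h2 := h _ _ wu.
near=> n.
have : `|q u - q v - (Q n u - Q n v)| <= e / 2 by near: n; exact: h1.
have : `|q w - q u - (Q n w - Q n u)| <= e / 2 by near: n; exact: h2.
rewrite !ler_norml => /andP[i1 i2] /andP[i3 i4].
have i5 := Q0 n v; have i6 := Q1 n w.
by apply/andP; split; lra.
Unshelve. all: end_near. Qed.

Lemma tl_conv_N01_cvg an a (u : R) : chf_cvg an a ->
  tl (conv (an n) N) u @[n --> \oo] --> tl (conv a N) u.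
Proof.
move=> h; apply: (@tails_cvg (fun n => tl (conv (an n) N)) (tl (conv a N))).
- by move=> n x; exact: tl_ge0.
- by move=> n x; exact: tl_le1.
- by move=> v w; exact: tl_conv_N01_itv_cvg.
- by move=> x y; exact: tl_le.
- by move=> e; exact: tl_cvg0.
- by move=> e; exact: tl_cvg1.
Qed.

Definition scale (c : R) a : probability R R :=
  law a (measurable_funM (measurable_cst c) (@measurable_id _ _ setT)).

Lemma tl_scale c a x : 0 < c -> tl (scale c a) x = tl a (x / c).
Proof.
move=> c0; rewrite !tlE E_law; last exact: bdm_lt.
by apply: eq_Rintegral => y _; rewrite /= ltr_pdivrMr// mulrC.
Qed.

Lemma chf_cvg_scale c an a : chf_cvg an a -> chf_cvg (fun n => scale c (an n)) (scale c a).
Proof.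
move=> h s p.
have e b : \int[scale c b]_x cos (s * x + p) = \int[b]_x cos (s * c * x + p).
  rewrite E_law; last exact: bdm_cos.
  by apply: eq_Rintegral => x _; rewrite /= mulrA.
by rewrite e; under eq_cvg do rewrite e; exact: h.
Qed.

Lemma tl_conv_le a b x k : tl (conv a b) x <= tl a (x - k) + tl b k.
Proof.
have ba := @bdm_gt R (x - k).
have bb := @bdm_gt R (k).
rewrite tl_conv (tlE b) -{1}[tl a _](E_cst b) -E_D//; last exact: bdm_cst.
apply: le_E; [by exact: bdm_tl_sub|by apply: bdmD => //; exact: bdm_cst|].
move=> y; have [ky|yk] := ltP k y; first by apply: (le_trans (tl_le1 _ _)); rewrite lerDr tl_ge0.
by rewrite addr0; apply: tl_le; rewrite lerD2l lerN2.
Qed.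

Lemma tl_conv_ge a b x k : tl a (x + k) - (1 - tl b (- k)) <= tl (conv a b) x.
Proof.
have bb := @bdm_gt R (- k).
rewrite tl_conv (tlE b) opprB addrCA -{1}(E_cst b (tl a (x + k) - 1)) -E_D//; last exact: bdm_cst.
apply: le_E; [by apply: bdmD => //; exact: bdm_cst|by exact: bdm_tl_sub|].
move=> y; have [ky|yk] := ltP (- k) y.
  by rewrite addrCA subrr addr0; apply: tl_le; rewrite lerD2l lerNl ltW.
by rewrite add0r; apply: le_trans (tl_ge0 _ _); rewrite subr_le0 tl_le1.
Qed.

(* Both sides are blurred by a centred Gaussian of standard deviation [c^-1]; since the tail of
   [gauss s * bn n] is Lipschitz uniformly in [n], the blur is harmless for large [c]. *)
Lemma tl_cvg_of_chf s bn a u : 0 < s ->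
  chf_cvg (fun n => conv (gauss s) (bn n)) a ->
  tl (conv (gauss s) (bn n)) u @[n --> \oo] --> tl a u.
Proof.
move=> s0 h; apply/cvgrPdist_le => e e0.
pose L : R := normal_peak 1 / s.
have L0 : 0 < L by rewrite divr_gt0// normal_peak_gt0// oner_neq0.
(* By the Lipschitz bound a displacement by [2 * d] changes a tail by at most [e / 4]. *)
pose d := e / (8 * L); have d0 : 0 < d by rewrite divr_gt0// mulr_gt0.
have e80 : 0 < e / 8 by rewrite divr_gt0.
have [K [K0 K1 K2]] : exists K, [/\ 0 < K, tl N K < e / 8 & 1 - tl N (- K) < e / 8].
  have [A hA] := tl_cvg0 N e80; have [B hB] := tl_cvg1 N e80.
  exists (Num.max 1 (Num.max A (- B))); split; first by rewrite lt_max ltr01.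
  - by apply: le_lt_trans hA; apply: tl_le; rewrite !le_max lexx !orbT.
  - apply: le_lt_trans hB; rewrite lerD2l lerN2; apply: tl_le.
    by rewrite lerNl !le_max lexx !orbT.
(* Instead of shrinking the blur, the laws are scaled up by [c]; the unit Gaussian is mostly within
   [K], which is a displacement by [d] on the original scale. *)
pose c := K / d; have c0 : 0 < c by rewrite divr_gt0.
have hc := @chf_cvg_scale c _ _ h.
have cd : c * d = K by rewrite /c divfK// gt_eqF.
have scl b x : tl (scale c b) (c * x) = tl b x by rewrite tl_scale// mulrAC divff ?mul1r// gt_eqF.
have /cvgrPdist_le/(_ _ e80) h1 := @tl_conv_N01_cvg _ _ (c * (u + d)) hc.
have /cvgrPdist_le/(_ _ e80) h2 := @tl_conv_N01_cvg _ _ (c * (u - d)) hc.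
apply: filterS2 h1 h2 => n.
set an := conv (gauss s) (bn n).
have d20 : 0 <= 2 * d by rewrite mulr_ge0// ltW.
have Ld : L * (2 * d) = e / 4 by rewrite /d; field; rewrite !gt_eqF.
have := tl_conv_gauss_lip (bn n) u s0 d20; rewrite -/an -/L Ld => j1.
have := tl_conv_gauss_lip (bn n) (u - 2 * d) s0 d20; rewrite -/an -/L Ld subrK => j2.
have := tl_conv_ge (scale c an) N (c * (u + d)) K.
rewrite -{1}cd -mulrDr scl (_ : u + d + d = u + 2 * d); last by ring.
have := tl_conv_le (scale c a) N (c * (u + d)) K.
rewrite -{1}cd -mulrBr scl addrK.
have := tl_conv_ge (scale c a) N (c * (u - d)) K.
rewrite -{1}cd -mulrDr scl subrK.
have := tl_conv_le (scale c an) N (c * (u - d)) K.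
rewrite -{1}cd -mulrBr scl (_ : u - d - d = u - 2 * d); last by ring.
move: (tl a u) (tl an u) (tl an (u + 2 * d)) (tl an (u - 2 * d)) j1 j2 K1 K2.
move: (tl N K) (tl N (- K)) => q1 q2 z1 z2 z3 z4.
move: (tl (conv (scale c an) N) _) (tl (conv (scale c an) N) _).
move: (tl (conv (scale c a) N) _) (tl (conv (scale c a) N) _).
move=> y1 y2 y3 y4 j1 j2 K1 K2; rewrite !ler_norml => k1 k2 k3 k4 /andP[i1 i2] /andP[i3 i4].
by apply/andP; split; lra.
Qed.

End chf_cvg.

(** * Restrictions of Lévy measures *)

Section restriction.
Context (R : realType) (rho : {measure set R -> \bar R}) (A : set R).
Hypotheses (mA : measurable A) (rA : (rho A < +oo)%E).

Definition rl : {nonneg R} := NngNum (fine_ge0 (measure_ge0 rho A)).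

(** The law of the jumps in [A]. The default [point 0] is used when [rho A = 0], where the rate [rl]
    is 0 as well. *)
Definition rn : probability R R := mnormalize (mrestr rho mA) (point 0).

Lemma ge0_integral_mrestr (f : R -> \bar R) : measurable_fun setT f ->
  (forall x, 0 <= f x)%E ->
  (\int[mrestr rho mA]_x f x = \int[rho]_(x in A) f x)%E.
Proof.
move=> mf f0.
rewrite -(setvU A) ge0_integral_setU//; last 3 first.
- exact: measurableC.
- by rewrite setvU.
- by rewrite disj_set2E setICl.
rewrite [X in (X + _)%E]null_set_integral ?add0e//; last 3 first.
- exact: measurableC.
- exact: measurable_funTS.
- by rewrite /= /mrestr setICl measure0.
apply: eq_measure_integral => B mB BA; exact: (congr1 rho (setIidl BA)).
Qed.

(** Multiplying by the mass instead of dividing keeps the case [rho A = 0], where both sides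
    vanish. *)
Lemma ge0_integral_rn (f : R -> \bar R) : measurable_fun setT f ->
  (forall x, 0 <= f x)%E ->
  (rl%:num%:E * \int[rn]_x f x = \int[rho]_(x in A) f x)%E.
Proof.
move=> mf f0; rewrite -ge0_integral_mrestr//.
have rAE : (mrestr rho mA : {measure set R -> \bar R}) setT = rho A by exact: (congr1 rho (setTI A)).
have [r0|r0] := eqVneq (rho A) 0%E.
  rewrite /= r0 mul0e; apply/esym; apply: (null_set_integral measurableT).
    exact: measurable_funTS.
  by rewrite rAE.
have fA : rho A \is a fin_num by rewrite ge0_fin_numE.
have r1 : 0 < fine (rho A) by rewrite fine_gt0// rA lt0e r0 measure_ge0.
have r2 : 0 <= (fine (rho A))^-1 by rewrite invr_ge0 ltW.
transitivity ((fine (rho A))%:E * \int[mscale (NngNum r2) (mrestr rho mA)]_x f x)%E.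
  congr (_ * _)%E; apply: eq_measure_integral => B mB _.
  by rewrite /rn /= /mnormalize /= rAE (negbTE r0) (lt_eqF rA) /= /mscale/= muleC.
rewrite ge0_integral_mscale// muleA -EFinM /= divff ?mul1e// gt_eqF//.
Qed.

Lemma integrable_rn (f : R -> R) : measurable_fun setT f ->
  rho.-integrable A (EFin \o f) -> 0 < rl%:num -> rn.-integrable setT (EFin \o f).
Proof.
move=> mf /integrableP[_ h] l0; apply/integrableP; split; first exact/measurable_EFinP.
have mf' : measurable_fun setT (fun x => `|(f x)%:E|%E).
  by apply: measurableT_comp => //; exact/measurable_EFinP.
rewrite /= in h.
have := @ge0_integral_rn _ mf' (fun=> abse_ge0 _).
rewrite ltNge leye_eq; apply: contraPN => /eqP -> e.
by move: h; rewrite -e gt0_muley ?lte_fin// ltxx.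
Qed.

Lemma E_rn (f : R -> R) : measurable_fun setT f -> rho.-integrable A (EFin \o f) ->
  rl%:num * \int[rn]_x f x = \int[rho]_(x in A) f x.
Proof.
move=> mf intf.
have h (g : R -> R) : measurable_fun setT g -> (forall x, 0 <= g x) ->
    rho.-integrable A (EFin \o g) ->
    rl%:num * \int[rn]_x g x = \int[rho]_(x in A) g x.
  move=> mg g0 ig; rewrite /Rintegral -ge0_integral_rn//; last first.
    exact/measurable_EFinP.
  have [l0|l0] := eqVneq rl%:num 0; first by rewrite l0 mul0e mul0r.
  have l1 : 0 < rl%:num by rewrite lt_neqAle eq_sym l0 /=.
  rewrite fineM//; apply: integrable_fin_num => //; exact: integrable_rn.
(* A difference of two nonnegative integrable functions, for each of which the identity is known. *)
have fE x : f x = `|f x| - (`|f x| - f x) by rewrite opprB addrCA subrr addr0.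
pose f1 x := `|f x|; pose f2 x := `|f x| - f x.
have m1 : measurable_fun setT f1 by exact: measurableT_comp.
have m2 : measurable_fun setT f2 by exact: measurable_funB.
have i1 : rho.-integrable A (EFin \o f1) by exact: (integrable_norm intf).
have i2 : rho.-integrable A (EFin \o f2).
  rewrite (_ : EFin \o f2 = (EFin \o f1) \- (EFin \o f))%E//.
  exact: integrableB.
have h1 := h _ m1 (fun=> normr_ge0 _) i1.
have h2 : rl%:num * \int[rn]_x f2 x = \int[rho]_(x in A) f2 x.
  by apply: h => // x; rewrite subr_ge0 ler_norm.
rewrite (_ : \int[rho]_(x in A) f x = \int[rho]_(x in A) f1 x - \int[rho]_(x in A) f2 x); last first.
  by rewrite -RintegralB//; apply: eq_Rintegral => x _; exact: fE.
have [l0|l0] := eqVneq rl%:num 0.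
  by rewrite -h1 -h2 l0 !mul0r subrr.
have l1 : 0 < rl%:num by rewrite lt_neqAle eq_sym l0 /=.
rewrite -h1 -h2 -mulrBr -RintegralB//; [|exact: integrable_rn..].
by congr (_ * _); apply: eq_Rintegral => x _; exact: fE.
Qed.

Lemma rn_supp : 0 < rl%:num -> rn (~` A) = 0%E.
Proof.
move=> l0; have rAE : (mrestr rho mA : {measure set R -> \bar R}) setT = rho A by exact: (congr1 rho (setTI A)).
have r0 : rho A != 0%E.
  by apply: contraTN l0 => /eqP r0; rewrite /= r0 ltxx.
rewrite /rn /= /mnormalize /= rAE (negbTE r0) (lt_eqF rA) /=.
by rewrite /mrestr setICl measure0 mul0e.
Qed.

End restriction.

(** * Elementary inequalities and integrability against a Lévy measure *)

Section trig.
Context (R : realType).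
Implicit Types (x y : R).

Lemma mvt_le (f df : R -> R) (y M : R) : (forall x, is_derive x 1 f (df x)) ->
  (forall x, `|x| <= `|y| -> `|df x| <= M) -> `|f y - f 0| <= M * `|y|.
Proof.
move=> fd dM.
have fc a b : {within `[a, b], continuous f}.
  by apply: derivable_within_continuous => x _; have [] := fd x.
have [y0|y0|<-] := ltgtP 0 y; last by rewrite subrr !normr0 mulr0.
  have [c] := MVT y0 (fun x _ => fd x) (@fc 0 y).
  rewrite in_itv/= => /andP[c0 cy] ->; rewrite subr0 normrM ler_wpM2r// dM//.
  by rewrite !gtr0_norm// ltW.
have [c] := MVT y0 (fun x _ => fd x) (@fc y 0).
rewrite in_itv/= => /andP[c0 cy]; rewrite sub0r distrC => ->.
by rewrite normrM normrN ler_wpM2r// dM// !ltr0_norm// lerN2 ltW.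
Qed.

Lemma sin_le_norm y : `|sin y| <= `|y|.
Proof.
have := @mvt_le sin cos y 1 (@is_derive_sin R) (fun x _ => cos_max x).
by rewrite sin0 subr0 mul1r.
Qed.

Lemma cos_sub1_norm y : `|cos y - 1| <= `|y|.
Proof.
have := @mvt_le cos (fun x => - sin x) y 1 (@is_derive_cos R).
by rewrite cos0 mul1r; apply => x _; rewrite normrN sin_max.
Qed.

Lemma cos_sub1_sqr y : `|cos y - 1| <= y ^+ 2.
Proof.
have := @mvt_le cos (fun x => - sin x) y `|y| (@is_derive_cos R).
rewrite cos0 -expr2 real_normK ?num_real//; apply => x xy.
by rewrite normrN (le_trans (sin_le_norm _)).
Qed.

Lemma sin_sub_sqr y : `|sin y - y| <= y ^+ 2.
Proof.
have d (x : R) : is_derive x 1 (fun x => sin x - x) (cos x - 1).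
  by apply: is_derive_eq.
have := @mvt_le _ _ y `|y| d.
rewrite sin0 !subr0 -expr2 real_normK ?num_real//; apply => x xy.
by rewrite (le_trans (cos_sub1_norm _)).
Qed.

(** For the exponential moments of compensated small jumps, where the linear term has cancelled. *)
Lemma expR_sub2 y : expR y - 1 - y <= y ^+ 2 * expR `|y|.
Proof.
have [y0|y0] := leP 0 y.
  rewrite ger0_norm//.
  have h : expR y - 1 <= y * expR y.
    have := expR_ge1Dx (- y); rewrite -subr_ge0 expRN => h.
    have := mulr_ge0 h (expR_ge0 y).
    rewrite mulrBl mulVf ?gt_eqF ?expR_gt0// mulrDl mul1r mulNr.
    by lra.
  have h2 : y * (expR y - 1) <= y * (y * expR y) by rewrite ler_wpM2l.
  by rewrite expr2 -mulrA; nra.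
have z0 : 0 < - y by rewrite oppr_gt0.
have h := expR_ge1Dx (- y); have h1 : expR (- y) * expR y = 1 by rewrite -expRD addNr expR0.
have e0 := expR_gt0 y.
have h2 : expR y - 1 - y <= y ^+ 2 by nra.
rewrite (le_trans h2)// ler_peMr ?sqr_ge0// -[leLHS]expR0 ler_expR//.
Qed.

End trig.

Section levy_int.
Context (R : realType) (rho : {measure set R -> \bar R}).
Hypothesis hrho : levy_measure rho.

Lemma measurable_sqr : measurable_fun setT (fun x : R => x ^+ 2).
Proof. by apply: continuous_measurable_fun; exact: exprn_continuous. Qed.

Lemma measurable_min1sqr : measurable_fun setT (fun x : R => Num.min 1 (x ^+ 2)).
Proof. by apply: measurable_minr => //; exact: measurable_sqr. Qed.

Lemma levy_integrable (f : R -> R) (C : R) : measurable_fun setT f ->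
  (forall x, `|f x| <= C * Num.min 1 (x ^+ 2)) -> rho.-integrable setT (EFin \o f).
Proof.
move=> mf fC.
have m0 (x : R) : 0 <= Num.min 1 (x ^+ 2) by rewrite le_min ler01 sqr_ge0.
have i1 : rho.-integrable setT (EFin \o (fun x : R => Num.min 1 (x ^+ 2))).
  apply/integrableP; split; first by apply/measurable_EFinP; exact: measurable_min1sqr.
  by under eq_integral do rewrite /= ger0_norm//.
apply: (le_integrable measurableT _ _ (integrableZl measurableT C i1)).
  exact/measurable_EFinP.
by move=> x _; rewrite /= lee_fin (le_trans (fC x))// ler_norm.
Qed.

Lemma levy_finite (c : R) (A : set R) : 0 < c -> measurable A ->
  (forall x, A x -> c <= `|x|) -> (rho A < +oo)%E.
Proof.
move=> c0 mA hA; pose m := Num.min 1 (c ^+ 2).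
have m0 : 0 < m by rewrite lt_min ltr01 exprn_gt0.
have i : rho.-integrable setT (EFin \o (\1_A : R -> R)).
  apply: (@levy_integrable _ m^-1); first exact: measurable_indic.
  move=> x; rewrite indicE; have [xA|_] := boolP (x \in A); last first.
    by rewrite normr0 mulr_ge0// ?invr_ge0 ?(ltW m0)// le_min ler01 sqr_ge0.
  rewrite normr1 ler_pdivlMl// mulr1 /m le_min ge_min lexx/= ge_min.
  apply/orP; right; rewrite -(real_normK (num_real x)).
  by rewrite ler_pXn2r ?nnegrE ?(ltW c0)//; apply: hA; rewrite inE in xA.
have /integrableP[_] := i.
under eq_integral do rewrite /= ger0_norm//.
by rewrite integral_indic// setIT.
Qed.

Lemma measurable_sinc (s : R) : measurable_fun setT (fun x : R => sin (s * x)).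
Proof.
apply: (measurableT_comp (continuous_measurable_fun (@continuous_sin R))).
exact: measurable_funM.
Qed.

Lemma measurable_cosc (s : R) : measurable_fun setT (fun x : R => cos (s * x)).
Proof.
apply: (measurableT_comp (continuous_measurable_fun (@continuous_cos R))).
exact: measurable_funM.
Qed.

(** [cpart] and [spart] are the integrands of [psi_re] and [psi_im]: quadratic near 0 and bounded at
    infinity, hence integrable. *)
Definition cpart (s x : R) := cos (s * x) - 1.
Definition spart (s x : R) := sin (s * x) - (if `|x| <= 1 then s * x else 0).

Lemma measurable_cpart s : measurable_fun setT (cpart s).
Proof. by apply: measurable_funB => //; exact: measurable_cosc. Qed.

Lemma measurable_trunc (c : R) : measurable_fun setT (fun x : R => if `|x| <= 1 then c * x else 0).
Proof.
apply: measurable_fun_ifT => //; first by apply: measurable_fun_ler => //; exact: measurableT_comp.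
Qed.

Lemma measurable_spart s : measurable_fun setT (spart s).
Proof. by apply: measurable_funB; [exact: measurable_sinc|exact: measurable_trunc]. Qed.

Lemma cpart_int s : rho.-integrable setT (EFin \o cpart s).
Proof.
apply: (@levy_integrable _ (2 + s ^+ 2)); first exact: measurable_cpart.
move=> x; rewrite minr_pMr ?addr_ge0 ?sqr_ge0// le_min; apply/andP; split.
  rewrite mulr1 /cpart (le_trans (ler_normB _ _))// normr1.
  by have := cos_max (s * x); have := sqr_ge0 s; lra.
by rewrite (le_trans (cos_sub1_sqr _))// exprMn mulrDl lerDr mulr_ge0 ?sqr_ge0.
Qed.

Lemma spart_int s : rho.-integrable setT (EFin \o spart s).
Proof.
apply: (@levy_integrable _ (1 + `|s| + s ^+ 2)); first exact: measurable_spart.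
have s2 := sqr_ge0 s; have n2 := normr_ge0 s.
have C0 : 0 <= 1 + `|s| + s ^+ 2 by lra.
move=> x; rewrite minr_pMr// le_min; apply/andP; split.
  rewrite mulr1 /spart; have := sin_max (s * x); case: ifPn => [x1 h|_ h].
    rewrite (le_trans (ler_normB _ _))// normrM.
    have : `|s| * `|x| <= `|s| by rewrite ler_piMr.
    lra.
  by rewrite subr0; lra.
rewrite /spart; case: ifPn => [x1|x1].
  rewrite (le_trans (sin_sub_sqr _))// exprMn ler_wpM2r ?sqr_ge0//.
  lra.
rewrite -ltNge in x1; rewrite subr0 (le_trans (sin_max _))//.
have : 1 <= x ^+ 2 by rewrite -real_normK ?num_real// expr_ge1// ltW.
by move=> h; rewrite (le_trans h)// ler_peMl ?sqr_ge0//; lra.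
Qed.

End levy_int.

(** * Algebra of convolutions *)

Section conv_more.
Context (R : realType).
Implicit Types (a b c m : probability R R).

Lemma E_convA a b c (f : R -> R) : bdm f ->
  \int[conv (conv a b) c]_x f x = \int[conv a (conv b c)]_x f x.
Proof.
move=> bf; have bg := bdm_fubini1 a c (bdm_add2 bf).
rewrite (@E_conv _ (conv a b) c f bf) (@E_conv _ a b _ bg) (@E_conv _ a (conv b c) f bf).
apply: eq_Rintegral => x _.
have bh : bdm (fun y => f (x + y)) by have := bdm_shift x bf; under eq_fun do rewrite addrC.
rewrite (@E_conv _ b c _ bh).
by apply: eq_Rintegral => y _; apply: eq_Rintegral => z _; rewrite addrA.
Qed.

Lemma E_convC a b (f : R -> R) : bdm f ->
  \int[conv a b]_x f x = \int[conv b a]_x f x.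
Proof.
move=> bf; rewrite (@E_conv _ a b f bf) (@E_convr _ b a f bf); apply: eq_Rintegral => x _.
by apply: eq_Rintegral => y _; rewrite addrC.
Qed.

Lemma tl_convA a b c x : tl (conv (conv a b) c) x = tl (conv a (conv b c)) x.
Proof. by rewrite !tlE E_convA//; exact: bdm_lt. Qed.

Lemma tl_convC a b x : tl (conv a b) x = tl (conv b a) x.
Proof. by rewrite !tlE E_convC//; exact: bdm_lt. Qed.

Lemma tl_conv_congl a a' b x : (forall y, tl a y = tl a' y) ->
  tl (conv a b) x = tl (conv a' b) x.
Proof. by move=> h; rewrite !tl_conv; apply: eq_Rintegral => y _; rewrite h. Qed.

Lemma tl_conv_congr a b b' x : (forall y, tl b y = tl b' y) ->
  tl (conv a b) x = tl (conv a b') x.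
Proof. by move=> h; rewrite !tl_convl; apply: eq_Rintegral => y _; rewrite h. Qed.

Lemma tl_convAC a b c x : tl (conv (conv a b) c) x = tl (conv (conv a c) b) x.
Proof.
by rewrite tl_convA [RHS]tl_convA; apply: tl_conv_congr => y; exact: tl_convC.
Qed.

Lemma le_tl_convl a a' b C x : (forall y, tl a y <= C * tl a' y) ->
  tl (conv a b) x <= C * tl (conv a' b) x.
Proof.
move=> h; have mu : measurable_fun setT (fun y : R => x - y) by exact: measurable_funB.
rewrite !tl_conv -E_Z; last exact: bdm_tl.
apply: le_E; [exact: bdm_tl|by apply: bdmM; [exact: bdm_cst|exact: bdm_tl]|].
by move=> y; exact: h.
Qed.

Lemma chf_cvg_polar (an : nat -> probability R R) a :
  (forall s, exists rn tn r t, [/\ forall n, polar (an n) s (rn n) (tn n),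
     polar a s r t, rn n @[n --> \oo] --> r & tn n @[n --> \oo] --> t]) ->
  chf_cvg an a.
Proof.
move=> h s p; have [rn' [tn [r [t [hn ha cr ct]]]]] := h s.
rewrite ha; under eq_cvg do rewrite hn.
apply: cvgM => //; apply: continuous_cvg; first exact: continuous_cos.
by apply: cvgD => //; exact: cvg_cst.
Qed.

End conv_more.

(** * Tails of compound Poisson laws with light jumps *)

Section cp_tails.
Context (R : realType).
Implicit Types (a b m Y : probability R R) (l : {nonneg R}).

Lemma tl_conv_point Y x : tl (conv Y (point 0)) x = tl Y x.
Proof.
rewrite tl_conv E_point ?subr0//; exact: bdm_tl_sub.
Qed.

(** Conditioning on the number of jumps; all estimates on compound Poisson tails compare such series
    term by term. *)
Lemma cvg_tl_cp Y l m x :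
  series (fun k => (pw l k)%:num * tl (conv Y (convn m k)) x) n @[n --> \oo] -->
  tl (conv Y (cp l m)) x.
Proof.
have bf : bdm (fun y : R => tl Y (x - y)) by exact: bdm_tl_sub.
have e a : tl (conv Y a) x = \int[a]_y tl Y (x - y) by exact: tl_conv.
rewrite e (_ : (fun k => (pw l k)%:num * tl (conv Y (convn m k)) x) =
  (fun k => (pw l k)%:num * \int[convn m k]_y tl Y (x - y))); first exact: E_cp.
by apply/funext => k; rewrite e.
Qed.

Lemma series_le_lim (u : nat -> R) (L : R) : (forall k, 0 <= u k) ->
  series u n @[n --> \oo] --> L -> forall n, series u n <= L.
Proof.
move=> u0 uL n; have c : cvgn (series u) by apply/cvg_ex; exists L.
have <- : limn (series u) = L by apply/cvg_lim.
apply: nondecreasing_cvgn_le => // i j ij.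
by rewrite /series/= (big_cat_nat (leq0n i) ij)/= lerDl sumr_ge0.
Qed.

Lemma series_term_le (u : nat -> R) (L : R) k : (forall k, 0 <= u k) ->
  series u n @[n --> \oo] --> L -> u k <= L.
Proof.
move=> u0 uL; apply: le_trans (series_le_lim u0 uL k.+1).
by rewrite /series/= big_nat_recr//= lerDr sumr_ge0.
Qed.

Lemma series_lim_le (u : nat -> R) (L M : R) :
  series u n @[n --> \oo] --> L -> (forall n, series u n <= M) -> L <= M.
Proof.
move=> uL uM; have <- : limn (series u) = L by apply/cvg_lim.
by apply: limr_le; [apply/cvg_ex; exists L|exact: nearW].
Qed.

Lemma tl_cp_ge Y l m x k :
  (pw l k)%:num * tl (conv Y (convn m k)) x <= tl (conv Y (cp l m)) x.
Proof.
have h (i : nat) : 0 <= (pw l i)%:num * tl (conv Y (convn m i)) x.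
  by apply: mulr_ge0 => //; exact: tl_ge0.
exact: (series_term_le k h (@cvg_tl_cp Y l m x)).
Qed.

Lemma tl_cp_ge0 Y l m x : expR (- l%:num) * tl Y x <= tl (conv Y (cp l m)) x.
Proof.
apply: le_trans (tl_cp_ge Y l m x 0); rewrite /= tl_conv_point.
by rewrite expr0 fact0 invr1 !mulr1.
Qed.

Lemma pw_sum_le1 l n : \sum_(0 <= k < n) (pw l k)%:num <= 1.
Proof. by apply: (series_le_lim _ (cvg_pw l)) => k. Qed.

Lemma tl_convn0 m k : tl m 0 = 0 -> tl (convn m k) 0 = 0.
Proof.
move=> m0; elim: k => [|k IH] /=.
  rewrite tlE E_point ?ltxx//; exact: bdm_lt.
apply/eqP; rewrite eq_le tl_ge0 andbT.
by apply: le_trans (tl_conv_le _ _ 0 0) _; rewrite subr0 m0 IH addr0.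
Qed.

Lemma tl_conv_nonpos Y a x : tl a 0 = 0 -> tl (conv Y a) x <= tl Y x.
Proof. by move=> a0; apply: le_trans (tl_conv_le _ _ x 0) _; rewrite a0 subr0 addr0. Qed.

Lemma tl_cp_nonpos Y l m x : tl m 0 = 0 -> tl (conv Y (cp l m)) x <= tl Y x.
Proof.
move=> m0; apply: (series_lim_le (@cvg_tl_cp Y l m x)) => n.
apply: (@le_trans _ _ (\sum_(0 <= k < n) (pw l k)%:num * tl Y x)).
  apply: ler_sum => k _; apply: ler_wpM2l => //.
  by apply: tl_conv_nonpos; exact: tl_convn0.
by rewrite -mulr_suml ler_piMl ?tl_ge0//; exact: pw_sum_le1.
Qed.

Lemma tl_conv_ge_supp Y a c x : tl a c = 1 -> tl Y (x - c) <= tl (conv Y a) x.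
Proof.
move=> a1; have := tl_conv_ge Y a x (- c).
by rewrite opprK a1 subrr subr0.
Qed.

Lemma tl_convn_supp Y m c x k : tl m c = 1 ->
  tl Y (x - k%:R * c) <= tl (conv Y (convn m k)) x.
Proof.
move=> m1; elim: k x => [|k IH] x /=; first by rewrite mul0r subr0 tl_conv_point.
apply: (@le_trans _ _ (tl (conv Y (convn m k)) (x - c))).
  apply: le_trans (IH (x - c)); apply: tl_le; rewrite -natr1; lra.
have -> : tl (conv Y (conv m (convn m k))) x = tl (conv (conv Y (convn m k)) m) x.
  by rewrite -tl_convA; exact: tl_convAC.
exact: tl_conv_ge_supp.
Qed.

Lemma tl_cp_nonneg Y l m c x : 0 <= c -> tl m c = 1 -> tl Y x <= tl (conv Y (cp l m)) x.
Proof.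
move=> c0 m1.
have h : (fun n => (\sum_(0 <= k < n) (pw l k)%:num) * tl Y x) n @[n --> \oo] --> 1 * tl Y x.
  by apply: cvgMr_tmp; exact: cvg_pw.
rewrite mul1r in h.
have <- : limn (fun n => (\sum_(0 <= k < n) (pw l k)%:num) * tl Y x) = tl Y x by apply/cvg_lim.
apply: limr_le; first by apply/cvg_ex; exists (tl Y x).
apply: nearW => n.
have hh : forall k, 0 <= (pw l k)%:num * tl (conv Y (convn m k)) x.
  by move=> k; apply: mulr_ge0 => //; exact: tl_ge0.
apply: le_trans (series_le_lim hh (@cvg_tl_cp Y l m x) n).
rewrite mulr_suml; apply: ler_sum => k _; apply: ler_wpM2l => //.
apply: le_trans (tl_convn_supp Y x k m1).
by apply: tl_le; rewrite gerBl mulr_ge0.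
Qed.

Lemma expR_sum_sqr (x : R) : x ^+ 2 / 4 + 2 <= expR x + expR (- x).
Proof.
have h (y : R) : 0 <= y -> y ^+ 2 / 4 + 2 <= expR y + expR (- y).
  move=> y0; have h1 := expR_ge1Dx (- y); have h2 := expR_ge1Dx (y / 2).
  have e : expR y = expR (y / 2) ^+ 2 by rewrite expr2 -expRD; congr expR; field.
  have h3 : (1 + y / 2) ^+ 2 <= expR y.
    by rewrite e ler_pXn2r ?nnegrE ?expR_ge0// addr_ge0 ?divr_ge0.
  by move: h3; rewrite sqrrD expr1n; lra.
have [x0|x0] := leP 0 x; first exact: h.
have := h (- x); rewrite sqrrN opprK oppr_ge0 addrC => hx; rewrite addrC [leRHS]addrC.
by rewrite addrC [leRHS]addrC; have := hx (ltW x0); lra.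
Qed.

(** Chebyshev's inequality from the moments at 1 and -1, by [x ^ 2 / 4 + 2 <= exp x + exp (- x)].
    Over a short time [t] both moments are [1 + O(t)], so the 2 on the left leaves a deviation
    probability [O(t / e ^ 2)]: hence the condition on the window in Ottaviani's inequality. *)
Lemma mgf_cheb a (M1 M2 e : R) : 0 <= e -> mgfle a 1 M1 -> mgfle a (-1) M2 ->
  e ^+ 2 / 4 * (1 - tl a (- e)) + 2 <= M1 + M2.
Proof.
move=> e0 h1 h2; rewrite /mgfle in h1 h2.
have bl : bdm (fun x : R => ((- e < x)%R)%:R : R) by apply: bdm_lt.
pose g (x : R) : R := e ^+ 2 / 4 * (1 - ((- e < x)%R)%:R) + 2.
have b1 : bdm (fun x : R => 1 - ((- e < x)%R)%:R : R) by apply: bdmB => //; exact: bdm_cst.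
have bM : bdm (fun x : R => e ^+ 2 / 4 * (1 - ((- e < x)%R)%:R) : R) by apply: bdmM => //; exact: bdm_cst.
have bg : bdm g by apply: bdmD => //; exact: bdm_cst.
have g0 x : 0 <= g x.
  rewrite addr_ge0// mulr_ge0 ?divr_ge0 ?sqr_ge0//.
  by case: (_ < _); rewrite ?subrr ?subr0.
have <- : \int[a]_x g x = e ^+ 2 / 4 * (1 - tl a (- e)) + 2.
  rewrite E_D//; last exact: bdm_cst.
  rewrite E_Z// E_B//; last exact: bdm_cst.
  by rewrite (E_cst a 1) (E_cst a 2) tlE.
rewrite -lee_fin -E_EFin// EFinD; apply: le_trans (leeD h1 h2).
rewrite -ge0_integralD//; last 2 first.
- exact: measurable_expt.
- exact: measurable_expt.
apply: ge0_le_integral => //.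
- by move=> x _; rewrite lee_fin.
- by apply/measurable_EFinP; case: bg.
- by apply: emeasurable_funD; exact: measurable_expt.
move=> x _; rewrite -EFinD lee_fin mul1r mulN1r /g; have [ex|xe] := ltP (- e) x.
  rewrite subrr mulr0 add0r; apply: le_trans (expR_sum_sqr x).
  by rewrite lerDr divr_ge0 ?sqr_ge0.
rewrite subr0 mulr1; apply: le_trans (expR_sum_sqr x).
rewrite lerD2r ler_wpM2r ?invr_ge0// -(sqrrN x) ler_pXn2r ?nnegrE//; lra.
Qed.

End cp_tails.

(** * Lightness under convolution powers *)

Section light.
Context (R : realType).
Implicit Types (a c m : probability R R).

Lemma tl_conv_mul a c x y : tl a x * tl c y <= tl (conv a c) (x + y).
Proof.
have mu : measurable_fun setT (fun z : R => x + y - z) by exact: measurable_funB.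
have bc : bdm (fun z : R => ((y < z)%R)%:R : R) by apply: bdm_lt.
rewrite tl_conv (tlE c) -E_Z//; apply: le_E; [by apply: bdmM => //; exact: bdm_cst|exact: bdm_tl|].
move=> z; have [yz|zy] := ltP y z; last by rewrite mulr0 tl_ge0.
by rewrite mulr1; apply: tl_le; rewrite -addrA gerDl subr_le0 ltW.
Qed.

(** Either the summand with law [c] exceeds [u - x0], or the other one has to exceed a level in the
    range where [a] and [a'] are compared. *)
Lemma tl_conv_split a a' c C u x0 : 0 <= C ->
  (forall x, x0 <= x -> tl a x <= C * tl a' x) ->
  tl (conv a c) u <= C * tl (conv a' c) u + tl c (u - x0).
Proof.
move=> C0 h.
have mu : measurable_fun setT (fun z : R => u - z) by exact: measurable_funB.
have bc : bdm (fun z : R => ((u - x0 < z)%R)%:R : R) by apply: bdm_lt.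
have ba : bdm (fun z : R => C * tl a' (u - z)) by apply: bdmM; [exact: bdm_cst|exact: bdm_tl].
rewrite !tl_conv (tlE c) -E_Z; last exact: bdm_tl.
rewrite -E_D//; apply: le_E; [exact: bdm_tl|exact: bdmD|].
move=> z; have [xz|zx] := ltP (u - x0) z.
  by apply: (le_trans (tl_le1 _ _)); rewrite lerDr mulr_ge0// tl_ge0.
by rewrite addr0; apply: h; rewrite lerBrDl -lerBrDr.
Qed.

(** The only form in which lightness is used: [n] jumps are negligible against [n + 1]. *)
Definition light_step m := forall n eta, 0 < eta -> exists x0, forall x, x0 <= x ->
  tl (convn m n) x <= eta * tl (convn m n.+1) x.

Lemma tl_convn_point0 m x : 0 <= x -> tl (convn m 0) x = 0.
Proof.
move=> x0; rewrite tlE /= E_point; last exact: bdm_lt.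
by rewrite ltNge x0.
Qed.

(** When jumps are bounded by [B], a sum of [n] of them cannot exceed [n B], so the left side is
    eventually 0. *)
Lemma light_step_bounded m A : tl m A = 0 -> light_step m.
Proof.
move=> mA n eta eta0.
pose B := Num.max A 0.
have B0 : 0 <= B by rewrite le_max lexx orbT.
have mB : tl m B = 0.
  by apply/eqP; rewrite eq_le tl_ge0 andbT -mA; apply: tl_le; rewrite le_max lexx.
have h k x : k%:R * B <= x -> tl (convn m k) x = 0.
  elim: k x => [|k IH] x kx; first by apply: tl_convn_point0; rewrite mul0r in kx.
  apply/eqP; rewrite eq_le tl_ge0 andbT /= tl_convC.
  apply: (le_trans (tl_conv_le _ _ x B)); rewrite mB addr0.
  by rewrite IH// lerBrDr; move: kx; rewrite -natr1 mulrDl mul1r.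
exists (n%:R * B) => x nx; rewrite h//; apply: mulr_ge0; [exact: ltW|exact: tl_ge0].
Qed.

Lemma light_step_unbounded m : (forall x, 0 < tl m x) ->
  (forall eta, 0 < eta -> exists x0, forall x, x0 <= x -> tl m x <= eta * tl (conv m m) x) ->
  light_step m.
Proof.
move=> m0 hm; elim=> [|n IH] eta eta0.
  exists 0 => x x0; rewrite tl_convn_point0//.
  by apply: mulr_ge0; [exact: ltW|exact: tl_ge0].
have e2 : 0 < eta / 2 by rewrite divr_gt0.
have [x0 h0] := hm _ e2.
(* The splitting leaves [n] jumps at the lower level [u - x0]. The factor [tl m x0] put into the
   tolerance is the probability of one more jump above [x0], which makes up for the lost [x0]. *)
have e3 : 0 < eta / 2 * tl m x0 by rewrite mulr_gt0.
have [x1 h1] := IH _ e3.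
exists (x1 + x0) => u hu.
have := @tl_conv_split m (conv m m) (convn m n) (eta / 2) u x0 (ltW e2) h0.
rewrite tl_convA -[tl (conv m (convn m n)) u]/(tl (convn m n.+1) u)
  -[tl (conv m (conv m (convn m n))) u]/(tl (convn m n.+2) u) => k1.
have k2 := h1 (u - x0); rewrite lerBrDr in k2; have {}k2 := k2 hu.
have k3 := tl_conv_mul m (convn m n.+1) x0 (u - x0).
rewrite (addrC x0) subrK -[tl (conv m (convn m n.+1)) u]/(tl (convn m n.+2) u) in k3.
apply: (le_trans k1); rewrite [in leRHS](splitr eta) mulrDl lerD2l.
apply: (le_trans k2); rewrite -mulrA ler_wpM2l//; exact: ltW.
Qed.

Lemma tl_convn_pow m x n : tl m x ^+ n.+1 <= tl (convn m n.+1) (n.+1%:R * x).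
Proof.
elim: n => [|n IH]; first by rewrite expr1 mul1r /= tl_conv_point.
rewrite exprS -[n.+2%:R]natr1 mulrDl mul1r (addrC (n.+1%:R * x) x).
apply: le_trans (tl_conv_mul m (convn m n.+1) x (n.+1%:R * x)).
by apply: ler_wpM2l => //; exact: tl_ge0.
Qed.

End light.

Section numeric.
Context (R : realType).

Lemma fact_le_pow (n : nat) : (n`! <= n ^ n)%N.
Proof.
elim: n => [|n IH]; first by [].
rewrite factS expnS leq_mul2l/= (leq_trans IH)//.
by case: n {IH} => [//|n]; rewrite leq_exp2r.
Qed.

Lemma sqr_le_expR_half (x : R) : 0 <= x -> x ^+ 2 <= 16 * expR (x / 2).
Proof.
move=> x0; have h := expR_ge1Dx (x / 4).
have e : expR (x / 2) = expR (x / 4) ^+ 2 by rewrite expr2 -expRD; congr expR; field.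
have h2 : (1 + x / 4) ^+ 2 <= expR (x / 2).
  by rewrite e ler_pXn2r ?nnegrE ?expR_ge0// addr_ge0 ?divr_ge0.
have := h2; rewrite !expr2 => h3; nra.
Qed.

(** The comparison of exponents in [jumps_dominate], with [x = ln i] for [i] jumps: [- i ln i]
    absorbs all other terms. *)
Lemma numeric_bound (C1 C2 C3 C6 : R) : 0 <= C2 -> 0 <= C3 ->
  exists x0, forall x, x0 <= x ->
  expR x * (- x + C1) + C2 * x + C3 * (x ^+ 2 * expR (x / 2)) + C6 <= 0.
Proof.
move=> C20 C30; exists (Num.max 0 (C1 + C2 + 16 * C3 + `|C6|)) => x.
rewrite ge_max => /andP[x0 hx].
have e1 : 1 <= expR x by rewrite -[leLHS]expR0 ler_expR.
have e2 : x <= expR x by have := expR_ge1Dx x; lra.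
have e3 : x ^+ 2 * expR (x / 2) <= 16 * expR x.
  rewrite [in leRHS](_ : x = x / 2 + x / 2); last by field.
  by rewrite expRD mulrA ler_wpM2r ?expR_ge0// sqr_le_expR_half.
have a1 : C2 * x <= C2 * expR x by exact: ler_wpM2l.
have a2 : C3 * (x ^+ 2 * expR (x / 2)) <= C3 * (16 * expR x) by exact: ler_wpM2l.
have a3 : C6 <= `|C6| * expR x.
  by apply: (le_trans (ler_norm C6)); rewrite ler_peMr.
have a4 : expR x * (- x + C1 + C2 + 16 * C3 + `|C6|) <= 0.
  by rewrite mulr_ge0_le0 ?expR_ge0//; lra.
have -> : expR x * (- x + C1) = expR x * (- x + C1 + C2 + 16 * C3 + `|C6|)
  - C2 * expR x - C3 * (16 * expR x) - `|C6| * expR x by ring.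
lra.
Qed.

End numeric.

(** * Many large jumps against the tame part *)

Section jumps.
Context (R : realType) (m : probability R R) (b : R).
Hypotheses (b0 : 0 < b) (m1 : tl m b = 1) (p0 : 0 < tl m (4 * b)).
Variables (G S V L c : R).
Hypotheses (G0 : 0 <= G) (S0 : 0 <= S) (V0 : 0 <= V) (c0 : 0 < c).
Variable l : {nonneg R}.
Hypothesis l0 : 0 < l%:num.

(* What is needed of the part of the process without jumps above [b], with constants that do
   not depend on the approximation. *)
Definition tame (Y : probability R R) :=
  (forall x th, 0 <= th -> tl Y x <= expR (- (th * x)) *
     expR (G * th + S * th ^+ 2 + V * (th ^+ 2 * expR (th * b)))) /\
  c <= tl Y (- L).

Lemma conv_tame_low Y k x : tame Y -> c * tl (convn m k) (x + L) <= tl (conv Y (convn m k)) x.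
Proof.
move=> [_ hL]; have := tl_conv_mul Y (convn m k) (- L) (x + L).
rewrite (addrC (- L)) addrK; apply: le_trans; apply: ler_wpM2r => //; exact: tl_ge0.
Qed.

Lemma conv_tame_pow Y k u : tame Y -> u + 2 * L <= k.+1%:R * (4 * b) ->
  c * tl m (4 * b) ^+ k.+1 <= tl (conv Y (convn m k.+1)) (u + L).
Proof.
move=> hY hu; apply: le_trans (conv_tame_low k.+1 (u + L) hY).
apply: ler_wpM2l; first exact: ltW.
apply: le_trans (tl_convn_pow _ _ _) _; apply: tl_le; lra.
Qed.

(** Only the order [k ln k] of the exponent matters, so [k! <= k ^ k] replaces Stirling's
    formula. *)
Lemma pw_pow_ge (k : nat) (q : R) : (0 < k)%N -> 0 < q ->
  expR (- l%:num + k%:R * ln (l%:num * q) - k%:R * ln k%:R) <= (pw l k)%:num * q ^+ k.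
Proof.
move=> k0 q0; rewrite expRD expRD -mulrA !expRN.
rewrite !expRM_natl !lnK ?posrE ?mulr_gt0 ?ltr0n// exprMn.
rewrite /= expRN -!mulrA ler_wpM2l ?invr_ge0 ?expR_ge0// ler_wpM2l ?exprn_ge0//.
rewrite mulrC ler_wpM2r ?exprn_ge0 ?(ltW q0)//.
by rewrite lef_pV2 ?posrE ?exprn_gt0 ?ltr0n ?fact_gt0// -natrX ler_nat fact_le_pow.
Qed.

(* With [i ~ u / (4 b)], reaching [u] by [i] jumps above [4 b] has probability
   [exp (- i ln i + O(i))], while Chernoff's bound with exponent [ln i / (2 b)] gives
   [exp (- 2 i ln i + O(i))] for [Y]. *)
Lemma jumps_dominate X (e : R) : 0 < e -> exists u0, forall u, u0 <= u -> forall Y, tame Y ->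
  tl Y (u - X) <= e * tl (conv Y (cp l m)) (u + L).
Proof.
move=> e0; pose q := tl m (4 * b); pose D := 4 * b + 2 * L + X.
have C20 : 0 <= `|D| / (2 * b) + G / (2 * b) by rewrite addr_ge0// divr_ge0// mulr_ge0// ltW.
have C30 : 0 <= S / (4 * b ^+ 2) + V / (4 * b ^+ 2).
  by rewrite addr_ge0// divr_ge0// mulr_ge0// sqr_ge0.
have [x0 hx] := numeric_bound (- ln (l%:num * q)) (l%:num - ln (e * c)) C20 C30.
exists (4 * b * expR x0 - 2 * L) => u hu Y hY.
have y0 : expR x0 <= (u + 2 * L) / (4 * b).
  rewrite ler_pdivlMr; last by rewrite mulr_gt0.
  by rewrite mulrC -lerBlDr.
have := truncn_itv (le_trans (expR_ge0 x0) y0).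
(* Just enough jumps above [4 * b] to exceed [u + 2 * L]: one [L] belongs to the target [u + L], the
   other allows [Y] to be as low as [- L]. *)
set i := (Num.truncn _).+1 => /andP[hi1 hi2].
have i0 : (0 < i)%N by [].
have xi : x0 <= ln i%:R.
  by rewrite -[leLHS]expRK ler_ln ?posrE ?expR_gt0 ?ltr0n//; apply: (le_trans y0); exact: ltW.
have x1 : 0 <= ln (i%:R : R) by rewrite ln_ge0// ler1n.
have ex : expR (ln i%:R) = i%:R :> R by rewrite lnK// posrE ltr0n.
have {hx} := hx _ xi; rewrite ex; set x := ln i%:R in xi x1 ex * => hx.
have ub : u + 2 * L <= i%:R * (4 * b).
  by rewrite -ler_pdivrMr ?mulr_gt0//; exact: ltW.
have ua : i%:R * (4 * b) - 4 * b <= u + 2 * L.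
  move: hi1; rewrite ler_pdivlMr ?mulr_gt0// => h.
  by rewrite {1}/i -natr1 mulrDl mul1r addrK.
have th0 : 0 <= x / (2 * b) by rewrite divr_ge0// mulr_ge0// ltW.
have [h1 _] := hY; have {h1} h1 := h1 (u - X) _ th0.
have h2 := conv_tame_pow hY ub.
have h3 := pw_pow_ge i0 p0.
have h4 := tl_cp_ge Y l m (u + L) i.
have {}h4 : e * ((pw l i)%:num * (c * q ^+ i)) <= e * tl (conv Y (cp l m)) (u + L).
  apply: ler_wpM2l; first exact: ltW.
  by apply: le_trans h4; exact: ler_wpM2l.
apply: (le_trans h1); apply: le_trans h4.
have -> : e * ((pw l i)%:num * (c * q ^+ i)) = (e * c) * ((pw l i)%:num * q ^+ i) by ring.
rewrite -expRD -[e * c]lnK ?posrE ?mulr_gt0//.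
apply: (@le_trans _ _ (expR (ln (e * c)) * expR (- l%:num + i%:R * ln (l%:num * q) - i%:R * x))); last first.
  by apply: ler_wpM2l; [exact: expR_ge0|exact: h3].
rewrite -expRD ler_expR.
(* With this exponent, a step of [4 * b] gains [2 x], twice the cost [x] of a jump, while
   [exp (theta * b) = exp (x / 2)] is only the square root of [i]. *)
have eb : x / (2 * b) * b = x / 2 by field; rewrite lt0r_neq0.
rewrite eb.
have e1 : x / (2 * b) * (i%:R * (4 * b)) = 2 * i%:R * x by field; rewrite lt0r_neq0.
have e2 : x / (2 * b) * (i%:R * (4 * b) - 4 * b - 2 * L - X) <= x / (2 * b) * (u - X).
  by apply: ler_wpM2l => //; lra.
have e3 : x / (2 * b) * D <= x / (2 * b) * `|D| by apply: ler_wpM2l => //; exact: ler_norm.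
have e4 : x / (2 * b) * (i%:R * (4 * b) - 4 * b - 2 * L - X) = 2 * i%:R * x - x / (2 * b) * D.
  by rewrite -e1 /D; ring.
have e5 : S * (x / (2 * b)) ^+ 2 <= S / (4 * b ^+ 2) * (x ^+ 2 * expR (x / 2)).
  rewrite (_ : S * _ = S / (4 * b ^+ 2) * x ^+ 2); last by field; rewrite lt0r_neq0.
  apply: ler_wpM2l; first by rewrite divr_ge0// mulr_ge0// sqr_ge0.
  rewrite ler_peMr ?sqr_ge0// -[leLHS]expR0 ler_expR; lra.
have e6 : V * ((x / (2 * b)) ^+ 2 * expR (x / 2)) = V / (4 * b ^+ 2) * (x ^+ 2 * expR (x / 2)).
  by field; rewrite lt0r_neq0.
have e7 : G * (x / (2 * b)) = G / (2 * b) * x by ring.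
have e8 : x / (2 * b) * `|D| = `|D| / (2 * b) * x by ring.
rewrite e6.
rewrite e4 in e2; rewrite e8 in e3; rewrite e7; lra.
Qed.

(** Every jump exceeds [b], so [n] additional jumps lift the level by at least [n b]. *)
Lemma conv_convn_shift Y k n x :
  tl (conv Y (convn m k)) x <= tl (conv Y (convn m (k + n))) (x + n%:R * b).
Proof.
elim: n => [|n IH]; first by rewrite addn0 mul0r addr0.
apply: (le_trans IH); rewrite addnS /=.
have -> : tl (conv Y (conv m (convn m (k + n)))) (x + n.+1%:R * b) =
    tl (conv (conv Y (convn m (k + n))) m) (x + n.+1%:R * b).
  by rewrite [LHS](tl_conv_congr _ _ (tl_convC m (convn m (k + n)))) tl_convA.
apply: le_trans (tl_conv_ge_supp _ _ m1); apply: tl_le; rewrite -natr1; lra.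
Qed.

Hypothesis hm : light_step m.

(** Either the [k] jumps alone pass the level [x0] beyond which [light_step] trades them for [k + 1]
    jumps, or [Y] itself is within a bounded distance of [u], which [jumps_dominate] rules out. *)
Lemma few_jumps_negligible k (e : R) : 0 < e -> exists u0, forall u, u0 <= u -> forall Y, tame Y ->
  tl (conv Y (convn m k)) (u + L) <= e * tl (conv Y (cp l m)) (u + L).
Proof.
move=> e0; have e2 : 0 < e / 2 by rewrite divr_gt0.
have v0 : 0 < (pw l k.+1)%:num. by exact: pw_gt0.
have e3 : 0 < e / 2 * (pw l k.+1)%:num by rewrite mulr_gt0.
have [x0 hx] := hm k e3.
have [u0 hu] := jumps_dominate (x0 - L) e2.
exists u0 => u uu Y hY.
have := @tl_conv_split _ (convn m k) (convn m k.+1) Y _ (u + L) x0 (ltW e3) hx.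
rewrite tl_convC [X in _ <= _ * X + _]tl_convC => h; apply: (le_trans h).
rewrite [e in leRHS]splitr mulrDl; apply: lerD.
  rewrite -[leLHS]mulrA; apply: ler_wpM2l; first exact: ltW.
  exact: tl_cp_ge.
by rewrite -addrA -opprB; exact: hu.
Qed.

Lemma bin_pow_le1 (s : R) n k : 0 <= s <= 1 ->
  'C(n + k, k)%:R * (s ^+ n * (1 - s) ^+ k) <= 1.
Proof.
move=> /andP[s0 s1]; have s1' : 0 <= 1 - s by rewrite subr_ge0.
have := exprDn s (1 - s) (n + k); rewrite addrC subrK expr1n => E; rewrite [leRHS]E.
rewrite (bigD1 (inord k : 'I_(n + k).+1))//= inordK ?ltnS ?leq_addl//.
rewrite addnK mulr_natl ?lerDl sumr_ge0// => i _.
by rewrite mulrn_wge0// mulr_ge0// exprn_ge0.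
Qed.

(** The ratio is [r ^ k] times a polynomial in [k]. The polynomial part is a binomial coefficient,
    bounded by [s ^ - k (1 - s) ^ - q] for any [s] strictly between [r] and 1, so [(r / s) ^ k]
    remains. *)
Lemma pw_ratio (l1 : {nonneg R}) r q e : 0 < r < 1 -> l1%:num = r * l%:num -> 0 < e ->
  exists n0, forall k, (n0 <= k)%N -> (pw l1 k)%:num <= e * (pw l (k + q))%:num.
Proof.
move=> /andP[r0 r1] l1E e0.
have [s [s0 s1 rs]] : exists s, [/\ 0 < s, s < 1 & r / s < 1].
  exists ((1 + r) / 2); split; [lra|lra|].
  by rewrite ltr_pdivrMr ?mul1r; lra.
pose D := expR (- l1%:num) / (expR (- l%:num) * l%:num ^+ q) * (q`!%:R / (1 - s) ^+ q).
have D0 : 0 < D.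
  by rewrite !mulr_gt0 ?invr_gt0 ?mulr_gt0 ?expR_gt0 ?exprn_gt0 ?subr_gt0 ?ltr0n ?fact_gt0.
have eD : 0 < e / D by rewrite divr_gt0.
have h : (r / s) ^+ k @[k --> \oo] --> 0.
  by apply: cvg_expr; rewrite ger0_norm// divr_ge0// ltW.
have [n0 _ hn] := (cvgr0Pnorm_lt _).1 h _ eD.
exists n0 => k /hn; rewrite ger0_norm; last by rewrite exprn_ge0// divr_ge0// ltW.
rewrite ltr_pdivlMr// => /ltW hk.
have hb := @bin_pow_le1 s k q; have {}hb := hb (_ : 0 <= s <= 1).
have {hb} hb : 'C(k + q, q)%:R * (s ^+ k * (1 - s) ^+ q) <= 1 by apply: hb; rewrite !ltW.
have s1' : 0 < 1 - s by rewrite subr_gt0.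
have fE : ((k + q)`!)%:R = 'C(k + q, q)%:R * (q`!%:R * k`!%:R) :> R.
  by rewrite -!natrM -(bin_fact (leq_addl k q)) addnK.
have v0 : 0 < (pw l (k + q))%:num. by exact: pw_gt0.
apply: le_trans (ler_wpM2r (ltW v0) hk).
have -> : (r / s) ^+ k * D * (pw l (k + q))%:num =
  (pw l1 k)%:num / ('C(k + q, q)%:R * (s ^+ k * (1 - s) ^+ q)).
  rewrite /D /= l1E fE expr_div_n exprMn exprD; field.
  rewrite !lt0r_neq0 ?exprn_gt0 ?expR_gt0 ?ltr0n ?fact_gt0 ?bin_gt0 ?leq_addl//.
rewrite ler_pdivlMr; last by rewrite !mulr_gt0 ?exprn_gt0 ?ltr0n ?bin_gt0 ?leq_addl.
by rewrite ler_piMr.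
Qed.

Lemma eventually_lt (P : nat -> R -> Prop) :
  (forall k, exists u0, forall u, u0 <= u -> P k u) ->
  forall n, exists u0, forall u, u0 <= u -> forall k, (k < n)%N -> P k u.
Proof.
move=> h; elim=> [|n [u1 h1]]; first by exists 0.
have [u2 h2] := h n; exists (Num.max u1 u2) => u.
rewrite ge_max => /andP[hu1 hu2] k; rewrite ltnS leq_eqVlt => /orP[/eqP ->|kn].
  exact: h2.
exact: h1.
Qed.

(* For a large number of jumps the Poisson weights of the smaller rate are negligible, even
   against a fixed number [q] of additional jumps that make up for the shift; for a bounded
   number of jumps, one more jump dominates by lightness. *)
Lemma tl_cp_rate_lt (l1 : {nonneg R}) r K e : 0 < r < 1 -> l1%:num = r * l%:num -> 0 < e ->
  exists u0, forall u, u0 <= u -> forall Y, tame Y ->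
  tl (conv Y (cp l1 m)) (u - K) <= e * tl (conv Y (cp l m)) (u + L).
Proof.
move=> r01 l1E e0; have e2 : 0 < e / 2 by rewrite divr_gt0.
(* [q] jumps above [b] bridge the gap from [u - K] to [u + L]. *)
pose q := (Num.truncn (`|K + L| / b)).+1.
have hq : K + L <= q%:R * b.
  have /andP[_ h] := truncn_itv (divr_ge0 (normr_ge0 (K + L)) (ltW b0)).
  by rewrite -ler_pdivrMr//; apply: le_trans (ltW h); rewrite ler_pM2r ?invr_gt0// ler_norm.
have [n0 hn0] := pw_ratio q r01 l1E e2.
have v0 k : 0 < (pw l k)%:num. by exact: pw_gt0.
have hk k := few_jumps_negligible (k + q) (mulr_gt0 e2 (v0 k)).
have [u0 hu0] := eventually_lt hk n0.
exists u0 => u uu Y hY; pose B := tl (conv Y (cp l m)) (u + L).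
have B0 : 0 <= B by exact: tl_ge0.
pose F k := (pw l k)%:num * tl (conv Y (convn m k)) (u + L).
have F0 k : 0 <= F k by apply: mulr_ge0 => //; exact: tl_ge0.
have FB n : \sum_(0 <= k < n) F k <= B.
  by have := series_le_lim F0 (@cvg_tl_cp _ Y l m (u + L)) n.
apply: (series_lim_le (@cvg_tl_cp _ Y l1 m (u - K))) => n.
(* The first summand serves [k < n0], the second [k >= n0]. The Poisson weight in the first makes
   the sum over [k] at most [e / 2 * B]; in the second, [F] sums to at most [B]. *)
apply: (@le_trans _ _ (\sum_(0 <= k < n) (e / 2 * ((pw l k)%:num * B) + e / 2 * F (k + q)))).
  apply: ler_sum => k _.
  have h1 : tl (conv Y (convn m k)) (u - K) <= tl (conv Y (convn m (k + q))) (u + L).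
    apply: (le_trans (conv_convn_shift Y k q (u - K))); apply: tl_le; lra.
  have [kn|kn] := ltnP k n0.
    apply: (@le_trans _ _ (tl (conv Y (convn m (k + q))) (u + L))).
      apply: le_trans h1; rewrite ler_piMl ?tl_ge0//.
      apply: le_trans (pw_sum_le1 l1 k.+1).
      by rewrite big_nat_recr//= lerDr sumr_ge0.
    apply: (@le_trans _ _ (e / 2 * ((pw l k)%:num * B))).
      by rewrite mulrA; apply: (hu0 u uu k kn Y hY).
    by rewrite lerDl mulr_ge0// ltW.
  apply: (@le_trans _ _ (e / 2 * F (k + q))).
    rewrite /F mulrA; apply: ler_pM => //; [exact: tl_ge0|exact: hn0].
  rewrite lerDr; apply: mulr_ge0; [exact: ltW|exact: mulr_ge0].
rewrite big_split/= -!mulr_sumr -mulr_suml [e in leRHS]splitr mulrDl; apply: lerD.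
  apply: ler_wpM2l; first exact: ltW.
  by rewrite ler_piMl//; exact: pw_sum_le1.
apply: ler_wpM2l; first exact: ltW.
apply: le_trans (FB (n + q)).
rewrite [leRHS](@big_cat_nat _ _ _ q)//= ?leq_addl//.
by rewrite -{3}(add0n q) big_addn addnK lerDr sumr_ge0.
Qed.

End jumps.

(** * Gaussian smoothing *)

Section smoothing.
Context (R : realType).
Implicit Types (a p q lam beta : probability R R).

Lemma measurable_inv_gt0 (f : R -> R) : measurable_fun setT f -> (forall x, 0 < f x) ->
  measurable_fun setT (fun x => (f x)^-1).
Proof.
move=> mf f0; rewrite (_ : (fun x => _) = (fun x => expR (- ln (f x)))).
  apply: (measurableT_comp (@measurable_expR R)); apply: measurable_funN.
  exact: (measurableT_comp (@measurable_ln R)).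
by apply/funext => x; rewrite expRN lnK// posrE.
Qed.

(* A shift of this size at level [v] changes a Gaussian tail by a factor [1 + O(e0)] only. *)
Definition slack (e0 v : R) := e0 / (1 + Num.max v 0).

Lemma max0_gt0 (v : R) : 0 < 1 + Num.max v 0.
Proof. by apply: ltr_wpDr => //; rewrite le_max lexx orbT. Qed.

Lemma measurable_slack e0 : measurable_fun setT (slack e0).
Proof.
apply: measurable_funM => //; apply: measurable_inv_gt0; last exact: max0_gt0.
by apply: measurable_funD => //; apply: measurable_maxr.
Qed.

(** [v] exceeds [w] by at most 1/2, so [1 + max v 0] is at most twice [1 + max w 0]: a tolerance
    attached to [w] becomes one attached to [v] after doubling [e0]. *)
Lemma slack_shift e0 v w : 0 <= e0 -> e0 <= 1 / 2 -> v < w + slack e0 w ->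
  v - slack (2 * e0) v < w.
Proof.
move=> e00 e01 h.
have w0 := max0_gt0 w; have v0 := max0_gt0 v.
have we : slack e0 w <= e0.
  by rewrite /slack ler_pdivrMr// ler_peMr// lerDl le_max lexx orbT.
rewrite ltrBlDr; apply: (lt_le_trans h); rewrite lerD2l.
have [v1|v1] := leP v 1.
  apply: (le_trans we); rewrite /slack ler_pdivlMr//.
  have : Num.max v 0 <= 1 by rewrite ge_max v1/=.
  nra.
have wv : (1 + v) / 2 <= 1 + w by lra.
rewrite /slack [Num.max v 0]max_l; last by lra.
rewrite [Num.max w 0]max_l; last by lra.
rewrite ler_pdivrMr; last by lra.
rewrite mulrAC ler_pdivlMr; last by lra.
nra.
Qed.

(** The tolerance depends on the Gaussian summand [w], so the tail ratio does not apply directly. By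
    [slack_shift] the event is contained in one whose tolerance depends on [v - z], with [z] the
    other summand; integrating over [w] first, [hC] applies for each [z]. *)
Lemma tl_conv_slack s C e0 p v : (forall v e, 0 <= e ->
    e * (1 + Num.max v 0) <= 1 ->
    tl (gauss s) (v - e) <= (1 + C * (e * (1 + Num.max v 0))) * tl (gauss s) v) ->
  0 <= e0 -> e0 <= 1 / 2 ->
  exists2 f : R -> R, bdm f /\ (forall w, tl p (v - w - slack e0 w) <= f w) &
    \int[gauss s]_w f w <= (1 + C * (2 * e0)) * tl (conv (gauss s) p) v.
Proof.
move=> hC e00 e01; pose k (y : R * R) : R := ((v - y.2 - slack (2 * e0) (v - y.2) < y.1)%R)%:R.
have bk : bdm k.
  apply: bdm_lt => //.
  have m1 : measurable_fun setT (fun y : R * R => v - y.2) by apply: measurable_funB.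
  apply: measurable_funB => //; exact: (measurableT_comp (measurable_slack (2 * e0))).
exists (fun w => \int[p]_z k (w, z)); first split.
- exact: (bdm_fubini1 (gauss s) p bk).
- move=> w; rewrite tlE; apply: le_E.
  + exact: bdm_lt.
  + exact: (@bdm_pair1 _ _ _ _ _ k w bk).
  move=> z; rewrite /k/=; have [h|_] := ltP (v - w - slack e0 w) z; last by rewrite ler0n.
  by rewrite slack_shift//; lra.
rewrite (E_swap _ _ bk) tl_conv -E_Z; last by exact: bdm_tl_sub.
apply: le_E; [exact: (bdm_fubini2 (gauss s) p bk)|by apply: bdmM; [exact: bdm_cst|exact: bdm_tl_sub]|].
move=> z; rewrite /k/= -tlE.
have e : slack (2 * e0) (v - z) * (1 + Num.max (v - z) 0) = 2 * e0.
  by rewrite /slack divfK// gt_eqF// max0_gt0.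
rewrite -[X in 1 + C * X]e; apply: hC; last by rewrite e; lra.
by rewrite /slack divr_ge0 ?(ltW (max0_gt0 _))//; lra.
Qed.

(** What the comparison may lose at Gaussian values above [j0]: a factor exponential in [w], set
    against a level raised by 1. *)
Definition far j0 D kap p v (w : R) : R :=
  ((j0 < w)%R)%:R * (D * expR (kap * w) * tl p (v - w + 1)).

Lemma measurable_far j0 D kap p v : measurable_fun setT (far j0 D kap p v).
Proof.
have mu : measurable_fun setT (fun w : R => v - w + 1).
  by apply: measurable_funD => //; exact: measurable_funB.
apply: measurable_funM; first by have [] : bdm (fun w : R => ((j0 < w)%R)%:R : R) by exact: bdm_lt.
apply: measurable_funM; last by have [] := bdm_tl p mu.
apply: measurable_funM => //; apply: (measurableT_comp (@measurable_expR R)).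
exact: measurable_funM.
Qed.

Lemma far_ge0 j0 D kap p v w : 0 <= D -> 0 <= far j0 D kap p v w.
Proof.
by move=> D0; rewrite mulr_ge0 ?ler0n// mulr_ge0 ?tl_ge0// mulr_ge0 ?expR_ge0.
Qed.

(** [far] is unbounded in [w]. Tails are at most 1, so it can be capped and stays among bounded
    functions. *)
Lemma bdm_min1 (f : R -> R) : measurable_fun setT f -> (forall x, 0 <= f x) ->
  bdm (fun x => Num.min 1 (f x)).
Proof.
move=> mf f0; split; first exact: measurable_minr.
by exists 1 => x; rewrite ger0_norm ?ge_min ?lexx// le_min ler01 f0.
Qed.

(* Shifting the Gaussian by 1 gains a factor [exp (- w / s ^ 2)], which beats [exp (kap * w)]. *)
Lemma E_far s j0 D kap p v : 0 < s -> 0 <= D -> 1 <= j0 -> kap <= (2 * s ^+ 2)^-1 ->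
  \int[gauss s]_w Num.min 1 (far j0 D kap p v w) <=
  D * expR (- ((j0 - 1) / (2 * s ^+ 2))) * tl (conv (gauss s) p) v.
Proof.
move=> s0 D0 j01 hk; set T := D * _.
have mf := measurable_far j0 D kap p v.
have f0 w := far_ge0 j0 kap p v w D0.
have T0 : 0 <= T by rewrite mulr_ge0// expR_ge0.
have bm := bdm_min1 mf f0.
have bt : bdm (fun w : R => tl p (v - w)) by exact: bdm_tl_sub.
have bT : bdm (fun w : R => T * tl p (v - w)) by apply: bdmM => //; exact: bdm_cst.
rewrite tl_convl -E_Z// -lee_fin -!E_EFin//.
apply: (@le_trans _ _ (\int[gauss s]_w (far j0 D kap p v w)%:E)%E).
  apply: ge0_le_integral => //.
  - by move=> w _; rewrite lee_fin le_min ler01 f0.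
  - by apply/measurable_EFinP; have [] := bm.
  - exact/measurable_EFinP.
  - by move=> w _; rewrite lee_fin ge_min lexx orbT.
rewrite (@cameron_martin _ s 1 (EFin \o far j0 D kap p v) (lt0r_neq0 s0)); last 2 first.
- exact/measurable_EFinP.
- by move=> w; rewrite lee_fin.
apply: ge0_le_integral => //.
- by move=> w _; rewrite -EFinM lee_fin mulr_ge0// expR_ge0.
- apply: emeasurable_funM; last by apply/measurable_EFinP; exact: measurable_expRlin.
  by apply/measurable_EFinP; apply: (measurableT_comp mf); exact: measurable_funD.
- by apply/measurable_EFinP; have [] := bT.
move=> w _; rewrite -EFinM lee_fin /far.
have [jw|_] := ltP j0 (w + 1); last by rewrite !mul0r mulr_ge0// tl_ge0.
rewrite mul1r (_ : v - (w + 1) + 1 = v - w); last by ring.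
rewrite mulrAC ler_wpM2r ?tl_ge0// -[leLHS]mulrA -expRD /T ler_wpM2l// ler_expR.
(* Half of the gain [w / s ^ 2] pays for [kap]; the other half is at least [(j0 - 1) / (2 s ^ 2)]
   because [w > j0 - 1]. *)
have k1 : kap * (w + 1) <= (2 * s ^+ 2)^-1 * (w + 1) by rewrite ler_wpM2r//; lra.
have k2 : (2 * s ^+ 2)^-1 * (j0 - 1) <= (2 * s ^+ 2)^-1 * w.
  by rewrite ler_wpM2l ?invr_ge0 ?mulr_ge0 ?sqr_ge0//; lra.
have e1 : - 1 / s ^+ 2 * w = - 2 * ((2 * s ^+ 2)^-1 * w) by field; rewrite lt0r_neq0.
have e2 : (1 : R) ^+ 2 / (2 * s ^+ 2) = (2 * s ^+ 2)^-1 by rewrite expr1n mul1r.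
rewrite e1 e2; lra.
Qed.

(* The bound assumed on the tail of [lam] may depend on [w], the value of the Gaussian summand. *)
Lemma gauss_smoothing s A C K D kap e0 j0 lam p p' : 0 < s -> 0 <= A -> 0 <= C -> 0 <= D ->
  1 <= j0 -> kap <= (2 * s ^+ 2)^-1 -> 0 <= e0 -> e0 <= 1 / 2 ->
  forall G, (forall v e, 0 <= e -> e * (1 + Num.max v 0) <= 1 ->
    tl (gauss s) (v - e) <= (1 + G * (e * (1 + Num.max v 0))) * tl (gauss s) v) ->
  (forall x w, tl lam x <= A * tl p (x - slack e0 w) + C * tl p' (x - K) +
    ((j0 < w)%R)%:R * (D * expR (kap * w) * tl p (x + 1))) ->
  forall beta u, tl (conv (conv (gauss s) beta) lam) u <=
    (A * (1 + G * (2 * e0)) + D * expR (- ((j0 - 1) / (2 * s ^+ 2)))) *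
      tl (conv (conv (gauss s) beta) p) u + C * tl (conv (conv (gauss s) beta) p') (u - K).
Proof.
move=> s0 A0 C0 D0 j01 hk e00 e01 G hG h beta u.
set Z := A * _ + _.
(* The case without [beta]; integrating it over [beta] gives the claim. *)
have h0 v : tl (conv (gauss s) lam) v <= Z * tl (conv (gauss s) p) v +
    C * tl (conv (gauss s) p') (v - K).
  have [f [bf hf] Ef] := tl_conv_slack p v hG e00 e01.
  have bfar := bdm_min1 (measurable_far j0 D kap p v) (fun w => far_ge0 j0 kap p v w D0).
  have b' : bdm (fun w : R => tl p' (v - K - w)) by exact: bdm_tl_sub.
  have bl : bdm (fun w : R => tl lam (v - w)) by exact: bdm_tl_sub.
  have bA : bdm (fun w : R => A * f w) by apply: bdmM => //; exact: bdm_cst.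
  have bC : bdm (fun w : R => C * tl p' (v - K - w)) by apply: bdmM => //; exact: bdm_cst.
  have bAC := bdmD bA bC.
  apply: (@le_trans _ _ (\int[gauss s]_w (A * f w + C * tl p' (v - K - w) +
      Num.min 1 (far j0 D kap p v w)))).
    rewrite tl_convl; apply: le_E => // [|w]; first exact: bdmD.
    have Af : A * tl p (v - w - slack e0 w) <= A * f w by exact: ler_wpM2l.
    have C' : 0 <= C * tl p' (v - K - w) by rewrite mulr_ge0// tl_ge0.
    have A' : 0 <= A * tl p (v - w - slack e0 w) by rewrite mulr_ge0// tl_ge0.
    have {h} := h (v - w) w; rewrite -/(far j0 D kap p v w).
    rewrite (_ : v - w - K = v - K - w); last by ring.
    have := tl_le1 lam (v - w).
    by rewrite minEle; case: ifP => _; lra.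
  rewrite E_D// E_D// E_Z// E_Z// -tl_convl.
  have k1 := E_far p v s0 D0 j01 hk.
  have k2 := ler_wpM2l A0 Ef.
  rewrite /Z mulrDl -addrA (addrC (C * _)) addrA lerD2r.
  by apply: lerD => //; rewrite -mulrA.
have bp : bdm (fun y : R => tl (conv (gauss s) p) (u - y)) by exact: bdm_tl_sub.
have bp' : bdm (fun y : R => tl (conv (gauss s) p') (u - K - y)) by exact: bdm_tl_sub.
have bl : bdm (fun y : R => tl (conv (gauss s) lam) (u - y)) by exact: bdm_tl_sub.
rewrite (tl_convAC _ beta lam) (tl_convAC _ beta p) (tl_convAC _ beta p').
rewrite (tl_conv _ beta u) (tl_conv _ beta u) (tl_conv _ beta (u - K)).
rewrite -(E_Z _ Z bp) -(E_Z _ C bp').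
have b1 : bdm (fun y : R => Z * tl (conv (gauss s) p) (u - y)) by apply: bdmM => //; exact: bdm_cst.
have b2 : bdm (fun y : R => C * tl (conv (gauss s) p') (u - K - y)) by apply: bdmM => //; exact: bdm_cst.
rewrite -(E_D _ b1 b2); apply: le_E; [exact: bl|exact: bdmD|move=> y].
by rewrite (_ : u - K - y = u - y - K); [exact: h0|ring].
Qed.

End smoothing.

Section exp_bounds.
Context (R : realType).

Lemma expRN_le_inv (x : R) : 0 < x -> expR (- x) <= x^-1.
Proof.
move=> x0; rewrite expRN lef_pV2 ?posrE ?expR_gt0//.
by have := expR_ge1Dx x; lra.
Qed.

Lemma expRN_sqr_small (c tau : R) : 0 < c -> 0 < tau -> exists j0, forall y, j0 <= y ->
  expR (- (c * y)) * (1 + y) ^+ 2 <= tau.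
Proof.
move=> c0 tau0; pose M := 16 / c ^+ 2 * expR (c / 2) * (2 / c).
have M0 : 0 < M by rewrite !mulr_gt0 ?expR_gt0 ?invr_gt0 ?exprn_gt0.
exists (Num.max 1 (M / tau)) => y; rewrite ge_max => /andP[y1 yM].
have y0 : 0 < y by lra.
have h1 : (c * (1 + y)) ^+ 2 <= 16 * expR (c * (1 + y) / 2).
  by apply: sqr_le_expR_half; rewrite mulr_ge0//; lra.
have h2 : expR (- (c * y / 2)) <= (c * y / 2)^-1 by apply: expRN_le_inv; rewrite divr_gt0// mulr_gt0.
apply: (@le_trans _ _ (M / y)); last first.
  by rewrite ler_pdivrMr// mulrC -ler_pdivrMr.
have h3 : (1 + y) ^+ 2 <= 16 / c ^+ 2 * expR (c * (1 + y) / 2).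
  rewrite mulrAC ler_pdivlMr ?exprn_gt0//; move: h1; rewrite exprMn; lra.
apply: (le_trans (ler_wpM2l (expR_ge0 _) h3)).
have -> : expR (- (c * y)) * (16 / c ^+ 2 * expR (c * (1 + y) / 2)) =
    16 / c ^+ 2 * expR (c / 2) * expR (- (c * y / 2)).
  by rewrite mulrCA -expRD -[RHS]mulrA -expRD; congr (_ * expR _); field.
have -> : M / y = 16 / c ^+ 2 * expR (c / 2) * (c * y / 2)^-1.
  by rewrite /M; field; rewrite !gt_eqF.
apply: ler_wpM2l => //; by rewrite mulr_ge0 ?expR_ge0 ?divr_ge0 ?sqr_ge0.
Qed.

End exp_bounds.

Section cvg_tails.
Context (R : realType).

Lemma cvg_tl_convl (an : nat -> probability R R) a lam u :
  (forall y, tl (an n) y @[n --> \oo] --> tl a y) ->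
  tl (conv (an n) lam) u @[n --> \oo] --> tl (conv a lam) u.
Proof.
move=> h; under eq_cvg do rewrite tl_conv.
rewrite tl_conv; apply: (@E_cvg _ _ _ lam (fun n y => tl (an n) (u - y)) _ 1) => [n|n x|x].
- by have [] := bdm_tl (an n) (measurable_funB (measurable_cst u) (@measurable_id _ _ setT)).
- by rewrite ger0_norm ?tl_ge0//; exact: tl_le1.
- exact: h.
Qed.

End cvg_tails.

Section limits.
Context (R : realType).
Lemma cvg_ge_cst (u : nat -> R) (l v : R) : u n @[n --> \oo] --> l ->
  (forall n, v <= u n) -> v <= l.
Proof.
move=> ul vu; have <- : limn u = l by apply/cvg_lim.
by apply: limr_ge; [apply/cvg_ex; exists l|exact: nearW].
Qed.

End limits.

Definition rt (R : realType) (rho : {measure set R -> \bar R}) (t : {nonneg R}) (A : set R) :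
  {nonneg R} := (t%:num * (rl rho A)%:num)%:nng.

Section rn_more.
Context (R : realType) (rho : {measure set R -> \bar R}) (A : set R).
Hypotheses (mA : measurable A) (rA : (rho A < +oo)%E).

Lemma rn_zero (B : set R) : (rl rho A)%:num = 0 -> rn rho mA B = point 0 B.
Proof.
move=> l0; have rAE : (mrestr rho mA : {measure set R -> \bar R}) setT = rho A by exact: (congr1 rho (setTI A)).
have r0 : rho A = 0%E.
  have fA : rho A \is a fin_num by rewrite ge0_fin_numE.
  by rewrite -(fineK fA) -[fine _]/((rl rho A)%:num) l0.
by rewrite /rn /= /mnormalize /= rAE r0 eqxx.
Qed.

Lemma rl_ge0E : (rl rho A)%:num = 0 \/ 0 < (rl rho A)%:num.
Proof.
have [->|h] := eqVneq (rl rho A)%:num 0; first by left.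
by right; rewrite lt_neqAle eq_sym h /=.
Qed.

Lemma tl_rn1 (c : R) : 0 < (rl rho A)%:num -> (forall x, A x -> c < x) -> tl (rn rho mA) c = 1.
Proof.
move=> l0 hA; have h := rn_supp mA rA l0; rewrite tl_def.
have mc : measurable [set y : R | c < y] by exact: measurable_gt.
suff -> : rn rho mA [set y | c < y] = 1%E by [].
have e := probability_setC (rn rho mA) (measurableC mc).
rewrite setCK in e; rewrite e.
suff -> : rn rho mA (~` [set y | c < y]) = 0%E by rewrite sube0.
apply/eqP; rewrite eq_le measure_ge0 andbT -h; apply: le_measure.
- by rewrite inE; exact: measurableC.
- by rewrite inE; exact: measurableC.
- by apply: subsetC => x; exact: hA.
Qed.

Lemma tl_rn0 (c : R) : 0 <= c -> (forall x, A x -> x <= c) -> tl (rn rho mA) c = 0.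
Proof.
move=> c0 hA; rewrite tl_def; have [l0|l0] := rl_ge0E.
  suff -> : rn rho mA [set y | c < y] = 0%E by [].
  rewrite (rn_zero _ l0) /point/= diracE memNset//=.
  by move=> /(le_lt_trans c0); rewrite ltxx.
suff -> : rn rho mA [set y | c < y] = 0%E by [].
apply/eqP; rewrite eq_le measure_ge0 andbT -(rn_supp mA rA l0); apply: le_measure.
- by rewrite inE; exact: measurable_gt.
- by rewrite inE; exact: measurableC.
- by move=> x /= cx Ax; have := le_lt_trans (hA _ Ax) cx; rewrite ltxx.
Qed.

Lemma mgfle_cp_rn (t : {nonneg R}) (th B : R) : (forall x, A x -> `|x| <= B) ->
  mgfle (cp (rt rho t A) (rn rho mA)) th
    (expR (t%:num * \int[rho]_(x in A) (expR (th * x) - 1))).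
Proof.
move=> hB.
have ib (f : R -> R) M : measurable_fun setT f -> (forall x, A x -> `|f x| <= M) ->
    rho.-integrable A (EFin \o f).
  move=> mf f1; apply: measurable_bounded_integrable => //; first exact: measurable_funTS.
  by exists M; split; [rewrite num_real|move=> x Mx y Ay /=; rewrite (le_trans (f1 y Ay))// ltW].
have me : measurable_fun setT (fun x : R => expR (th * x)).
  by have := measurable_expRlin th 0; under eq_fun do rewrite addr0.
have ie : rho.-integrable A (EFin \o (fun x : R => expR (th * x))).
  apply: (ib _ (expR (`|th| * B))) => // x Ax.
  rewrite ger0_norm ?expR_ge0// ler_expR (le_trans (ler_norm _))// normrM ler_wpM2l//.
  exact: hB.
have -> : \int[rho]_(x in A) (expR (th * x) - 1) =
    (rl rho A)%:num * (\int[rn rho mA]_x expR (th * x) - 1).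
  rewrite mulrBr (E_rn mA rA me ie) mulr1 RintegralB//; last first.
    by apply: measurable_bounded_integrable => //; exact: bounded_cst.
  by rewrite Rintegral_cst// mul1r.
rewrite mulrA; apply: mgfle_cp.
  by apply: E_ge0 => x; exact: expR_ge0.
have [l0|l0] := rl_ge0E.
  have eqm (f : R -> \bar R) : (\int[rn rho mA]_x f x = \int[point (0 : R)]_x f x)%E.
    by apply: eq_measure_integral => C mC _; exact: rn_zero.
  have e : (\int[point (0 : R)]_x (expR (th * x))%:E = (expR (th * 0))%:E)%E.
    by rewrite integral_dirac// ?diracT ?mul1e//; exact: measurable_expt.
  by rewrite /mgfle /Rintegral !eqm e.
rewrite /mgfle /Rintegral fineK//.
by apply: integrable_fin_num => //; exact: (integrable_rn mA rA me ie l0).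
Qed.

End rn_more.

(** * The convolution semigroup of the process *)

Section levy.
Context (R : realType) (rho : {measure set R -> \bar R}).
Hypothesis hrho : levy_measure rho.
Variables (gamma sigma b : R).
Hypotheses (s0 : 0 < sigma) (b0 : 0 < b) (b1 : b <= 1).

(** Jump sizes are split at [b]: [SP] and [SN] beyond it on either side, [SB] the small jumps. The
    sets [Sm n] exhaust [SB] up to 0 and stay away from 0, so they have finite mass and give
    compound Poisson laws. *)
Definition SP := [set x : R | b < x].
Definition SN := [set x : R | x < - b].
Definition SB := [set x : R | `|x| <= b].
Definition Sm (n : nat) := SB `&` [set x : R | b / n.+1%:R < `|x|].

Lemma mSP : measurable SP. Proof. exact: measurable_gt. Qed.

Lemma mSN : measurable SN.
Proof.
rewrite (_ : SN = `]-oo, (- b)[%classic); first exact: measurable_itv.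
by apply/seteqP; split => x; rewrite /SN /= in_itv.
Qed.

Lemma measurable_norm_le (c : R) : measurable [set x : R | `|x| <= c].
Proof.
rewrite (_ : [set _ | _] = `[- c, c]%classic); first exact: measurable_itv.
by apply/seteqP; split => x; rewrite /= in_itv/= ler_norml.
Qed.

Lemma measurable_norm_gt (c : R) : measurable [set x : R | c < `|x|].
Proof.
rewrite (_ : [set _ | _] = ~` [set x : R | `|x| <= c]).
  by apply: measurableC; exact: measurable_norm_le.
by apply/seteqP; split => x /=; [move=> h; apply/negP; rewrite -ltNge|move/negP; rewrite -ltNge].
Qed.

Lemma mSB : measurable SB. Proof. exact: measurable_norm_le. Qed.

Lemma mSm n : measurable (Sm n).
Proof. by apply: measurableI; [exact: mSB|exact: measurable_norm_gt]. Qed.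

Lemma fSP : (rho SP < +oo)%E.
Proof.
by apply: (levy_finite hrho b0 mSP) => x /= bx; rewrite (le_trans (ltW bx))// ler_norm.
Qed.

Lemma fSN : (rho SN < +oo)%E.
Proof.
apply: (levy_finite hrho b0 mSN) => x /= bx.
by rewrite -normrN (le_trans _ (ler_norm _))// lerNr ltW.
Qed.

Lemma fSm n : (rho (Sm n) < +oo)%E.
Proof.
have c0 : 0 < b / n.+1%:R by rewrite divr_gt0.
by apply: (levy_finite hrho c0 (mSm n)) => x [_ /= /ltW].
Qed.

Lemma polar_cp_rn (t : {nonneg R}) (A : set R) (mA : measurable A) (s : R) : (rho A < +oo)%E ->
  polar (cp (rt rho t A) (rn rho mA)) s
    (expR (t%:num * \int[rho]_(x in A) cpart s x)) (t%:num * \int[rho]_(x in A) sin (s * x)).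
Proof.
move=> rA; have [r [th [r0 hp]]] := polar_exists (rn rho mA) s.
have ib (f : R -> R) : measurable_fun setT f -> (forall x, `|f x| <= 1) ->
    rho.-integrable A (EFin \o f).
  move=> mf f1; apply: measurable_bounded_integrable => //; first exact: measurable_funTS.
  by exists 1; split; [rewrite num_real|move=> x x1 y _ /=; rewrite (le_trans (f1 y))// ltW].
have ic := ib _ (measurable_cosc s) (fun x => cos_max _).
have is_ := ib _ (measurable_sinc s) (fun x => sin_max _).
have hc : (rl rho A)%:num * (r * cos th) = \int[rho]_(x in A) cos (s * x).
  rewrite -(E_rn mA rA (measurable_cosc s) ic); congr (_ * _).
  by have := hp 0; rewrite addr0 => <-; apply: eq_Rintegral => x _; rewrite addr0.
have hs : (rl rho A)%:num * (r * sin th) = \int[rho]_(x in A) sin (s * x).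
  rewrite -(E_rn mA rA (measurable_sinc s) is_); congr (_ * _).
  by have := hp (- (pi / 2)); rewrite cosBpihalf => <-; apply: eq_Rintegral => x _; rewrite cosBpihalf.
have := polar_cp (rt rho t A) r0 hp; congr (polar _ _ (expR _) _).
  rewrite /= -mulrA mulrBr hc mulr1; congr (_ * _).
  rewrite /cpart RintegralB//; last by apply: measurable_bounded_integrable => //; exact: bounded_cst.
  by rewrite Rintegral_cst// mul1r.
by rewrite /= -mulrA hs.
Qed.

(** Written with [1 * x] to be an instance of [measurable_trunc]. *)
Definition trunc1 (x : R) : R := if `|x| <= 1 then 1 * x else 0.

(** Jumps in [SN] and [SP] enter uncompensated, so the part of the compensator that [psi_im] assigns
    to them moves into the drift; [gamn] compensates the jumps in [Sm n]. *)
Definition gam' := gamma - \int[rho]_(x in SN) trunc1 x - \int[rho]_(x in SP) trunc1 x.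
Definition gamn n := gam' - \int[rho]_(x in Sm n) x.

(* The law at time [t] is the limit of [conv (Yn n t) (Cn t)]: [Un] consists of the Gaussian
   part, the drift and the jumps of size in (b / (n + 1), b], compensated, [Dn]
   of the jumps below [- b] and [Cn] of those above [b]. *)
Definition Un n (t : {nonneg R}) := conv (gauss (sigma * Num.sqrt t%:num))
  (conv (point (t%:num * gamn n)) (cp (rt rho t (Sm n)) (rn rho (mSm n)))).
Definition Dn (t : {nonneg R}) := cp (rt rho t SN) (rn rho mSN).
Definition Cn (t : {nonneg R}) := cp (rt rho t SP) (rn rho mSP).
Definition Yn n t := conv (Un n t) (Dn t).

Definition Ar n s := - (sigma ^+ 2 * s ^+ 2) / 2 + \int[rho]_(x in Sm n) cpart s x
  + \int[rho]_(x in SN) cpart s x.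
Definition Ai n s := s * gamn n + \int[rho]_(x in Sm n) sin (s * x)
  + \int[rho]_(x in SN) sin (s * x).

Lemma polar_Yn n t s : polar (Yn n t) s (expR (t%:num * Ar n s)) (t%:num * Ai n s).
Proof.
have := polar_conv (polar_conv (polar_gauss (sigma * Num.sqrt t%:num) s)
  (polar_conv (polar_point (t%:num * gamn n) s) (polar_cp_rn t (mSm n) s (fSm n))))
  (polar_cp_rn t mSN s fSN).
rewrite mul1r -!expRD; congr (polar _ _ (expR _) _).
  by rewrite /Ar !exprMn sqr_sqrtr//; ring.
by rewrite /Ai; ring.
Qed.

Lemma polar_Cn t s : polar (Cn t) s (expR (t%:num * \int[rho]_(x in SP) cpart s x))
  (t%:num * \int[rho]_(x in SP) sin (s * x)).
Proof. exact: (polar_cp_rn t mSP s fSP). Qed.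

(** Dominated convergence. The value [h 0 = 0] is needed because 0 lies in [SB] but in no [Sm n]. *)
Lemma cvg_Rint_Sm (h : R -> R) : rho.-integrable setT (EFin \o h) -> h 0 = 0 ->
  \int[rho]_(x in Sm n) h x @[n --> \oo] --> \int[rho]_(x in SB) h x.
Proof.
move=> ih h0; rewrite Rintegral_mkcond.
under eq_cvg do rewrite Rintegral_mkcond.
have mh : measurable_fun setT h by have /integrableP[/measurable_EFinP] := ih.
have ir (A : set R) : measurable A -> rho.-integrable setT (EFin \o (h \_ A)).
  move=> mA; have := integrableS measurableT mA (@subsetT _ _) ih.
  move=> /(integrable_mkcond _ mA).
  by rewrite restrict_EFin.
have : (\int[rho]_x ((h \_ (Sm n)) x)%:E @[n --> \oo] --> \int[rho]_x ((h \_ SB) x)%:E)%E.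
  apply: (@dominated_cvg _ _ _ rho setT measurableT (fun n => EFin \o (h \_ (Sm n)))
    (EFin \o (h \_ SB)) (fun x => `|(h x)%:E|%E)).
  - by move=> n; have /integrableP[] := ir _ (mSm n).
  - move=> x _; apply: cvg_near_cst; rewrite /= /patch.
    have [x0|x0] := eqVneq x 0.
      by apply: nearW => n; rewrite x0 h0; do 2 case: ifP.
    have bx : 0 < `|x| by rewrite normr_gt0.
    near=> n; congr (_%:E).
    suff -> : (x \in Sm n) = (x \in SB) by [].
    apply/idP/idP; rewrite !inE; first by move=> [].
    move=> xb; split => //=; rewrite ltr_pdivrMr// -ltr_pdivrMl//.
    by rewrite -natr1 (@lt_trans _ _ n%:R)// ?ltrDl//; near: n; exact: nbhs_infty_gtr.
  - by [].
  - by have := integrable_abse ih.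
  - move=> n x _; rewrite /= lee_fin /patch; case: ifP => // _.
    by rewrite normr0.
move=> hc; apply: fine_cvg; rewrite fineK//.
by apply: integrable_fin_num => //; apply: ir; exact: mSB.
Unshelve. all: end_near. Qed.

Lemma trunc1_int (A : set R) (c : R) : 0 < c -> measurable A -> (forall x, A x -> c <= `|x|) ->
  rho.-integrable A (EFin \o trunc1).
Proof.
move=> c0 mA hA; apply: measurable_bounded_integrable => //.
- exact: (levy_finite hrho c0 mA hA).
- by apply: measurable_funTS; exact: measurable_trunc.
exists 1; split; [by rewrite num_real|move=> x x1 y _ /=; apply: le_trans (ltW x1)].
by rewrite /trunc1 mul1r; case: ifP => // _; rewrite normr0.
Qed.

Lemma hSP x : SP x -> b <= `|x|.
Proof. by rewrite /SP /= => bx; rewrite (le_trans (ltW bx))// ler_norm. Qed.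

Lemma hSN x : SN x -> b <= `|x|.
Proof. by rewrite /SN /= => bx; rewrite -normrN (le_trans _ (ler_norm _))// lerNr ltW. Qed.

Lemma sin_spart (A : set R) (s : R) : measurable A -> (forall x, A x -> b <= `|x|) ->
  \int[rho]_(x in A) sin (s * x) =
  \int[rho]_(x in A) spart s x + s * \int[rho]_(x in A) trunc1 x.
Proof.
move=> mA hA; have it := trunc1_int b0 mA hA.
have is_ : rho.-integrable A (EFin \o spart s).
  by apply: integrableS (spart_int hrho s).
rewrite -RintegralZl// -RintegralD//.
  apply: eq_Rintegral => x _; rewrite /spart /trunc1.
  by case: ifP => _; rewrite ?mul1r ?mulr0 subrK.
by have := integrableZl mA s it.
Qed.

(** As [b <= 1], the truncation in [spart] is inactive on [Sm n], so the compensator in [gamn] and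
    the sine combine to [spart], which is integrable uniformly in [n]. *)
Lemma Ai_E n s : Ai n s = s * gam' + \int[rho]_(x in Sm n) spart s x
  + \int[rho]_(x in SN) sin (s * x).
Proof.
rewrite /Ai; congr (_ + _); rewrite /gamn mulrBr -addrA; congr (_ + _).
have c0 : 0 < b / n.+1%:R by rewrite divr_gt0.
have hc x : Sm n x -> b / n.+1%:R <= `|x| by move=> [_ /= /ltW].
have ix : rho.-integrable (Sm n) (EFin \o (fun x : R => x)).
  apply: measurable_bounded_integrable => //; [exact: mSm|exact: fSm|].
  exists b; split; [by rewrite num_real|move=> x bx y [yb _] /=].
  by rewrite (le_trans yb)// ltW.
have is_ : rho.-integrable (Sm n) (EFin \o spart s).
  by apply: integrableS (spart_int hrho s) => //; exact: mSm.
rewrite -RintegralZl//; last exact: mSm.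
have isx : rho.-integrable (Sm n) (EFin \o (fun x => s * x)).
  by have := integrableZl (mSm n) s ix.
apply/eqP; rewrite addrC subr_eq -RintegralD//; last exact: mSm.
apply/eqP; apply: eq_Rintegral => x; rewrite inE => -[/= xb _].
by rewrite /spart (le_trans xb b1) subrK.
Qed.

Lemma Rint_split (h : R -> R) : rho.-integrable setT (EFin \o h) ->
  \int[rho]_x h x = \int[rho]_(x in SB) h x + \int[rho]_(x in SN) h x + \int[rho]_(x in SP) h x.
Proof.
move=> ih; have mU := measurableU _ _ mSB mSN.
have ->: [set: R] = (SB `|` SN) `|` SP.
  apply/seteqP; split => // x _; rewrite /SB /SN /SP /= ler_norml.
  by have [] := ltP x (- b); have [] := ltP b x; auto.
have dis (A B : set R) : (forall x, A x -> B x -> False) -> [disjoint A & B].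
  by move=> AB; rewrite disj_set2E; apply/eqP/seteqP; split => // x [] /AB.
have d1 : [disjoint SB `|` SN & SP].
  apply: dis => x; rewrite /SB /SN /SP /= ler_norml => -[/andP[_ xb] bx|xb bx].
    by have := le_lt_trans xb bx; rewrite ltxx.
  by have := b0; lra.
have d2 : [disjoint SB & SN].
  apply: dis => x; rewrite /SB /SN /= ler_norml => /andP[bx _] xb.
  by have := le_lt_trans bx xb; rewrite ltxx.
have i1 : rho.-integrable ((SB `|` SN) `|` SP) (EFin \o h).
  by apply: integrableS ih => //; apply: measurableU => //; exact: mSP.
have i2 : rho.-integrable (SB `|` SN) (EFin \o h) by apply: integrableS ih.
by rewrite (Rintegral_setU mU mSP i1 d1) (Rintegral_setU mSB mSN i2 d2).
Qed.

Definition Er s := - (sigma ^+ 2 * s ^+ 2) / 2 + \int[rho]_(x in SB) cpart s x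
  + \int[rho]_(x in SN) cpart s x.
Definition Ei s := s * gam' + \int[rho]_(x in SB) spart s x
  + \int[rho]_(x in SN) sin (s * x).

Lemma cvg_Ar s : Ar n s @[n --> \oo] --> Er s.
Proof.
apply: cvgD; last exact: cvg_cst; apply: cvgD; first exact: cvg_cst.
by apply: cvg_Rint_Sm; [exact: cpart_int|rewrite /cpart mulr0 cos0 subrr].
Qed.

Lemma cvg_Ai s : Ai n s @[n --> \oo] --> Ei s.
Proof.
under eq_cvg do rewrite Ai_E.
apply: cvgD; last exact: cvg_cst; apply: cvgD; first exact: cvg_cst.
apply: cvg_Rint_Sm; first exact: spart_int.
by rewrite /spart mulr0 sin0 normr0 ler01 ?mulr0 subrr.
Qed.

Lemma psi_reE s : psi_re sigma rho s = Er s + \int[rho]_(x in SP) cpart s x.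
Proof. by rewrite /psi_re (Rint_split (cpart_int hrho s)) /Er !addrA. Qed.

Lemma psi_imE s : psi_im gamma rho s = Ei s + \int[rho]_(x in SP) sin (s * x).
Proof.
rewrite /psi_im (Rint_split (spart_int hrho s)) /Ei.
rewrite (sin_spart s mSP hSP) (sin_spart s mSN hSN) /gam'; ring.
Qed.

(** The tail estimates concern only the laws at fixed times; for the process these are [Xlaw]. *)
Definition levy_polar (pi : {nonneg R} -> probability R R) := forall (t : {nonneg R}) s,
  polar (pi t) s (expR (t%:num * psi_re sigma rho s)) (t%:num * psi_im gamma rho s).

Variable pi : {nonneg R} -> probability R R.
Hypothesis hpi : levy_polar pi.

Lemma chf_cvg_Yn_Cn t : chf_cvg (fun n => conv (Yn n t) (Cn t)) (pi t).
Proof.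
apply: chf_cvg_polar => s; do 4 eexists; split.
- by move=> n; apply: polar_conv; [exact: polar_Yn|exact: polar_Cn].
- exact: hpi.
- rewrite psi_reE mulrDr expRD; apply: cvgM; last exact: cvg_cst.
  apply: continuous_cvg; first exact: continuous_expR.
  by apply: cvgMl_tmp; exact: cvg_Ar.
- rewrite psi_imE mulrDr; apply: cvgD; last exact: cvg_cst.
  by apply: cvgMl_tmp; exact: cvg_Ai.
Qed.

(** The tame part is split in time while the large jumps keep their full rate. In [levy_time_lt] the
    same factor [Yn n t1] then stands on both sides, next to large jumps of different rates. *)
Lemma chf_cvg_Yn2_Cn t1 t2 t : t%:num = t1%:num + t2%:num ->
  chf_cvg (fun n => conv (Yn n t1) (conv (Yn n t2) (Cn t))) (pi t).
Proof.
move=> tE; apply: chf_cvg_polar => s; do 4 eexists; split.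
- move=> n; apply: polar_conv; first exact: polar_Yn.
  by apply: polar_conv; [exact: polar_Yn|exact: polar_Cn].
- exact: hpi.
- rewrite psi_reE [X in _ --> X](_ : _ = expR (t1%:num * Er s) * (expR (t2%:num * Er s) *
    expR (t%:num * \int[rho]_(x in SP) cpart s x))); last first.
    by rewrite -!expRD tE; congr expR; ring.
  have h u : expR (u * Ar n s) @[n --> \oo] --> expR (u * Er s).
    apply: continuous_cvg; first exact: continuous_expR.
    by apply: cvgMl_tmp; exact: cvg_Ar.
  by apply: cvgM => //; apply: cvgM => //; exact: cvg_cst.
- rewrite psi_imE [X in _ --> X](_ : _ = t1%:num * Ei s + (t2%:num * Ei s +
    t%:num * \int[rho]_(x in SP) sin (s * x))); last by rewrite tE; ring.
  have h u : u * Ai n s @[n --> \oo] --> u * Ei s by apply: cvgMl_tmp; exact: cvg_Ai.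
  by apply: cvgD => //; apply: cvgD => //; exact: cvg_cst.
Qed.

(** [Yn n t] without its Gaussian factor, which the Lipschitz and smoothing arguments need in
    front. *)
Definition Rn n t := conv (conv (point (t%:num * gamn n)) (cp (rt rho t (Sm n)) (rn rho (mSm n)))) (Dn t).

Lemma tl_cvg_Yn (t : {nonneg R}) (Z : nat -> probability R R) a u : 0 < t%:num ->
  chf_cvg (fun n => conv (Yn n t) (Z n)) a ->
  tl (conv (Yn n t) (Z n)) u @[n --> \oo] --> tl a u.
Proof.
move=> t0 h.
have st0 : 0 < sigma * Num.sqrt t%:num by rewrite mulr_gt0// sqrtr_gt0.
pose W n := conv (Rn n t) (Z n).
have hb (f : R -> R) n : bdm f -> \int[conv (Yn n t) (Z n)]_x f x =
    \int[conv (gauss (sigma * Num.sqrt t%:num)) (W n)]_x f x.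
  move=> bf; transitivity (\int[Z n]_y (\int[Yn n t]_x f (x + y))).
    exact: (@E_convr _ (Yn n t) (Z n) f bf).
  transitivity (\int[Z n]_y (\int[conv (gauss (sigma * Num.sqrt t%:num)) (Rn n t)]_x f (x + y))).
    by apply: eq_Rintegral => y _; exact: (@E_convA _ (gauss _) _ (Dn t) _ (bdm_shift y bf)).
  apply: etrans (@E_convA _ (gauss (sigma * Num.sqrt t%:num)) (Rn n t) (Z n) f bf).
  exact: esym (@E_convr _ (conv (gauss _) (Rn n t)) (Z n) f bf).
have hW : chf_cvg (fun n => conv (gauss (sigma * Num.sqrt t%:num)) (W n)) a.
  move=> s p; have e := funext (fun n => hb _ n (bdm_cos s p)).
  exact: (eq_ind _ (fun F => F n @[n --> \oo] --> _) (h s p) _ e).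
have := @tl_cvg_of_chf _ _ W _ u st0 hW.
suff -> : (fun n => tl (conv (gauss (sigma * Num.sqrt t%:num)) (W n)) u) =
    (fun n => tl (conv (Yn n t) (Z n)) u) by [].
apply/funext => n; rewrite !tlE; apply/esym/hb; exact: bdm_lt.
Qed.

Definition Vb := \int[rho]_(x in SB) (x ^+ 2).

Lemma sqr_int : rho.-integrable SB (EFin \o (fun x : R => x ^+ 2)).
Proof.
have mV : measurable_fun setT (fun x : R => \1_(SB) x * x ^+ 2).
  by apply: measurable_funM; [apply: measurable_indic; exact: mSB|exact: measurable_sqr].
have := @levy_integrable _ _ hrho (fun x => \1_(SB) x * x ^+ 2) 1 mV.
have h x : `|\1_(SB) x * x ^+ 2| <= 1 * Num.min 1 (x ^+ 2) :> R.
  rewrite mul1r indicE; have [xb|xb] := boolP (x \in SB); last first.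
    by rewrite mul0r normr0 le_min ler01 sqr_ge0.
  rewrite inE /SB /= in xb.
  rewrite mul1r ger0_norm ?sqr_ge0// le_min lexx andbT -real_normK ?num_real//.
  by rewrite expr_le1// (le_trans xb).
move=> /(_ h) /(integrableS measurableT mSB (@subsetT _ _)).
apply: eq_integrable; first exact: mSB.
by move=> x xb; rewrite /= indicE xb mul1r.
Qed.

Lemma Vb_ge0 : 0 <= Vb.
Proof. by apply: Rintegral_ge0 => x _; exact: sqr_ge0. Qed.

(** A bound, per unit of time and uniform in [n], on the logarithm of the exponential moment of
    [Un n]. *)
Definition qexp (th : R) := gam' * th + sigma ^+ 2 * th ^+ 2 / 2 + Vb * (th ^+ 2 * expR (`|th| * b)).

Lemma mgfle_Un n t th : mgfle (Un n t) th (expR (t%:num * qexp th)).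
Proof.
have hB x : Sm n x -> `|x| <= b by move=> [].
have h1 := mgfle_cp_rn (mSm n) (fSm n) t th hB.
have := mgfle_conv (expR_ge0 _) (mgfle_gauss (sigma * Num.sqrt t%:num) th)
  (mgfle_conv (expR_ge0 _) (mgfle_point th (t%:num * gamn n)) h1).
apply: mgfle_le; rewrite -!expRD ler_expR.
rewrite exprMn sqr_sqrtr//.
have ib (f : R -> R) M : measurable_fun setT f -> (forall x, Sm n x -> `|f x| <= M) ->
    rho.-integrable (Sm n) (EFin \o f).
  move=> mf f1; apply: measurable_bounded_integrable => //.
  - exact: mSm.
  - exact: fSm.
  - exact: measurable_funTS.
  by exists M; split; [rewrite num_real|move=> x Mx y Ay /=; rewrite (le_trans (f1 y Ay))// ltW].
have ix : rho.-integrable (Sm n) (EFin \o (fun x : R => th * x)).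
  apply: (ib _ (`|th| * b)); first exact: measurable_funM.
  by move=> x /hB xb; rewrite normrM ler_wpM2l.
have ix1 : rho.-integrable (Sm n) (EFin \o (fun x : R => x)).
  by apply: (ib _ b) => // x /hB.
have me : measurable_fun setT (fun x : R => expR (th * x)).
  by have := measurable_expRlin th 0; under eq_fun do rewrite addr0.
have ie : rho.-integrable (Sm n) (EFin \o (fun x : R => expR (th * x) - 1)).
  apply: (ib _ (expR (`|th| * b) + 1)); first exact: measurable_funB.
  move=> x xS; rewrite (le_trans (ler_normB _ _))// normr1 lerD2r.
  rewrite ger0_norm ?expR_ge0// ler_expR (le_trans (ler_norm _))// normrM ler_wpM2l//.
  exact: hB.
have i2 : rho.-integrable (Sm n) (EFin \o (fun x : R => x ^+ 2)).
  by apply: (integrableS mSB (mSm n) _ sqr_int) => x [].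
(* The compensator removes the linear term; what remains is bounded by the second moment of the
   small jumps, whatever [n] is. *)
have key : \int[rho]_(x in Sm n) (expR (th * x) - 1) - th * \int[rho]_(x in Sm n) x <=
    Vb * (th ^+ 2 * expR (`|th| * b)).
  rewrite -RintegralZl//; last exact: mSm.
  rewrite -RintegralB//; last exact: mSm.
  have c0 : 0 <= th ^+ 2 * expR (`|th| * b) by rewrite mulr_ge0 ?sqr_ge0 ?expR_ge0.
  apply: (@le_trans _ _ (\int[rho]_(x in Sm n) (x ^+ 2 * (th ^+ 2 * expR (`|th| * b))))).
    apply: le_Rintegral.
    - exact: mSm.
    - have := integrableB (mSm n) ie ix; exact.
    - have := integrableZr (mSm n) (th ^+ 2 * expR (`|th| * b)) i2; exact.
    move=> x /hB xb; apply: (le_trans (expR_sub2 _)).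
    rewrite exprMn mulrA (mulrC (x ^+ 2)) ler_wpM2l//.
      by rewrite mulr_ge0 ?sqr_ge0.
    by rewrite ler_expR normrM ler_wpM2l.
  rewrite RintegralZr//; last exact: mSm.
  rewrite ler_wpM2r// /Vb /Rintegral fine_le//.
  - by apply: integrable_fin_num => //; exact: mSm.
  - by apply: integrable_fin_num => //; [exact: mSB|exact: sqr_int].
  have ms : measurable_fun SB (fun x : R => (x ^+ 2)%:E).
    by apply/measurable_EFinP/measurable_funTS; exact: measurable_sqr.
  apply: (@ge0_subset_integral _ _ _ rho _ _ (mSm n) mSB _ ms).
  - by move=> x _; rewrite lee_fin sqr_ge0.
  - by move=> x [].
rewrite /qexp /gamn.
have t0 : 0 <= t%:num by [].
have := ler_wpM2l t0 key; rewrite -/gam'; lra.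
Qed.

Lemma Dn_nonpos t : tl (Dn t) 0 = 0 /\ tl (rn rho mSN) 0 = 0.
Proof.
have h : tl (rn rho mSN) 0 = 0.
  apply: (tl_rn0 mSN fSN) => // x /= xb; apply: ltW; apply: (lt_trans xb).
  by rewrite oppr_lt0.
split => //; apply/eqP; rewrite eq_le tl_ge0 andbT.
have := @tl_cp_nonpos R (point 0) (rt rho t SN) _ 0 h.
rewrite tl_convC tl_conv_point => /le_trans; apply.
by rewrite tlE E_point ?ltxx//; exact: bdm_lt.
Qed.

Lemma tl_Yn_le n t x : tl (Yn n t) x <= tl (Un n t) x.
Proof. by apply: tl_conv_nonpos; have [] := Dn_nonpos t. Qed.

Lemma tl_Yn_ge n t x :
  expR (- (t%:num * (rl rho SN)%:num)) * tl (Un n t) x <= tl (Yn n t) x.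
Proof. exact: (@tl_cp_ge0 R (Un n t) (rt rho t SN)). Qed.

Lemma tl_Yn_chernoff n t x th : 0 <= th -> tl (Yn n t) x <= expR (- (th * x)) * expR (t%:num * qexp th).
Proof.
move=> th0; apply: (le_trans (tl_Yn_le n t x)); apply: chernoff => //.
exact: mgfle_Un.
Qed.

Lemma tl_Un_low : exists2 C, 0 <= C & forall n (t : {nonneg R}) e, t%:num <= 1 -> 0 < e ->
  1 - C * t%:num / e ^+ 2 <= tl (Un n t) (- e).
Proof.
(* In place of convexity: exponential moments over time [t] exceed 1 by at most a multiple of [t],
   as [mgf_cheb] requires. *)
have conv1 (t y : R) : 0 <= t <= 1 -> expR (t * y) <= 1 + t * expR (2 * `|y|).
  move=> /andP[t0 t1]; have h := expR_ge1Dx (- (t * y)).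
  have e0 := expR_gt0 (t * y).
  have e1 : expR (- (t * y)) * expR (t * y) = 1 by rewrite -expRD addNr expR0.
  have h1 : expR (t * y) <= 1 + t * (y * expR (t * y)) by nra.
  apply: (le_trans h1); rewrite lerD2l ler_wpM2l//.
  apply: (@le_trans _ _ (`|y| * expR `|y|)).
    rewrite (@le_trans _ _ (`|y| * expR (t * y)))//.
      by rewrite ler_wpM2r ?ler_norm// expR_ge0.
    rewrite ler_wpM2l// ler_expR (le_trans (ler_norm _))// normrM ler_piMl//.
    by rewrite ger0_norm.
  rewrite mulr_natl mulr2n expRD ler_wpM2r ?expR_ge0//.
  by have := expR_ge1Dx `|y|; lra.
exists (4 * (expR (2 * `|qexp 1|) + expR (2 * `|qexp (-1)|))); first by rewrite mulr_ge0// addr_ge0// expR_ge0.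
move=> n t e t1 e0.
have := mgf_cheb (ltW e0) (mgfle_Un n t 1) (mgfle_Un n t (-1)).
have t01 : 0 <= t%:num <= 1 by rewrite t1 andbT.
have := conv1 _ (qexp 1) t01; have := conv1 _ (qexp (-1)) t01.
move: (tl (Un n t) (- e)) (expR (t%:num * qexp 1)) (expR (t%:num * qexp (-1))) => z M1 M2.
move: (expR (2 * `|qexp 1|)) (expR (2 * `|qexp (-1)|)) => q1 q2 h1 h2 h3.
have e2 : 0 < e ^+ 2 by rewrite exprn_gt0.
rewrite lerBlDr -lerBlDl ler_pdivlMr//; lra.
Qed.

Hypothesis hl : 0 < (rl rho SP)%:num.
Local Notation m := (rn rho mSP).
Local Notation lam := ((rl rho SP)%:num).

Lemma m_supp : tl m b = 1.
Proof. by apply: (tl_rn1 mSP fSP). Qed.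

Lemma cvg_tl_pi (t : {nonneg R}) x : 0 < t%:num ->
  tl (conv (Yn n t) (Cn t)) x @[n --> \oo] --> tl (pi t) x.
Proof.
move=> t0; apply: (@tl_cvg_Yn t (fun=> Cn t)) => //.
exact: (@chf_cvg_Yn_Cn t).
Qed.

Definition neg_rate := (rl rho SN)%:num.

(** With probability [exp (- t * neg_rate)] there is no jump below [- b], and jumps above [b] only
    help; the rest is Chebyshev's bound [tl_Un_low], passed to the limit. *)
Lemma levy_lower_tail : exists2 C, 0 <= C & forall (t : {nonneg R}) e,
  0 < t%:num -> t%:num <= 1 -> 0 < e ->
  expR (- (t%:num * neg_rate)) * (1 - C * t%:num / e ^+ 2) <= tl (pi t) (- e).
Proof.
have [C C0 hC] := tl_Un_low.
exists C => // t e t0 t1 e0.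
apply: (cvg_ge_cst (@cvg_tl_pi t (- e) t0)) => n.
apply: (@le_trans _ _ (tl (Yn n t) (- e))).
  apply: le_trans (tl_Yn_ge n t (- e)).
  by apply: ler_wpM2l; [exact: expR_ge0|exact: hC].
exact: (tl_cp_nonneg _ _ _ (ltW b0) m_supp).
Qed.

Lemma tl_Un_half : exists2 L, 0 < L & forall n (t : {nonneg R}), t%:num <= 1 ->
  2^-1 <= tl (Un n t) (- L).
Proof.
have [C C0 hC] := tl_Un_low.
exists (2 * C + 1); first by lra.
move=> n t t1; have L0 : 0 < 2 * C + 1 by lra.
apply: le_trans (hC n t _ t1 L0).
have t0 : 0 <= t%:num by [].
have h : C * t%:num / (2 * C + 1) ^+ 2 <= 2^-1.
  by rewrite ler_pdivrMr ?exprn_gt0//; nra.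
lra.
Qed.

Lemma tl_Yn_low : exists2 L, 0 < L & exists2 c, 0 < c & forall n (t : {nonneg R}),
  t%:num <= 1 -> c <= tl (Yn n t) (- L).
Proof.
have [L L0 hL] := tl_Un_half; exists L => //.
exists (expR (- neg_rate) * 2^-1); first by rewrite mulr_gt0// expR_gt0.
move=> n t t1; apply: le_trans (tl_Yn_ge n t (- L)).
apply: ler_pM => //; last exact: hL.
by rewrite ler_expR lerN2 ler_piMl.
Qed.

(** From a position above [- L], which has probability at least [c], [k] jumps above [b] reach [K];
    within time [t] they occur with probability of order [t ^ k]. *)
Lemma levy_upper_lower K : exists k c, 0 < c /\ forall (t : {nonneg R}),
  0 < t%:num -> t%:num <= 1 -> c * t%:num ^+ k <= tl (pi t) K.
Proof.
have [L L0 [c c0 hc]] := tl_Yn_low.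
pose k := (Num.truncn ((`|K| + L) / b)).+1.
have hk : K - k%:R * b <= - L.
  have h0 : 0 <= (`|K| + L) / b by rewrite divr_ge0 ?addr_ge0// ltW.
  have /andP[_ hk] := truncn_itv h0.
  have := ltW hk; rewrite -/k ler_pdivrMr// => h.
  by have := ler_norm K; lra.
exists k, (expR (- lam) * (lam ^+ k / k`!%:R) * c); split.
  by rewrite !mulr_gt0 ?expR_gt0 ?invr_gt0 ?exprn_gt0 ?ltr0n ?fact_gt0.
move=> t t0 t1; apply: (cvg_ge_cst (@cvg_tl_pi t K t0)) => n.
apply: le_trans (tl_cp_ge _ _ _ _ k).
apply: (@le_trans _ _ ((pw (rt rho t SP) k)%:num * c)); last first.
  apply: ler_wpM2l => //; apply: le_trans (tl_convn_supp _ _ _ m_supp).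
  by apply: (le_trans (hc n t t1)); exact: tl_le.
rewrite /= exprMn.
set e1 := expR (- lam); set e2 := expR (- _).
have e12 : e1 <= e2 by rewrite ler_expR lerN2 ler_piMl// ltW.
rewrite (_ : e1 * (lam ^+ k / k`!%:R) * c * t%:num ^+ k = e1 * ((t%:num ^+ k * lam ^+ k) / k`!%:R) * c); last first.
  by ring.
rewrite ler_wpM2r ?(ltW c0)// ler_wpM2r// mulr_ge0// ?invr_ge0// mulr_ge0 ?exprn_ge0// ltW.
Qed.

Hypotheses (p0 : 0 < tl m (4 * b)) (hm : light_step m).

Lemma tame_Yn : exists2 L, 0 < L & exists2 c, 0 < c & forall n (t : {nonneg R}), t%:num <= 1 ->
  c <= tl (Yn n t) (- L) /\
  tame b `|gam'| (sigma ^+ 2 / 2) (Vb) L c (Yn n t).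
Proof.
have [L L0 [c c0 h]] := tl_Yn_low.
exists L => //; exists c => // n t t1; split; first exact: h.
split; last exact: h.
move=> x th th0; apply: (le_trans (tl_Yn_chernoff n t x th0)).
apply: ler_wpM2l; first exact: expR_ge0.
rewrite ler_expR; set q := (X in _ <= X).
have V0 : 0 <= Vb * (th ^+ 2 * expR (th * b)).
  by apply: mulr_ge0; [exact: Vb_ge0|rewrite mulr_ge0 ?sqr_ge0 ?expR_ge0].
have S0 : 0 <= sigma ^+ 2 / 2 * th ^+ 2 by rewrite mulr_ge0 ?sqr_ge0// divr_ge0 ?sqr_ge0.
have q0 : 0 <= q by rewrite /q !addr_ge0// mulr_ge0.
apply: (@le_trans _ _ (t%:num * q)); last by rewrite ler_piMl.
apply: ler_wpM2l => //; rewrite /q /qexp (ger0_norm th0).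
have h1 : gam' * th <= `|gam'| * th.
  by apply: ler_wpM2r => //; exact: ler_norm.
lra.
Qed.

(** Shortening the time lowers the rate of large jumps by the factor [t1], which [tl_cp_rate_lt]
    shows to be decisive even against the shift [K]. The additional tame part over time [t2] stays
    above [- L] and costs only the constant [c]. *)
Lemma levy_time_lt (t1 t2 t : {nonneg R}) K (e : R) : 0 < t1%:num -> 0 < t2%:num ->
  t%:num = t1%:num + t2%:num -> t%:num = 1 -> 0 < e ->
  exists u0, forall u, u0 <= u -> tl (pi t1) (u - K) <= e * tl (pi t) u.
Proof.
move=> t10 t20 tE t1E e0; have [L L0 [c c0 hT]] := tame_Yn.
have r01 : 0 < t1%:num < 1 by rewrite t10/=; lra.
have l0 : 0 < (rt rho t SP)%:num by rewrite /= mulr_gt0// t1E.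
have lE : (rt rho t1 SP)%:num = t1%:num * (rt rho t SP)%:num.
  by rewrite /= mulrA t1E mulr1.
have ec : 0 < e * c by rewrite mulr_gt0.
have S0 : 0 <= sigma ^+ 2 / 2 by rewrite divr_ge0 ?sqr_ge0.
have [u0 hu] := @tl_cp_rate_lt _ m b b0 (m_supp) p0
  `|gam'| (sigma ^+ 2 / 2) (Vb) L c (normr_ge0 _) S0 Vb_ge0 c0
  _ l0 hm _ _ K _ r01 lE ec.
exists u0 => u uu.
have c1 := @cvg_tl_pi t1 (u - K) t10.
have c2 := @tl_cvg_Yn t1 _ _ u t10
  (@chf_cvg_Yn2_Cn t1 t2 t tE).
have {}c2 : e * tl (conv (Yn n t1) (conv (Yn n t2) (Cn t))) u @[n --> \oo] --> e * tl (pi t) u.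
  by apply: cvgMl_tmp; exact: c2.
apply: (ler_cvg_to c1 c2); apply: nearW => n.
have t1l : t1%:num <= 1 by lra.
have t2l : t2%:num <= 1 by lra.
have [_ hY1] := hT n t1 t1l; have [hY2 _] := hT n t2 t2l.
apply: (le_trans (hu u uu (Yn n t1) hY1)); rewrite -[leLHS]mulrA; apply: ler_wpM2l; first exact: ltW.
have -> : tl (conv (Yn n t1) (conv (Yn n t2) (Cn t))) u =
    tl (conv (Yn n t2) (conv (Yn n t1) (Cn t))) u.
  by rewrite -[LHS]tl_convA -[RHS]tl_convA; apply: tl_conv_congl => y; exact: tl_convC.
have := tl_conv_mul (Yn n t2) (conv (Yn n t1) (Cn t)) (- L) (u + L).
rewrite (addrC (- L)) addrK; apply: le_trans.
by apply: ler_wpM2r hY2; exact: tl_ge0.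
Qed.

Section smoothing_at.
Variable t : {nonneg R}.
Hypothesis t0 : 0 < t%:num.
Local Notation s := (sigma * Num.sqrt t%:num).

Lemma cvg_gauss_tl_conv lam u :
  tl (conv (conv (gauss s) (conv (Rn n t) (Cn t))) lam) u @[n --> \oo] -->
  tl (conv (pi t) lam) u.
Proof.
apply: cvg_tl_convl => y.
have e n : tl (conv (gauss s) (conv (Rn n t) (Cn t))) y = tl (conv (Yn n t) (Cn t)) y.
  rewrite -[LHS]tl_convA; apply: tl_conv_congl => z.
  by rewrite -[LHS]tl_convA.
under eq_cvg do rewrite e.
exact: (@cvg_tl_pi t y t0).
Qed.

(** The limit of [gauss_smoothing], with everything but the Gaussian factor of [pi t] in the role of
    [beta]. *)
Lemma levy_smoothing A C K D kap e0 j0 lam p p' : 0 <= A -> 0 <= C -> 0 <= D ->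
  1 <= j0 -> kap <= (2 * s ^+ 2)^-1 -> 0 <= e0 -> e0 <= 1 / 2 ->
  forall G, (forall v e, 0 <= e -> e * (1 + Num.max v 0) <= 1 ->
    tl (gauss s) (v - e) <= (1 + G * (e * (1 + Num.max v 0))) * tl (gauss s) v) ->
  (forall x w, tl lam x <= A * tl p (x - slack e0 w) + C * tl p' (x - K) +
    ((j0 < w)%R)%:R * (D * expR (kap * w) * tl p (x + 1))) ->
  forall u, tl (conv (pi t) lam) u <=
    (A * (1 + G * (2 * e0)) + D * expR (- ((j0 - 1) / (2 * s ^+ 2)))) *
      tl (conv (pi t) p) u + C * tl (conv (pi t) p') (u - K).
Proof.
move=> A0 C0 D0 j01 hk e00 e01 G hG h u.
have st0 : 0 < s by rewrite mulr_gt0// sqrtr_gt0.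
set Z := A * _ + _.
have c1 := @cvg_gauss_tl_conv lam u.
have c2 : Z * tl (conv (conv (gauss s) (conv (Rn n t) (Cn t))) p) u +
    C * tl (conv (conv (gauss s) (conv (Rn n t) (Cn t))) p') (u - K) @[n --> \oo] -->
    Z * tl (conv (pi t) p) u + C * tl (conv (pi t) p') (u - K).
  by apply: cvgD; apply: cvgMl_tmp; [exact: (@cvg_gauss_tl_conv p u)|exact: (@cvg_gauss_tl_conv p' (u - K))].
apply: (ler_cvg_to c1 c2); apply: nearW => n.
exact: (gauss_smoothing st0 A0 C0 D0 j01 hk e00 e01 hG h).
Qed.
End smoothing_at.

Local Notation neg := neg_rate.

(** Both laws have the same characteristic function, so both tails are limits of one and the same
    sequence of approximating tails. *)
Lemma levy_semigroup (t1 t2 t : {nonneg R}) x : 0 < t%:num -> t%:num = t1%:num + t2%:num ->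
  tl (conv (pi t1) (pi t2)) x = tl (pi t) x.
Proof.
move=> t0 tE.
have h1 := @cvg_tl_pi t x t0.
have e s p : \int[pi t]_x cos (s * x + p) = \int[conv (pi t1) (pi t2)]_x cos (s * x + p).
  rewrite (hpi t s p) (polar_conv (hpi t1 s) (hpi t2 s) p) -expRD tE.
  by congr (expR _ * cos (_ + _)); rewrite mulrDl.
have h2 : chf_cvg (fun n => conv (Yn n t) (Cn t)) (conv (pi t1) (pi t2)).
  by move=> s p; rewrite -e; exact: (@chf_cvg_Yn_Cn t s p).
have h3 := @tl_cvg_Yn t (fun=> Cn t) _ x t0 h2.
by rewrite -(cvg_lim _ h1)// -(cvg_lim _ h3).
Qed.

Definition first_rate C (d e : R) := expR (- (d * neg)) * (1 - C * d / e ^+ 2).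

(* The form in which Ottaviani's inequality bounds a maximum [lam] of the increments of the
   process over an interval of length [h]: with a small tolerance [e] on the last window of
   length [d], and with a fixed tolerance [K] before it. *)
Definition max_dom C Cc K (h : {nonneg R}) lam := forall x d e (h' : {nonneg R}),
  0 < d -> h'%:num = h%:num - d -> 0 < h'%:num -> 0 < e -> 0 < first_rate C d e ->
  tl lam x <= (first_rate C d e)^-1 * tl (pi h) (x - e) + Cc * tl (pi h') (x - K).

Lemma first_rate_ge C d e tau : 0 <= C -> 0 < d -> 0 < tau -> tau <= 1 / 4 ->
  d * neg <= tau -> C * d / e ^+ 2 <= tau -> (first_rate C d e)^-1 <= 1 + 4 * tau /\
  0 < first_rate C d e.
Proof.
move=> C0 d0 t0 t4 h1 h2.
have e1 := expR_ge1Dx (- (d * neg)).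
have h3 : (1 - tau) * (1 - tau) <= first_rate C d e.
  by apply: ler_pM; lra.
have f0 : 0 < first_rate C d e by apply: lt_le_trans h3; rewrite mulr_gt0//; lra.
split => //; rewrite -[leLHS]mul1r ler_pdivrMr//.
have h4 : (1 + 4 * tau) * ((1 - tau) * (1 - tau)) <= (1 + 4 * tau) * first_rate C d e.
  by apply: ler_wpM2l => //; lra.
apply: le_trans h4; nra.
Qed.

(* At the value [w] of the Gaussian summand of [pi h], the window is [d = exp (- c y)] and the
   tolerance [e = e0 / (1 + y)] with [y = max w j0], so that [d / e ^ 2] is small. The term
   with tolerance [K] is negligible by [levy_time_lt] when [w <= j0]; when [w > j0] it is at
   most [O (d ^ - k) = O (exp (c k w))] times the tail of [pi h]. *)
Lemma max_tail C Cc K (h one : {nonneg R}) eta : 0 <= C -> 0 <= Cc ->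
  h%:num = 1 / 2 -> one%:num = 1 -> 0 < eta -> eta <= 1 ->
  exists u0, forall u, u0 <= u -> forall lam, max_dom C Cc K h lam ->
  tl (conv (pi h) lam) u <= (1 + eta) * tl (pi one) u.
Proof.
move=> C0 Cc0 hE oneE eta0 eta1; pose s := sigma * Num.sqrt h%:num.
have h0 : 0 < h%:num by rewrite hE.
have st0 : 0 < s by rewrite mulr_gt0// sqrtr_gt0.
have [G G0 hG] := gauss_tail_ratio st0.
(* A rise by [K + 1] within the window takes the level [x - K] at its beginning to [x + 1] at its
   end. *)
have [k [c1 [c10 hk]]] := levy_upper_lower (K + 1).
pose v := (2 * s ^+ 2)^-1.
have v0 : 0 < v by rewrite invr_gt0 mulr_gt0// exprn_gt0.
(* With [d = exp (- c w)] the loss [d ^ - k] is [exp (kap * w)], and this [c] keeps [kap] below the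
   [v] that [levy_smoothing] tolerates. *)
pose c := v / k.+1%:R; have c0 : 0 < c by rewrite divr_gt0.
pose kap := c * k%:R.
have kapv : kap <= v.
  rewrite /kap /c mulrAC ler_pdivrMr ?ltr0n//; apply: ler_wpM2l; first exact: ltW.
  by rewrite ler_nat.
pose D := Cc / c1; have D0 : 0 <= D by rewrite divr_ge0// ltW.
(* Budget for [1 + eta]: [tau] and [e0] give at most [(1 + eta / 8) ^ 2], the Gaussian values above
   [j0] give [eta / 8], and the comparison of times gives [eta / 2]. *)
pose e0 := eta / (16 * (G + 1)).
have e00 : 0 < e0 by rewrite divr_gt0// mulr_gt0// addr_gt0.
have e0G : e0 * (16 * (G + 1)) = eta by rewrite divfK// gt_eqF// mulr_gt0// addr_gt0.
have e0h : e0 <= 1 / 2 by nra.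
have e0G' : G * (2 * e0) <= eta / 8 by nra.
pose tau := eta / 32; have tau0 : 0 < tau by rewrite divr_gt0.
have tau4 : tau <= 1 / 4 by rewrite /tau; lra.
have n0 : 0 <= neg by rewrite /neg_rate.
(* One bound [d (1 + y) ^ 2 <= tau / W] meets all requirements on [d]: the summands of [W] stand for
   [d * neg], for [C * d / e ^ 2] and for [d < 1 / 2]. *)
pose W := neg + C / e0 ^+ 2 + 1.
have Ce0 : 0 <= C / e0 ^+ 2 by rewrite divr_ge0// sqr_ge0.
have W0 : 0 < W by rewrite /W; lra.
pose tau1 := tau / W; have tau10 : 0 < tau1 by rewrite divr_gt0.
have tau1W : tau1 * W = tau by rewrite divfK// gt_eqF.
have [j1 hj1] := expRN_sqr_small c0 tau10.
(* [j1] makes the windows short enough; the second entry makes [D * exp (- (j0 - 1) * v)] at most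
   [eta / 8], through [exp (- x) <= 1 / x]. *)
pose j0 := Num.max j1 (8 * D / (eta * v) + 2).
have jD : 8 * D / (eta * v) + 2 <= j0 by rewrite le_max lexx orbT.
have ev0 : 0 < eta * v by rewrite mulr_gt0.
have D8 : 0 <= 8 * D / (eta * v) by apply: divr_ge0; [exact: mulr_ge0|exact: ltW].
have jj : j1 <= j0 by rewrite le_max lexx.
have j01 : 1 <= j0 by lra.
have hd y : j0 <= y -> let d := expR (- (c * y)) in
    [/\ 0 < d, d < 1 / 2, d * neg <= tau & C * d / (e0 / (1 + y)) ^+ 2 <= tau].
  move=> jy d; have d0 : 0 < d by exact: expR_gt0.
  have hy := hj1 y (le_trans jj jy); rewrite -/d in hy.
  have y1 : 1 <= (1 + y) ^+ 2 by nra.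
  have dt : d <= tau1 by nra.
  have t1W : tau1 * (neg + C / e0 ^+ 2 + 1) = tau by exact: tau1W.
  have dn : tau1 * neg + tau1 * (C / e0 ^+ 2) + tau1 = tau by lra.
  have tn : 0 <= tau1 * neg by rewrite mulr_ge0// ltW.
  have tC : 0 <= tau1 * (C / e0 ^+ 2) by rewrite mulr_ge0// ltW.
  split => //; first lra.
    apply: (@le_trans _ _ (tau1 * neg)); [exact: ler_wpM2r|lra].
  have -> : C * d / (e0 / (1 + y)) ^+ 2 = C / e0 ^+ 2 * (d * (1 + y) ^+ 2).
    by field; rewrite !gt_eqF//; lra.
  apply: (@le_trans _ _ (C / e0 ^+ 2 * tau1)); [exact: ler_wpM2l|lra].
pose d0 := expR (- (c * j0)); have [d00 d01 _ _] := hd j0 (lexx j0); rewrite -/d0 in d00 d01.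
have hd0 : 0 <= 1 / 2 - d0 by lra.
pose h' : {nonneg R} := NngNum hd0.
have ho : 0 <= 1 - d0 by lra.
pose one' : {nonneg R} := NngNum ho.
pose dd : {nonneg R} := NngNum (ltW d00).
have e20 : 0 < eta / (2 * (Cc + 1)) by rewrite divr_gt0// mulr_gt0//; lra.
have ho1 : 0 < one'%:num by rewrite /=; lra.
have hoE : one%:num = one'%:num + dd%:num by rewrite /= oneE subrK.
have [u0 hu0] := @levy_time_lt one' dd one K _
  ho1 d00 hoE oneE e20.
exists u0 => u uu lam hlam.
have H x w : tl lam x <= (1 + 4 * tau) * tl (pi h) (x - slack e0 w) + Cc * tl (pi h') (x - K) +
    ((j0 < w)%R)%:R * (D * expR (kap * w) * tl (pi h) (x + 1)).
  pose y := Num.max w j0; have jy : j0 <= y by rewrite le_max lexx orbT.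
  have [y0 y2 y3 y4] := hd y jy.
  pose d := expR (- (c * y)); rewrite -/d in y0 y2 y3 y4.
  have ey : 0 < e0 / (1 + y) by rewrite divr_gt0//; lra.
  have [r1 r2] := first_rate_ge C0 y0 tau0 tau4 y3 y4.
  have es : e0 / (1 + y) <= slack e0 w.
    rewrite /slack ler_wpM2l ?(ltW e00)// lef_pV2 ?posrE ?max0_gt0//; last by lra.
    have wy : w <= y by rewrite le_max lexx.
    by rewrite lerD2l ge_max wy/=; lra.
  have T1 : (first_rate C d (e0 / (1 + y)))^-1 * tl (pi h) (x - e0 / (1 + y)) <=
      (1 + 4 * tau) * tl (pi h) (x - slack e0 w).
    apply: ler_pM; [by rewrite invr_ge0 ltW|exact: tl_ge0|exact: r1|].
    by apply: tl_le; rewrite lerB.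
  have [jw|wj] := ltP j0 w; last first.
    rewrite mul0r addr0.
    have yE : y = j0 by rewrite /y max_r.
    have B := hlam x d (e0 / (1 + y)) h' y0; rewrite {1}/d yE -/d0 in B.
    have B1 : h'%:num = h%:num - d0 by rewrite hE.
    have B2 : 0 < h'%:num by rewrite /=; lra.
    have := B B1 B2; rewrite -yE => {}B.
    apply: (le_trans (B ey r2)); rewrite lerD2r; exact: T1.
  rewrite mul1r.
  have yE : y = w by rewrite /y max_l// ltW.
  have hw0 : 0 <= 1 / 2 - d by lra.
  have B1 : (NngNum hw0)%:num = h%:num - d by rewrite hE.
  have B2 : 0 < (NngNum hw0)%:num by rewrite /=; lra.
  apply: (le_trans (hlam x d _ _ y0 B1 B2 ey r2)).
  rewrite -addrA; apply: lerD; first exact: T1.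
  apply: (@le_trans _ _ (D * expR (kap * w) * tl (pi h) (x + 1))); last first.
    by rewrite lerDr mulr_ge0// tl_ge0.
  have dE : h%:num = (NngNum hw0)%:num + (NngNum (ltW y0))%:num by rewrite /= hE subrK.
  have := tl_conv_mul (pi (NngNum hw0)) (pi (NngNum (ltW y0))) (x - K) (K + 1).
  rewrite (levy_semigroup _ h0 dE) (_ : x - K + (K + 1) = x + 1); last by ring.
  have d1 : (NngNum (ltW y0))%:num <= 1 by rewrite /=; lra.
  have hkd := hk (NngNum (ltW y0)) y0 d1; rewrite /= in hkd.
  have dk : expR (kap * w) * d ^+ k = 1.
    rewrite /d yE -expRM_natl -expRD /kap.
    by rewrite (_ : _ + _ = 0) ?expR0//; ring.
  move=> h3.
  set a := tl (pi (NngNum hw0)) (x - K) in h3 *.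
  have a0 : 0 <= a by exact: tl_ge0.
  have h4 : a * (c1 * d ^+ k) <= tl (pi h) (x + 1).
    by apply: le_trans h3; exact: ler_wpM2l.
  have -> : Cc * a = D * expR (kap * w) * (a * (c1 * d ^+ k)).
    rewrite (_ : D * _ * _ = D * c1 * a * (expR (kap * w) * d ^+ k)); last by ring.
    by rewrite dk mulr1 /D divfK// gt_eqF.
  by apply: ler_wpM2l => //; rewrite mulr_ge0// expR_ge0.
have A0 : 0 <= 1 + 4 * tau by lra.
have key := @levy_smoothing h h0 _ Cc K D kap e0 j0 lam
  (pi h) (pi h') A0 Cc0 D0 j01 kapv (ltW e00) e0h G hG H u.
have hoE' : one'%:num = h%:num + h'%:num by rewrite /= hE; lra.
have onE : one%:num = h%:num + h%:num by rewrite hE oneE; lra.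
have on0 : 0 < one%:num by rewrite oneE.
rewrite (levy_semigroup _ on0 onE) (levy_semigroup _ ho1 hoE') in key.
apply: (le_trans key).
have q0 : 0 <= tl (pi one) u by exact: tl_ge0.
have h1 := hu0 u uu.
have h2 : Cc * tl (pi one') (u - K) <= eta / 2 * tl (pi one) u.
  apply: (le_trans (ler_wpM2l Cc0 h1)); rewrite mulrA; apply: ler_wpM2r => //.
  rewrite mulrA ler_pdivrMr; last by rewrite mulr_gt0//; lra.
  nra.
have h5 : D * expR (- ((j0 - 1) / (2 * s ^+ 2))) <= eta / 8.
  have x0 : 0 < (j0 - 1) * v by rewrite mulr_gt0//; lra.
  apply: (@le_trans _ _ (D * ((j0 - 1) * v)^-1)).
    by apply: ler_wpM2l => //; exact: expRN_le_inv.
  rewrite ler_pdivrMr//.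
  have : 8 * D / (eta * v) * (eta * v) <= (j0 - 1) * (eta * v).
    by apply: ler_wpM2r; [rewrite mulr_ge0// ltW|lra].
  rewrite divfK ?mulf_neq0 ?gt_eqF//; lra.
have h6 : (1 + 4 * tau) * (1 + G * (2 * e0)) <= (1 + eta / 8) * (1 + eta / 8).
  apply: ler_pM; [exact: A0| |by rewrite /tau; lra|lra].
  by apply: addr_ge0 => //; apply: mulr_ge0; [exact: ltW|apply: mulr_ge0 => //; exact: ltW].
have h7 : (1 + 4 * tau) * (1 + G * (2 * e0)) + D * expR (- ((j0 - 1) / (2 * s ^+ 2))) <= 1 + eta / 2.
  nra.
have := ler_wpM2r q0 h7; move: h2; set q1 := Cc * _; set q2 := (_ + _) * _.
lra.
Qed.

End levy.

(** * From the light right tail of jumps above [a] to [light_step] for jumps above [b] *)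

Section light_tail.
Context (R : realType) (rho : {measure set R -> \bar R}).
Hypothesis hrho : levy_measure rho.

Lemma tl_rn (A : set R) (mA : measurable A) x : (rho A < +oo)%E ->
  (rl rho A)%:num * tl (rn rho mA) x = fine (rho (A `&` [set y | x < y])).
Proof.
move=> fA; have mx : measurable [set y : R | x < y] by exact: measurable_gt.
have := @ge0_integral_rn _ rho A mA fA (EFin \o (\1_[set y : R | x < y] : R -> R)).
have mf : measurable_fun setT (EFin \o (\1_[set y : R | x < y] : R -> R)).
  by apply/measurable_EFinP; exact: measurable_indic.
pose f := EFin \o (\1_[set y : R | x < y] : R -> R); have f0 z : (0 <= f z)%E by rewrite lee_fin.
move=> /(_ mf f0); rewrite integral_indic// integral_indic// setIT => h.
by rewrite tl_def setIC -h fineM// fin_num_measure.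
Qed.

Variables (a b : R).
Hypotheses (b0 : 0 < b) (ba : 4 * b <= a).
Hypothesis a1 : (0 < rho [set x : R | (a < x)%R])%E.
Variable mu : probability R R.
Hypothesis hmu : forall B : set R, measurable B ->
  mu B = (fine (rho (B `&` [set x | a < x])) / fine (rho [set x | a < x]))%:E.
Hypothesis mu_light : light_right_tail mu.
Local Notation m := (rn rho (mSP b)).
Local Notation ca := (fine (rho [set x | a < x])).
Local Notation cb := ((rl rho (SP b))%:num).

Let a0 : 0 < a. Proof. by apply: lt_le_trans ba; rewrite mulr_gt0. Qed.
Let lba : b <= a. Proof. have := b0; have := ba; lra. Qed.
Let fa : (rho [set x : R | (a < x)%R] < +oo)%E.
Proof. exact: (fSP hrho a0). Qed.

Let ca0 : 0 < ca. Proof. by rewrite fine_gt0// a1 fa. Qed.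

Let fin_gt x : b <= x -> rho [set y : R | x < y] \is a fin_num.
Proof.
by move=> bx; rewrite ge0_fin_numE//; apply: (fSP hrho); exact: lt_le_trans bx.
Qed.

Lemma rl_SP_ge : ca <= cb.
Proof.
apply: fine_le; [by apply: fin_gt|exact: (fin_gt (lexx b))|].
apply: le_measure; rewrite ?inE; [exact: measurable_gt|exact: mSP|].
by move=> x /=; rewrite /SP/= => h; exact: le_lt_trans h.
Qed.

Lemma rl_SP_gt0 : 0 < cb. Proof. exact: lt_le_trans rl_SP_ge. Qed.

Let setI_gt (x y : R) : [set z : R | x < z] `&` [set z : R | y < z] = [set z | Num.max x y < z].
Proof. by apply/seteqP; split => z /=; rewrite gt_max => /andP. Qed.

Let tl_mE x : cb * tl m x = fine (rho [set z | Num.max b x < z]).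
Proof. by rewrite tl_rn ?setI_gt//; exact: fSP. Qed.

Let tl_muE x : ca * tl mu x = fine (rho [set z | Num.max x a < z]).
Proof.
rewrite tl_def hmu; last exact: measurable_gt.
by rewrite setI_gt /= mulrC divfK// gt_eqF.
Qed.

(** Conditioning on jumps above [a] or above [b] changes tails beyond [a] only by a constant factor,
    so lightness of [mu] carries over to [m]. *)
Let tl_m_mu x : a <= x -> cb * tl m x = ca * tl mu x.
Proof.
move=> ax; by rewrite tl_mE tl_muE (max_r (le_trans lba ax)) (max_l ax).
Qed.

Let tl_mu_m x : ca * tl mu x <= cb * tl m x.
Proof.
rewrite tl_mE tl_muE; apply: fine_le.
- by apply: fin_gt; rewrite le_max lba orbT.
- by apply: fin_gt; rewrite le_max lexx.
apply: le_measure; rewrite ?inE; [exact: measurable_gt|exact: measurable_gt|].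
move=> z /=; rewrite !gt_max => /andP[h1 h2]; apply/andP; split=> //; exact: le_lt_trans h2.
Qed.

Let mu_scale : 0 <= cb / ca. Proof. by rewrite divr_ge0// ltW// rl_SP_gt0. Qed.

Let tl_mu_le x : tl mu x <= cb / ca * tl m x.
Proof. by rewrite mulrAC ler_pdivlMr// mulrC tl_mu_m. Qed.

Let tl_mu2_le x : tl (conv mu mu) x <= (cb / ca) ^+ 2 * tl (conv m m) x.
Proof.
apply: (le_trans (le_tl_convl mu x tl_mu_le)); rewrite expr2 -mulrA.
apply: ler_wpM2l => //; rewrite tl_convC.
exact: (le_tl_convl m x tl_mu_le).
Qed.

Lemma tl_rn_SP_gt0 : 0 < tl m (4 * b).
Proof.
rewrite -(pmulr_rgt0 _ rl_SP_gt0) tl_mE fine_gt0//.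
apply/andP; split; last first.
  have h : 0 < Num.max b (4 * b) by rewrite lt_max b0.
  exact: (fSP hrho h).
apply: (lt_le_trans a1); apply: le_measure; rewrite ?inE; [exact: measurable_gt|exact: measurable_gt|].
by move=> z /=; rewrite gt_max => h; apply/andP; split; [exact: le_lt_trans h|exact: le_lt_trans h].
Qed.

Lemma light_step_rn : light_step m.
Proof.
have cb0 := rl_SP_gt0.
case: mu_light => [[mu_pos mu_lim]|[A [alpha [_ _ muA _]]]]; last first.
  apply: (@light_step_bounded _ _ (Num.max A a)).
  apply/eqP; rewrite -(mulrI_eq0 _ (lregP (lt0r_neq0 cb0))).
  rewrite tl_m_mu ?le_max ?lexx ?orbT// mulf_eq0 gt_eqF//= eq_le tl_ge0 andbT.
  by apply: (@le_trans _ _ (tl mu A)); [apply: tl_le; rewrite le_max lexx|rewrite tl_def muA].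
have mu_gt0 x : 0 < tl mu x.
  have x0 : 0 < Num.max x 1 by rewrite lt_max ltr01 orbT.
  apply: (@lt_le_trans _ _ (tl mu (Num.max x 1))); last by apply: tl_le; rewrite le_max lexx.
  have mx : measurable [set y : R | Num.max x 1 < y] by exact: measurable_gt.
  by rewrite tl_def fine_gt0// mu_pos//= ltey_eq fin_num_measure.
apply: light_step_unbounded => [x|eta eta0].
  rewrite -(pmulr_rgt0 _ cb0).
  by apply: lt_le_trans (tl_mu_m x); rewrite mulr_gt0.
(* The constant lost between [mu] and [m]: [ca / cb] for the single jump and the square of [cb / ca]
   for the sum of two. *)
pose k := ca / cb * (cb / ca) ^+ 2.
have k0 : 0 < k by rewrite mulr_gt0 ?exprn_gt0 ?divr_gt0.
have e0 : 0 < eta / k by rewrite divr_gt0.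
have [x0 [_ hx]] := (cvgr0Pnorm_lt _).1 mu_lim _ e0.
exists (Num.max a (x0 + 1)) => x; rewrite ge_max => /andP[ax x0x].
have /hx : x0 < x by lra.
have -> : fine ((mu \x mu)%E [set p : R * R | x < p.1 + p.2]) = tl (conv mu mu) x.
  by rewrite tl_def convE.
rewrite -tl_def ger0_norm; last by rewrite divr_ge0// tl_ge0.
have c0 : 0 < tl (conv mu mu) x.
  have := tl_conv_mul mu mu (x / 2) (x / 2); rewrite -splitr.
  by apply: lt_le_trans; rewrite mulr_gt0.
rewrite ltr_pdivrMr// => /ltW h.
have -> : tl m x = ca / cb * tl mu x.
  by rewrite mulrAC -tl_m_mu// mulrC mulKf// gt_eqF.
have d0 : 0 <= ca / cb by rewrite divr_ge0// ltW.
apply: (le_trans (ler_wpM2l d0 h)).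
apply: (@le_trans _ _ (ca / cb * (eta / k * ((cb / ca) ^+ 2 * tl (conv m m) x)))).
  by apply: ler_wpM2l => //; apply: ler_wpM2l; [exact: ltW|exact: tl_mu2_le].
rewrite le_eqVlt; apply/orP; left; apply/eqP; rewrite /k; field.
by rewrite !gt_eqF// rl_SP_gt0.
Qed.

End light_tail.

(** * Independent increments and Ottaviani's inequality *)

Section independence.
Context d (T : measurableType d) (R : realType) (P : probability T R).
Variables (n : nat) (Y : 'I_n -> T -> R).
Hypothesis mY : forall j, measurable_fun setT (Y j).
Hypothesis iY : mutually_independent P Y.
Variable i : 'I_n.

(** An intersection-stable family generating the information of all coordinates except the
    [i]-th. *)
Definition boxes_off : set (set T) := [set A | exists B : 'I_n -> set R,
  [/\ forall j, measurable (B j), B i = setT & A = \bigcap_j (Y j @^-1` B j)]].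

Lemma measurable_box (B : 'I_n -> set R) : (forall j, measurable (B j)) ->
  measurable (\bigcap_j (Y j @^-1` B j)).
Proof.
move=> mB; apply: fin_bigcap_measurable => // j _.
by rewrite -[_ @^-1` _]setTI; exact: mY.
Qed.

Let mF (C : set R) : measurable C -> measurable (Y i @^-1` C).
Proof. by move=> mC; rewrite -[_ @^-1` _]setTI; exact: mY. Qed.

(** Both sides are finite measures in [E]. They agree on boxes, where the slot [i] is free to
    receive [C], hence on the generated sigma-algebra. *)
Lemma indep_drop (E : set T) (C : set R) : <<s boxes_off >> E -> measurable C ->
  P (E `&` Y i @^-1` C) = (P (Y i @^-1` C) * P E)%E.
Proof.
move=> sE mC; have mFC := mF mC.
have fF : (0 <= fine (P (Y i @^-1` C)))%R by rewrite fine_ge0.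
pose m1 : {measure set T -> \bar R} := mrestr P mFC.
pose m2 : {measure set T -> \bar R} := mscale (NngNum fF) P.
have e2 A : m2 A = (P (Y i @^-1` C) * P A)%E.
  by rewrite /m2 /= /mscale /= fineK// fin_num_measure.
rewrite -e2; apply: (@g_sigma_algebra_measure_unique _ R T boxes_off _ (fun=> setT) _ _ m1 m2) => //.
- by move=> A [B [mB _ ->]]; exact: measurable_box.
- move=> _; exists (fun=> setT); split => //.
  by apply/seteqP; split => // x _ j _.
- by apply/seteqP; split => // x _; exists 0%N.
- move=> A1 A2 [B1 [m1' e1 ->]] [B2 [m2' e2' ->]].
  exists (fun j => B1 j `&` B2 j); split.
  + by move=> j; exact: measurableI.
  + by rewrite e1 e2' setTI.
  + by rewrite -bigcapI; apply: eq_bigcapr => j _; rewrite preimage_setI.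
- move=> A [B [mB Bi ->]]; rewrite e2 /m1 /= /mrestr /=.
  pose B' j := if j == i then C else B j.
  have mB' j : measurable (B' j) by rewrite /B'; case: ifP.
  have -> : \bigcap_j (Y j @^-1` B j) `&` Y i @^-1` C = \bigcap_j (Y j @^-1` B' j).
    apply/seteqP; split => x.
      move=> [h1 h2] j _; rewrite /B' /preimage/=.
      by case: ifP => [/eqP ->//|_]; exact: h1.
    move=> h; split => [j _|]; last by have := h i I; rewrite /B' /preimage /= eqxx.
    have := h j I; rewrite /B' /preimage /=.
    by case: ifP => [/eqP ->|//]; rewrite Bi.
  rewrite (iY mB') (iY mB) (bigD1 i)//= [in RHS](bigD1 i)//= Bi preimage_setT probability_setT mul1e.
  rewrite {1}/B' eqxx; congr (_ * _)%E; apply: eq_bigr => j /negbTE ji.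
  by rewrite /B' ji.
- move=> _; rewrite /m1 /= /mrestr setTI.
  by rewrite ltey_eq fin_num_measure.
Qed.

Local Notation GT := (g_sigma_algebraType boxes_off).

Lemma measurable_box_fun j : j != i -> measurable_fun (setT : set GT) (Y j : GT -> R).
Proof.
move=> ji _ B mB; rewrite setTI; apply: sub_sigma_algebra.
exists (fun l => if l == j then B else setT); split.
- by move=> l; case: ifP.
- by rewrite eq_sym (negbTE ji).
- apply/seteqP; split => x; first by move=> xB l _; rewrite /preimage/=; case: ifP => [/eqP ->|].
  by move=> /(_ j I); rewrite /preimage/= eqxx.
Qed.

Lemma box_sigma_sub (E : set T) : <<s boxes_off >> E -> measurable E.
Proof.
apply: smallest_sub; first exact: sigma_algebra_measurable.
by move=> A [B [mB _ ->]]; exact: measurable_box.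
Qed.

Lemma box_fun_measurable (f : T -> R) : measurable_fun (setT : set GT) (f : GT -> R) ->
  measurable_fun setT f.
Proof.
move=> mf _ B mB; rewrite setTI; apply: box_sigma_sub.
by have := mf measurableT B mB; rewrite setTI.
Qed.

Lemma indep_sum_tl (f : T -> R) (mf : measurable_fun (setT : set GT) (f : GT -> R)) u :
  fine (P [set w | u < f w + Y i w]) =
  tl (conv (law P (box_fun_measurable mf)) (law P (mY i))) u.
Proof.
have mf' := box_fun_measurable mf.
have mp : measurable_fun setT (fun w => (f w, Y i w)) by exact: measurable_fun_pair.
pose mpm := isMeasurableFun.Build _ _ _ _ _ mp.
pose pf : {mfun T >-> (R * R)%type} := HB.pack (fun w => (f w, Y i w)) mpm.
pose m' : probability (R * R)%type R := distribution P pf.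
rewrite tl_def convE; congr fine.
rewrite (@product_measure_unique _ _ _ _ _ _ _ m').
- by [].
- move=> A B mA mB.
  rewrite [LHS](_ : _ = P (f @^-1` A `&` Y i @^-1` B)); last by [].
  rewrite indep_drop// 1?muleC//.
  by have := mf measurableT A mA; rewrite setTI.
- have ms : measurable_fun setT (fun p : R * R => p.1 + p.2) by exact: measurable_funD.
  by have := ms measurableT _ (measurable_gt u); rewrite setTI.
Qed.
End independence.

Section reach.
Context (R : realType).

(** Recursive in the last index, so that [ottaviani] can add one first passage at a time. *)
Fixpoint reach (T : Type) (Z : nat -> T -> R) (x : R) (i0 k : nat) : set T :=
  if k is j.+1 then
    (if (i0 <= j)%N then reach Z x i0 j `|` [set w | x < Z j w] else reach Z x i0 j)
  else set0.

Lemma reachP T (Z : nat -> T -> R) x i0 k w :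
  reach Z x i0 k w <-> exists j, [/\ (i0 <= j)%N, (j < k)%N & x < Z j w].
Proof.
elim: k => [|k IH] /=; first by split => // -[j []].
have [ik|ki] := leqP i0 k.
  split=> [[/IH [j [h1 h2 h3]]|h]|[j [h1 h2 h3]]].
  - by exists j; split => //; exact: ltnW.
  - by exists k.
  - move: h2; rewrite ltnS leq_eqVlt => /orP[/eqP e|jk]; [by right; rewrite /= -e|].
    by left; apply/IH; exists j.
rewrite IH; split=> -[j [h1 h2 h3]]; exists j; split => //; first exact: ltnW.
by move: h2; rewrite ltnS leq_eqVlt => /orP[/eqP e|//]; move: ki; rewrite ltnNge -e h1.
Qed.

Definition first_reach (T : Type) (Z : nat -> T -> R) (x : R) (i0 k : nat) : set T :=
  [set w | x < Z k w] `\` reach Z x i0 k.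

Lemma measurable_lt_fun d (T : measurableType d) (f : T -> R) x :
  measurable_fun setT f -> measurable [set w | x < f w].
Proof.
move=> mf; have := mf measurableT _ (measurable_gt x); rewrite setTI.
by congr measurable.
Qed.

Lemma measurable_reach d (T : measurableType d) (Z : nat -> T -> R) x i0 k :
  (forall j, (j < k)%N -> measurable_fun setT (Z j)) -> measurable (reach Z x i0 k).
Proof.
elim: k => [|k IH] mZ /=; first exact: measurable0.
have h : measurable (reach Z x i0 k) by apply: IH => j /ltnW/mZ.
case: ifP => // _; apply: measurableU => //.
by apply: measurable_lt_fun; exact: mZ.
Qed.

Fixpoint runmax (T : Type) (W : nat -> T -> R) (k : nat) (w : T) : R :=
  if k is j.+1 then Num.max (runmax W j w) (W k w) else W 0%N w.

Lemma runmax_gt T (W : nat -> T -> R) k x w : x < runmax W k w <-> reach W x 0 k.+1 w.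
Proof.
elim: k => [|k IH]; first by split; [right|case].
rewrite [runmax _ _ _]/= lt_max; split=> [/orP[/IH h|h]|[/IH ->//|/= ->]].
- by left.
- by right.
- by rewrite orbT.
Qed.

Lemma measurable_runmax d (T : measurableType d) (W : nat -> T -> R) k :
  (forall j, (j <= k)%N -> measurable_fun setT (W j)) -> measurable_fun setT (runmax W k).
Proof.
elim: k => [|k IH] h; first exact: h.
apply: measurable_maxr; last exact: h.
by apply: IH => j jk; apply: h; exact: leqW.
Qed.

Context d (T : measurableType d) (P : probability T R).
Definition pr (E : set T) : R := fine (P E).

Lemma pr_ge0 E : 0 <= pr E. Proof. exact: fine_ge0. Qed.

Lemma pr_le A B : measurable A -> measurable B -> A `<=` B -> pr A <= pr B.
Proof.
move=> mA mB AB; apply: fine_le; rewrite ?fin_num_measure//.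
by apply: le_measure; rewrite ?inE.
Qed.

Lemma prU A B : measurable A -> measurable B -> A `&` B = set0 ->
  pr (A `|` B) = pr A + pr B.
Proof. by move=> mA mB AB; rewrite /pr measureU// fineD// fin_num_measure. Qed.

Lemma pr_leU A B : measurable A -> measurable B -> pr (A `|` B) <= pr A + pr B.
Proof.
move=> mA mB; rewrite /pr -fineD ?fin_num_measure//; apply: fine_le.
- by rewrite fin_num_measure//; exact: measurableU.
- by rewrite fin_numD !fin_num_measure.
- exact: measureU2.
Qed.

(** Decompose by the first index [k] at which [x] is exceeded; if the path then loses less than [e]
    until [n], it ends above [x - e]. Independence enters only through the last hypothesis, which
    passage by passage bounds the probability of this from below. *)
Lemma ottaviani (S : nat -> T -> R) (n i0 : nat) (x e q : R) :
  (forall k, measurable_fun setT (S k)) -> 0 <= q -> q <= 1 -> 0 < e ->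
  (forall k, (i0 <= k)%N -> (k < n)%N ->
     q * pr (first_reach (fun j w => S j w - S 0 w) x i0 k) <=
       pr (first_reach (fun j w => S j w - S 0 w) x i0 k `&` [set w | - e < S n w - S k w])) ->
  q * pr (reach (fun j w => S j w - S 0 w) x i0 n.+1) <=
    pr [set w | x - e < S n w - S 0 w].
Proof.
move=> mS q0 q1 e0 h; pose Z := fun j w => S j w - S 0 w.
have mZ j : measurable_fun setT (Z j) by exact: measurable_funB.
pose A k := first_reach Z x i0 k.
pose F k := [set w | - e < S n w - S k w].
have mR k : measurable (reach Z x i0 k) by exact: measurable_reach.
have mA k : measurable (A k) by apply: measurableD => //; exact: measurable_lt_fun.
have mF k : measurable (F k) by apply: measurable_lt_fun; exact: measurable_funB.
pose G := [set w | x - e < Z n w].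
have mG : measurable G by exact: measurable_lt_fun.
have hk k : (k <= n.+1)%N -> q * pr (reach Z x i0 k) <= pr (G `&` reach Z x i0 k).
  elim: k => [|k IH kn]; first by rewrite /= setI0 /pr measure0 mulr0.
  have {}IH := IH (ltnW kn).
  rewrite /=; case: ifP => // ik.
  have -> : reach Z x i0 k `|` [set w | x < Z k w] = reach Z x i0 k `|` A k.
    apply/seteqP; split => w [] h1; [by left| |by left|by right; case: h1].
    by have [h2|h2] := pselect (reach Z x i0 k w); [left|right; split].
  have RA : reach Z x i0 k `&` A k = set0 by apply/seteqP; split => // w [h1 [_]].
  rewrite setIUr !prU//; first last.
  - by rewrite setIACA setIid RA setI0.
  - exact: measurableI.
  - exact: measurableI.
  rewrite mulrDr lerD//.
  apply: (@le_trans _ _ (pr (A k `&` F k))).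
    (* A first passage at the final index leaves a zero increment, which needs no hypothesis. *)
    move: kn; rewrite ltnS leq_eqVlt => /orP[/eqP ->|kn]; last exact: h.
    have -> : A n `&` F n = A n.
      by apply/setIidPl => w _; rewrite /F/= subrr oppr_lt0.
    by rewrite ler_piMl// pr_ge0.
  apply: pr_le; [exact: measurableI|exact: measurableI|].
  move=> w [[h1 h2] h3]; split => //; rewrite /G/= /Z.
  by move: h1 h3; rewrite /F/= /Z; lra.
apply: (le_trans (hk n.+1 (leqnn _))); apply: pr_le => //; exact: measurableI.
Qed.
End reach.

Section process.
Context (R : realType) d (T : measurableType d) (P : probability T R) (X : R -> T -> R).
Hypothesis hX : levy_process P X.

Let mX (t : {nonneg R}) : measurable_fun setT (X t%:num).
Proof. by have [_ h _ _ _] := hX; exact: h. Qed.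

Let mX' t : 0 <= t -> measurable_fun setT (X t).
Proof. by have [_ h _ _ _] := hX; exact: h. Qed.

Definition Xlaw (t : {nonneg R}) : probability R R := law P (mX t).

Lemma tl_law (Z : T -> R) (mZ : measurable_fun setT Z) x :
  tl (law P mZ) x = pr P [set w | x < Z w].
Proof. by rewrite tl_def. Qed.

Lemma tl_incr s r (t : {nonneg R}) x : 0 <= s -> r = s + t%:num ->
  pr P [set w | x < X r w - X s w] = tl (Xlaw t) x.
Proof.
move=> s0 ->; have [_ _ _ _ h] := hX.
rewrite tl_law /pr; congr fine.
exact: (h s t%:num s0 _ [set y | x < y] (measurable_gt x)).
Qed.

Lemma Xlaw0 x : 0 < x -> tl (Xlaw 0%:nng) (- x) = 1.
Proof.
move=> x0; have [X0 _ _ _ _] := hX; rewrite tl_law /pr.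
rewrite (_ : [set _ | _] = setT) ?probability_setT//.
by apply/seteqP; split => // w _ /=; rewrite X0 oppr_lt0.
Qed.

Lemma Xlaw_polar gamma sigma rho : has_char_exponent P X gamma sigma rho ->
  levy_polar rho gamma sigma Xlaw.
Proof.
move=> h t s p; have [hc hs] := h t%:num s (ge0 t).
have mc : bdm (fun w => cos (s * X t%:num w)).
  rewrite (_ : (fun w => _) = (fun x => cos (s * x + 0)) \o X t%:num).
    exact: (bdm_comp (mX t) (bdm_cos s 0)).
  by apply/funext => w /=; rewrite addr0.
have ms : bdm (fun w => sin (s * X t%:num w)).
  rewrite (_ : (fun w => _) = (fun x => cos (s * x + - (pi / 2))) \o X t%:num).
    exact: (bdm_comp (mX t) (bdm_cos s (- (pi / 2)))).
  by apply/funext => w /=; rewrite cosBpihalf.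
rewrite E_law; last exact: bdm_cos.
transitivity (\int[P]_w (cos p * cos (s * X t%:num w) + (- sin p) * sin (s * X t%:num w))).
  by apply: eq_Rintegral => w _; rewrite cosD; ring.
rewrite E_D; [|by apply: bdmM => //; exact: bdm_cst|by apply: bdmM => //; exact: bdm_cst].
rewrite E_Z// E_Z//.
by rewrite [X in cos p * X]hc [X in _ + _ * X]hs cosD; ring.
Qed.

Section grid.
Variables (t : nat -> R) (n : nat).
Hypotheses (t0 : forall k, 0 <= t k) (tS : forall k, (k < n)%N -> t k < t k.+1).
Local Notation Z := (fun j w => X (t j) w - X (t 0%N) w).

Lemma grid_mono i j : (i <= j)%N -> (j <= n)%N -> t i <= t j.
Proof.
elim: j => [|j IH]; first by rewrite leqn0 => /eqP ->.
rewrite leq_eqVlt => /orP[/eqP ->//|ij] jn.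
by apply: (le_trans (IH ij (ltnW jn))); exact/ltW/tS.
Qed.

Lemma grid_lt i j : (i < j)%N -> (j <= n)%N -> t i < t j.
Proof. by move=> ij jn; apply: (lt_le_trans (tS (leq_trans ij jn))); exact: grid_mono. Qed.

Lemma passage_indep i0 x e k : (k < n)%N ->
  let A := first_reach Z x i0 k in
  let F := [set w | - e < X (t n) w - X (t k) w] in
  P (A `&` F) = (P F * P A)%E.
Proof.
(* The times after [k] are merged, so that [X (t n) - X (t k)] is the last of [k + 1] independent
   increments, while [A] depends on the others. *)
move=> kn A F; pose t' j := if (j <= k)%N then t j else t n.
have t'0 : 0 <= t' 0%N by exact: t0.
have t'S j : (j < k.+1)%N -> t' j < t' j.+1.
  rewrite ltnS leq_eqVlt => /orP[/eqP ->|jk]; rewrite /t'.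
    by rewrite leqnn ltnn; exact: grid_lt.
  by rewrite (ltnW jk) jk; apply: tS; exact: ltn_trans kn.
have [_ _ _ hi _] := hX; have iY := hi k.+1 t' t'0 t'S.
pose Y (j : 'I_k.+1) w := X (t' j.+1) w - X (t' j) w.
have t'p j : 0 <= t' j by rewrite /t'; case: ifP.
have mY j : measurable_fun setT (Y j) by apply: measurable_funB; exact: mX'.
have YE : Y ord_max = (fun w => X (t n) w - X (t k) w).
  by apply/funext => w; rewrite /Y /t' /= leqnn ltnn.
have mZ j : (j <= k)%N ->
    @measurable_fun _ _ (g_sigma_algebraType (boxes_off Y ord_max)) R setT (Z j).
  elim: j => [_|j IH jk].
    rewrite (_ : Z 0%N = cst 0); first exact: measurable_cst.
    by apply/funext => w /=; rewrite subrr.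
  have jk' : (j < k.+1)%N by rewrite ltnS ltnW.
  have -> : Z j.+1 = (fun w => Z j w + Y (Ordinal jk') w).
    by apply/funext => w; rewrite /Y /t' /= jk (ltnW jk); ring.
  apply: measurable_funD; first by apply: IH; exact: ltnW.
  apply: measurable_box_fun; apply/eqP => /(congr1 val)/= e1.
  by move: jk; rewrite e1 ltnn.
have mA : <<s boxes_off Y ord_max >> A.
  apply: (@measurableD _ (g_sigma_algebraType (boxes_off Y ord_max))).
    by apply: measurable_lt_fun; exact: mZ.
  by apply: measurable_reach => j /ltnW; exact: mZ.
have := indep_drop mY iY mA (measurable_gt (- e)).
by rewrite YE.
Qed.

Lemma grid_ottaviani i0 x e q (s : {nonneg R}) : 0 <= q -> q <= 1 -> 0 < e ->
  (forall k (r : {nonneg R}), (i0 <= k)%N -> (k < n)%N -> r%:num = t n - t k ->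
     q <= tl (Xlaw r) (- e)) ->
  s%:num = t n - t 0%N ->
  q * pr P (reach Z x i0 n.+1) <= tl (Xlaw s) (x - e).
Proof.
move=> q0 q1 e0 h sE.
rewrite -(@tl_incr (t 0%N) (t n)); [|exact: t0|by rewrite sE addrC subrK].
apply: (@ottaviani _ _ _ P (fun k => X (t k)) n i0 x e q _ q0 q1 e0).
  by move=> k; exact: mX'.
move=> k ik kn; set A := first_reach _ _ _ _.
have mk j : measurable_fun setT (Z j) by apply: measurable_funB; exact: mX'.
have mA : measurable A.
  apply: measurableD; first exact: measurable_lt_fun.
  by apply: measurable_reach => j _; exact: mk.
have mF : measurable [set w | - e < X (t n) w - X (t k) w].
  by apply: measurable_lt_fun; apply: measurable_funB; exact: mX'.
rewrite [pr P (_ `&` _)]/pr passage_indep// fineM ?fin_num_measure//.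
apply: ler_wpM2r; first exact: pr_ge0.
have r0 : 0 <= t n - t k by rewrite subr_ge0 ltW// grid_lt.
have := h k (NngNum r0) ik kn erefl.
by rewrite -(@tl_incr (t k) (t n)) ?t0//= addrC subrK.
Qed.

Lemma measurable_Z j : measurable_fun setT (Z j).
Proof. by apply: measurable_funB; exact: mX'. Qed.

Lemma measurable_gridmax : measurable_fun setT (runmax Z n).
Proof. by apply: measurable_runmax => j _; exact: measurable_Z. Qed.

Definition gridmax : probability R R := law P measurable_gridmax.

Lemma tl_gridmax x : tl gridmax x = pr P (reach Z x 0 n.+1).
Proof.
rewrite tl_law; congr pr; apply/seteqP.
by split => w; [move=> h; apply/runmax_gt; exact: h|move=> h; apply/runmax_gt].
Qed.

Lemma start_indep (h : {nonneg R}) u : 0 < h%:num -> h%:num = t 0%N ->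
  pr P (reach (fun j w => X (t j) w) u 0 n.+1) = tl (conv (Xlaw h) gridmax) u.
Proof.
(* Time 0 is put in front of the grid, which makes [X (t 0)] the first increment, independent of the
   maximum of the later ones. *)
move=> h0 hE; pose t' j := if j is k.+1 then t k else 0.
have t'p j : 0 <= t' j by case: j.
have t'S j : (j < n.+1)%N -> t' j < t' j.+1 by case: j => [_|j jn]; [rewrite /= -hE|exact: tS].
have [X0 _ _ hi _] := hX; have iY := hi n.+1 t' (t'p 0%N) t'S.
pose Y (j : 'I_n.+1) w := X (t' j.+1) w - X (t' j) w.
have mY j : measurable_fun setT (Y j) by apply: measurable_funB; exact: mX'.
have Y0 w : Y ord0 w = X (t 0%N) w by rewrite /Y /= X0 subr0.
have mZ j : (j <= n)%N ->
    @measurable_fun _ _ (g_sigma_algebraType (boxes_off Y ord0)) R setT (Z j).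
  elim: j => [_|j IH jn].
    rewrite (_ : Z 0%N = cst 0); first exact: measurable_cst.
    by apply/funext => w /=; rewrite subrr.
  have jn' : (j.+1 < n.+1)%N by [].
  have -> : Z j.+1 = (fun w => Z j w + Y (Ordinal jn') w).
    by apply/funext => w; rewrite /Y /=; ring.
  apply: measurable_funD; first by apply: IH; exact: ltnW.
  exact: measurable_box_fun.
have mM : @measurable_fun _ _ (g_sigma_algebraType (boxes_off Y ord0)) R setT (runmax Z n).
  by apply: measurable_runmax.
have := indep_sum_tl mY iY mM u.
rewrite tl_convC (_ : [set w | _] = reach (fun j w => X (t j) w) u 0 n.+1); last first.
  apply/seteqP; split => w.
    move=> hw; have {hw} : u < runmax Z n w + Y ord0 w by exact: hw.
    rewrite Y0 -ltrBlDr => /runmax_gt/reachP[j [_ jn hj]].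
    by apply/reachP; exists j; split => //; lra.
  move=> /reachP[j [_ jn hj]]; change (u < runmax Z n w + Y ord0 w).
  rewrite Y0 -ltrBlDr; apply/runmax_gt/reachP.
  by exists j; split => //; lra.
move=> hh; rewrite /pr hh.
rewrite (@tl_conv_congl _ _ (Xlaw h)).
  by apply: tl_conv_congr => y; rewrite !tl_law.
move=> y; rewrite !tl_law; congr pr; apply/seteqP.
by split => w /=; rewrite Y0 hE.
Qed.

End grid.
End process.

(** * The supremum *)

Section sup.
Context (R : realType) d (T : measurableType d) (P : probability T R) (X : R -> T -> R).
Variables (gamma sigma : R) (rho : {measure set R -> \bar R}) (b : R).
Hypotheses (hrho : levy_measure rho) (hX : levy_process P X).
Hypothesis hch : has_char_exponent P X gamma sigma rho.
Hypotheses (s0 : 0 < sigma) (b0 : 0 < b) (b1 : b <= 1).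
Hypothesis hl : 0 < (rl rho (SP b))%:num.
Local Notation m := (rn rho (mSP b)).
Hypotheses (p0 : 0 < tl m (4 * b)) (hm : light_step m).
Local Notation neg := (neg_rate rho b).
Local Notation pi := (Xlaw hX).

Let hpi : levy_polar rho gamma sigma pi := Xlaw_polar hX hch.

Let mX t : 0 <= t -> measurable_fun setT (X t).
Proof. by have [_ h _ _ _] := hX; exact: h. Qed.

Lemma Xlaw_low : exists K q, [/\ 0 < K, 0 < q, q <= 1 &
  forall s : {nonneg R}, s%:num <= 1 -> q <= tl (pi s) (- K)].
Proof.
have [C C0 hC] := levy_lower_tail hrho s0 b0 b1 hpi hl.
have e0 := expR_gt0 (- neg).
have n0 : 0 <= neg by rewrite /neg_rate.
have e1 : expR (- neg) <= 1 by rewrite -[leRHS]expR0 ler_expR; lra.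
exists (2 * C + 1), (expR (- neg) / 2); split; [lra|lra|lra|].
move=> s s1; have [s00|s00] := eqVneq s%:num 0.
  have -> : s = 0%:nng by exact/val_inj.
  rewrite (Xlaw0 hX); last lra.
  lra.
have sp : 0 < s%:num by rewrite lt_neqAle eq_sym s00 /=.
have K0 : 0 < 2 * C + 1 by lra.
apply: le_trans (hC s _ sp s1 K0).
apply: ler_pM; [exact: ltW|lra| |].
  by rewrite ler_expR lerN2 ler_piMl.
have h : C * s%:num / (2 * C + 1) ^+ 2 <= 2^-1 by rewrite ler_pdivrMr ?exprn_gt0//; nra.
lra.
Qed.

Lemma first_rate_anti C s dl e : 0 <= C -> 0 < e -> 0 <= s -> s <= dl ->
  0 < first_rate rho b C dl e -> first_rate rho b C dl e <= first_rate rho b C s e.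
Proof.
move=> C0 e0 s00 sd; rewrite /first_rate pmulr_rgt0 ?expR_gt0// => h.
have n0 : 0 <= neg by rewrite /neg_rate.
apply: ler_pM; [exact: expR_ge0|exact: ltW| |].
  by rewrite ler_expR lerN2 ler_wpM2r.
rewrite lerB// ler_wpM2r ?invr_ge0 ?sqr_ge0//; exact: ler_wpM2l.
Qed.

(** The grid is cut at the first index [i] inside the last window. The later indices are handled
    with tolerance [e], the earlier ones with the fixed tolerance [K]. *)
Lemma max_dom_gridmax : exists C Cc K, [/\ 0 <= C, 0 <= Cc &
  forall (t : nat -> R) n (h : {nonneg R}) (t0 : forall k, 0 <= t k),
    (forall k, (k < n)%N -> t k < t k.+1) -> h%:num = t n - t 0%N -> h%:num <= 1 ->
    max_dom rho b pi C Cc K h (gridmax hX n t0)].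
Proof.
have [C C0 hC] := levy_lower_tail hrho s0 b0 b1 hpi hl.
have [K [q [K0 q0 q1 hq]]] := Xlaw_low.
(* One [q] and one [K] come from Ottaviani's inequality on the early grid, the others from passing
   from its last point to the time [h'], which need not lie on the grid. *)
exists C, (q ^- 2), (2 * K); split => //; first by rewrite invr_ge0 sqr_ge0.
move=> t n h t0 tS hE h1 x dl e h' dl0 h'E h'0 e0 f0; rewrite tl_gridmax.
set Z := fun j w => _.
have mZ j : measurable_fun setT (Z j) by exact: (measurable_Z hX t0).
have n0 : 0 <= neg by rewrite /neg_rate.
have exi : exists i, t n - dl < t i by exists n; lra.
have [i i_gt i_min] := ex_minnP exi.
have i_n : (i <= n)%N by apply: i_min; lra.
have i0 : (0 < i)%N by rewrite lt0n; apply/eqP => e'; move: i_gt; rewrite e'; lra.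
have ti : t i.-1 <= t n - dl.
  rewrite leNgt; apply/negP => /i_min; rewrite -ltnS prednK// ltnn//.
pose i1 := i.-1; have iE : i = i1.+1 by rewrite prednK.
have i1n : (i1 < n)%N by rewrite -iE.
have mono := grid_mono tS.
have sub : reach Z x 0 n.+1 `<=` reach Z x i n.+1 `|` reach Z x 0 i1.+1.
  move=> w /reachP[j [_ jn hj]]; have [ij|ji] := leqP i j.
    by left; apply/reachP; exists j.
  by right; apply/reachP; exists j; rewrite -iE.
have mR k l : measurable (reach Z x k l) by apply: measurable_reach.
apply: (le_trans (pr_le P (mR _ _) (measurableU _ _ (mR _ _) (mR _ _)) sub)).
apply: (le_trans (pr_leU P (mR _ _) (mR _ _))).
apply: lerD.
  rewrite mulrC ler_pdivlMr// mulrC.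
  apply: (@grid_ottaviani _ _ _ _ _ hX t n t0 tS i x e _ h (ltW f0) _ e0) => //.
    rewrite /first_rate mulr_ile1 ?expR_ge0//.
    + by move: f0; rewrite /first_rate pmulr_rgt0 ?expR_gt0// => /ltW.
    + by rewrite -[leRHS]expR0 ler_expR oppr_le0 mulr_ge0// ltW.
    + by rewrite gerBl divr_ge0 ?sqr_ge0// mulr_ge0// ltW.
  move=> k r ik kn rE.
  have tk := grid_lt tS kn (leqnn n); have tik := mono i k ik (ltnW kn).
  have r0 : 0 < r%:num by rewrite rE; lra.
  have rd : r%:num <= dl by rewrite rE; lra.
  have r1 : r%:num <= 1 by lra.
  apply: le_trans (hC r e r0 r1 e0).
  exact: (first_rate_anti C0 e0 (ltW r0) rd f0).
have s00 : 0 <= t i1 - t 0%N by rewrite subr_ge0; apply: mono => //; exact: ltnW.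
have r00 : 0 <= h'%:num - (t i1 - t 0%N) by rewrite h'E hE; move: ti; rewrite -/i1; lra.
pose s : {nonneg R} := NngNum s00; pose r : {nonneg R} := NngNum r00.
have tS' k : (k < i1)%N -> t k < t k.+1 by move=> ki; apply: tS; exact: ltn_trans i1n.
have O : q * pr P (reach Z x 0 i1.+1) <= tl (pi s) (x - K).
  apply: (@grid_ottaviani _ _ _ _ _ hX t i1 t0 tS' 0 x K q s (ltW q0) q1 K0) => // k r' _ ki r'E.
  apply: hq; rewrite r'E; have := mono 0%N k (leq0n _) (ltnW (ltn_trans ki i1n)).
  have := mono i1 n (ltnW i1n) (leqnn _); lra.
have h'E2 : h'%:num = s%:num + r%:num by rewrite /= addrC subrK.
have rq : q <= tl (pi r) (- K) by apply: hq; rewrite /=; lra.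
have M := tl_conv_mul (pi s) (pi r) (x - K) (- K).
rewrite (levy_semigroup hrho s0 b0 b1 hpi _ h'0 h'E2) in M.
have xK : x - K - K = x - 2 * K by ring.
rewrite xK in M.
have M2 : tl (pi s) (x - K) * q <= tl (pi h') (x - 2 * K).
  by apply: le_trans M; apply: ler_wpM2l rq; exact: tl_ge0.
rewrite mulrC ler_pdivlMr ?exprn_gt0//; apply: le_trans M2.
by rewrite expr2 mulrA ler_wpM2r ?(ltW q0)// mulrC.
Qed.

(** The threshold [u0] is chosen before the grid; this uniformity is what permits refining the grid
    for fixed [u]. *)
Lemma grid_sup_le (h one : {nonneg R}) eta : h%:num = 1 / 2 -> one%:num = 1 ->
  0 < eta -> eta <= 1 ->
  exists u0, forall u, u0 <= u -> forall (t : nat -> R) n, (forall k, 0 <= t k) ->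
    (forall k, t k < t k.+1) -> t 0%N = 0 -> t n = 1 / 2 -> t (n + n)%N = 1 ->
    pr P (reach (fun j w => X (t j) w) u 0 (n + n).+1) <= (1 + eta) * tl (pi one) u.
Proof.
move=> hE oneE eta0 eta1.
have h0 : 0 < h%:num by rewrite hE; lra.
have [C [Cc [K [C0 Cc0 hdom]]]] := max_dom_gridmax.
have [K' [q [K'0 q0 q1 hq]]] := Xlaw_low.
have e2 : 0 < eta / 2 by lra.
have e21 : eta / 2 <= 1 by lra.
have [u1 hu1] := max_tail hrho s0 b0 b1 hpi hl p0 hm K C0 Cc0 hE oneE e2 e21.
have qe : 0 < q * (eta / 2) by rewrite mulr_gt0.
have oneE' : one%:num = h%:num + h%:num by rewrite hE oneE; lra.
have [u2 hu2] := @levy_time_lt _ _ hrho gamma _ _ s0 b0 b1 _ hpi hl p0 hm h h one K' _ h0 h0 oneE' oneE qe.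
exists (Num.max u1 u2) => u; rewrite ge_max => /andP[hu hu'] t n t0 tS t00 tn tnn.
have [X0 _ _ _ _] := hX.
pose t' k := t (n + k)%N.
have t'0 k : 0 <= t' k by exact: t0.
have t'S k : (k < n)%N -> t' k < t' k.+1 by move=> _; rewrite /t' addnS.
have hE' : h%:num = t' n - t' 0%N by rewrite /t' addn0 tn tnn hE; lra.
have hE'' : h%:num = t' 0%N by rewrite /t' addn0 tn hE.
have h1 : h%:num <= 1 by rewrite hE; lra.
have second := hu1 u hu _ (hdom t' n h t'0 t'S hE' h1).
rewrite -(start_indep hX t'0 t'S u h0 hE'') in second.
have hE3 : h%:num = t n - t 0%N by rewrite tn t00 subr0.
have tS' k : (k < n)%N -> t k < t k.+1 by move=> _.
have first : q * pr P (reach (fun j w => X (t j) w - X (t 0%N) w) u 0 n.+1) <= tl (pi h) (u - K').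
  apply: (@grid_ottaviani _ _ _ _ _ hX t n t0 tS' 0 u K' q h (ltW q0) q1 K'0) => // k r _ kn rE.
  apply: hq; rewrite rE tn; have := t0 k; lra.
have m1 : measurable (reach (fun j w => X (t j) w - X (t 0%N) w) u 0 n.+1).
  by apply: measurable_reach => j _; exact: (measurable_Z hX t0).
have m2 : measurable (reach (fun j w => X (t' j) w) u 0 n.+1).
  by apply: measurable_reach => j _; exact: mX.
have m3 : measurable (reach (fun j w => X (t j) w) u 0 (n + n).+1).
  by apply: measurable_reach => j _; exact: mX.
have sub : reach (fun j w => X (t j) w) u 0 (n + n).+1 `<=`
    reach (fun j w => X (t j) w - X (t 0%N) w) u 0 n.+1 `|` reach (fun j w => X (t' j) w) u 0 n.+1.
  move=> w /reachP[j [_ jn hj]]; have [jn'|nj] := leqP j n.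
    by left; apply/reachP; exists j; split => //; rewrite t00 X0 subr0.
  right; apply/reachP; exists (j - n)%N; split => //.
    by rewrite ltnS leq_subLR.
  by rewrite /t' subnKC// ltnW.
apply: (le_trans (pr_le P m3 (measurableU _ _ m1 m2) sub)).
apply: (le_trans (pr_leU P m1 m2)).
have third := le_trans first (hu2 u hu').
have {}third : pr P (reach (fun j w => X (t j) w - X (t 0%N) w) u 0 n.+1) <= eta / 2 * tl (pi one) u.
  by move: third; rewrite -[X in _ <= X]mulrA ler_pM2l.
have -> : (1 + eta) * tl (pi one) u = eta / 2 * tl (pi one) u + (1 + eta / 2) * tl (pi one) u by field.
exact: lerD.
Qed.

(** The mesh is [2 ^ - (N + 1)], so that 1/2 is a grid point from [N = 0] on. *)
Definition dyadic (N k : nat) : R := k%:R / (2 ^ N.+1)%:R.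

(** By right-continuity, a value above [u] at a time [t < 1] persists at dyadic times just after
    [t]; the time 1 is itself dyadic. *)
Lemma sup_dyadic u : [set w | exists2 t : R, 0 <= t <= 1 & u < X t w] =
  \bigcup_N reach (fun j w => X (dyadic N j) w) u 0 (2 ^ N.+1).+1.
Proof.
have p2 N : 0 < (2 ^ N.+1)%:R :> R by rewrite ltr0n expn_gt0.
apply/seteqP; split => w.
  move=> [t /andP[t0 t1] hu].
  move: t1; rewrite le_eqVlt => /predU1P[tE|t1].
    exists 0%N; first exact: I.
    apply: (proj2 (reachP _ _ _ _ _)); exists 2%N; split => //.
    by rewrite /dyadic expn1 divff ?pnatr_eq0// -tE.
  have [_ _ hr _ _] := hX; have [rc _] := hr w t t0.
  have xu : 0 < X t w - u by rewrite subr_gt0.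
  have [dl /= dl0 hdl] := (cvgrPdist_lt _ _).1 rc _ xu.
  pose e := Num.min dl (1 - t); have e0 : 0 < e by rewrite lt_min dl0 subr_gt0.
  have edl : e <= dl by rewrite ge_min lexx.
  have e1t : e <= 1 - t by rewrite ge_min lexx orbT.
  pose N := Num.truncn (e^-1).
  have eN : e^-1 < (2 ^ N.+1)%:R.
    have ie0 : 0 <= e^-1 by rewrite invr_ge0 ltW.
    have /andP[_ h] := truncn_itv ie0.
    by apply: (lt_trans h); rewrite ltr_nat ltn_expl.
  have {}eN : 1 < e * (2 ^ N.+1)%:R by rewrite mulrC -ltr_pdivrMr// mul1r.
  have tM : 0 <= t * (2 ^ N.+1)%:R by rewrite mulr_ge0// ltW.
  have /andP[j1 j2] := truncn_itv tM; set j := (Num.truncn _).+1 in j2.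
  rewrite -ltr_pdivlMr// -/(dyadic N j) in j2.
  have j3 : dyadic N j < t + e.
    rewrite /dyadic ltr_pdivrMr// mulrDl /j -natr1; lra.
  exists N; first exact: I.
  apply/(reachP (fun j w => X (dyadic N j) w) u 0 (2 ^ N.+1).+1 w); exists j; split => //.
    rewrite ltnS -(ler_nat R) -[leRHS]mul1r -ler_pdivrMr// -/(dyadic N j).
    by apply: ltW; lra.
  have := hdl (dyadic N j); rewrite /ball/= ltr0_norm ?subr_lt0// opprB => /(_ _ j2).
  have h1 : dyadic N j - t < dl by lra.
  by move=> /(_ h1) /(le_lt_trans (ler_norm _)); lra.
move=> [N _ /reachP[j [_ jn hj]]]; exists (dyadic N j) => //.
rewrite /dyadic divr_ge0//= ler_pdivrMr// mul1r ler_nat.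
by rewrite -ltnS.
Qed.

Lemma dyadic_ge0 N k : 0 <= dyadic N k.
Proof. by rewrite /dyadic divr_ge0. Qed.

Let DR (u : R) N := reach (fun j w => X (dyadic N j) w) u 0 (2 ^ N.+1).+1.

Let mDR u N : measurable (DR u N).
Proof. by apply: measurable_reach => j _; apply: mX; exact: dyadic_ge0. Qed.

Lemma measurable_sup u : measurable [set w | exists2 t : R, 0 <= t <= 1 & u < X t w].
Proof. by rewrite sup_dyadic; apply: bigcupT_measurable => N; exact: mDR. Qed.

(** The dyadic grids are nested, so the probabilities increase to that of the union. *)
Lemma pr_sup_le u M : (forall N, pr P (DR u N) <= M) ->
  pr P [set w | exists2 t : R, 0 <= t <= 1 & u < X t w] <= M.
Proof.
move=> hM; rewrite sup_dyadic /pr.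
have mU : measurable (\bigcup_N DR u N) by exact: bigcupT_measurable.
have nd : nondecreasing_seq (DR u).
  apply/nondecreasing_seqP => N; apply/subsetPset => w /reachP[j [_ jn hj]].
  apply/(reachP (fun j w => X (dyadic N.+1 j) w) u 0 (2 ^ N.+2).+1 w).
  exists (2 * j)%N; split => //; first by rewrite ltnS expnS leq_mul2l.
  suff -> : dyadic N.+1 (2 * j) = dyadic N j by [].
  rewrite /dyadic [(2 ^ N.+2)%N]expnS !natrM invfM mulrACA divff ?mul1r//.
have fin A : measurable A -> P A \is a fin_num by move=> mA; rewrite fin_num_measure.
rewrite -lee_fin fineK ?fin//.
have h := nondecreasing_cvg_mu (mu := P) (mDR u) mU nd.
rewrite -(cvg_lim _ h)//; apply: lime_le; first by apply/cvg_ex; exists (P (\bigcup_N DR u N)).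
apply: nearW => N /=; rewrite -(fineK (fin _ (mDR u N))) lee_fin; exact: hM.
Qed.

Lemma sup_ratio : (fun u : R => pr P [set w | exists2 t : R, 0 <= t <= 1 & u < X t w] /
  pr P [set w | u < X 1 w]) @ +oo --> (1 : R).
Proof.
apply/cvgrPdist_le => e e0.
have h0 : 0 <= (1 / 2 : R) by lra.
pose h : {nonneg R} := NngNum h0; pose one : {nonneg R} := NngNum (@ler01 R).
pose eta := Num.min e 1.
have eta0 : 0 < eta by rewrite lt_min e0 ltr01.
have eta1 : eta <= 1 by rewrite ge_min lexx orbT.
have etae : eta <= e by rewrite ge_min lexx.
have [u0 hu0] := @grid_sup_le h one eta erefl erefl eta0 eta1.
exists u0; split; first exact: num_real.
move=> u /ltW u0u.
have tlE1 : pr P [set w | u < X 1 w] = tl (pi one) u by rewrite tl_law.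
have q0 : 0 < tl (pi one) u.
  have [k [c [c0 hc]]] := levy_upper_lower hrho s0 b0 b1 hpi hl u.
  have := hc one ltr01 (lexx 1); rewrite expr1n mulr1; exact: lt_le_trans.
have up : pr P [set w | exists2 t : R, 0 <= t <= 1 & u < X t w] <= (1 + eta) * tl (pi one) u.
  apply: pr_sup_le => N.
  have nn : (2 ^ N.+1 = 2 ^ N + 2 ^ N)%N by rewrite expnS mul2n addnn.
  rewrite /DR nn; apply: hu0 => //.
  - exact: dyadic_ge0.
  - by move=> k; rewrite /dyadic ltr_pM2r ?invr_gt0 ?ltr0n ?expn_gt0// ltr_nat.
  - by rewrite /dyadic mul0r.
  - by rewrite /dyadic expnS natrM invfM mulrCA divff ?mulr1 ?div1r// pnatr_eq0 expn_eq0.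
  - by rewrite /dyadic -nn divff// pnatr_eq0 expn_eq0.
have low : tl (pi one) u <= pr P [set w | exists2 t : R, 0 <= t <= 1 & u < X t w].
  rewrite -tlE1; apply: pr_le; [|exact: measurable_sup|].
    by apply: measurable_lt_fun; exact: mX.
  by move=> w /= uw; exists 1 => //; rewrite ler01 lexx.
rewrite /= tlE1 ler0_norm; last by rewrite subr_le0 ler_pdivlMr// mul1r.
rewrite opprB lerBlDr ler_pdivrMr//; apply: (le_trans up).
by apply: ler_wpM2r; [exact: ltW|lra].
Qed.

End sup.

Theorem theorem1 (R : realType) (d : measure_display) (T : measurableType d)
    (P : probability T R) (X : R -> T -> R) (gamma sigma : R)
    (rho : {measure set R -> \bar R}) :
  levy_measure rho ->
  levy_process P X ->
  has_char_exponent P X gamma sigma rho ->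
  0 < sigma ->
  (0 < rho [set x : R | (0 < x)%R])%E ->
  (rho [set x : R | (x < 0)%R] < +oo)%E ->
  (exists a : R, [/\ 0 < a, (0 < rho [set x : R | (a < x)%R])%E &
     exists mu : probability R R,
       (forall B : set R, measurable B ->
          mu B = (fine (rho (B `&` [set x | a < x])) /
                  fine (rho [set x | a < x]))%:E) /\
       light_right_tail mu]) ->
  (fun u : R => fine (P [set w | exists2 t : R, 0 <= t <= 1 & u < X t w]) /
                fine (P [set w | u < X 1 w]))
    @ +oo --> (1 : R).
Proof.
move=> hrho hX hch s0 _ _ [a [a0 a1 [mu [hmu light]]]].
(* [4 * b <= a] leaves mass above [4 * b]; [b <= 1] keeps all small jumps within the range that
   [psi_im] compensates. *)
pose b := Num.min (a / 4) 1.
have b0 : 0 < b by rewrite lt_min divr_gt0//=.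
have b1 : b <= 1 by rewrite ge_min lexx orbT.
have ba : 4 * b <= a.
  have : b <= a / 4 by rewrite ge_min lexx.
  lra.
exact: (sup_ratio hrho hX hch s0 b0 b1 (rl_SP_gt0 hrho b0 ba a1)
  (tl_rn_SP_gt0 hrho b0 ba a1) (light_step_rn hrho b0 ba a1 hmu light)).
Qed.
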